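(* Let $A$ be a continuous, $\sigma$-unital $C_0(X)$-algebra with base map $\phi$ and let $x\in X_\phi$. Then the following are equivalent: (i) $H_x$ is strictly closed in $M(A)$; (ii) either $x\in U_\phi$, or $x\in\mathrm{Int}\,W_\phi$ and $x$ is a P-point in $X_\phi$.
   Context: For a C$^*$-algebra $A$, $\mathrm{Prim}(A)$ is the primitive ideal space with the hull-kernel topology, $M(A)$ is the multiplier algebra and $Z(M(A))$ its centre. $A$ is a $C_0(X)$-algebra with base map $\phi$ if $X$ is a locally compact Hausdorff space and $\phi:\mathrm{Prim}(A)\to X$ is continuous; $X_\phi$ denotes the image of $\phi$ with the subspace topology. For a closed two-sided ideal $J$ of $A$, $\tilde J=\{b\in M(A): ba,ab\in J \text{ for all } a\in A\}$. If $P\in\mathrm{Prim}(A)$ then $\tilde P\in\mathrm{Prim}(M(A))$, and $P\mapsto\tilde P$ is a homeomorphism onto a dense open subset of $\mathrm{Prim}(M(A))$. The map $\phi$ has a unique extension to a continuous map $\overline\phi:\mathrm{Prim}(M(A))\to\beta X$ (the Stone-Čech compactification) with $\overline\phi(\tilde P)=\phi(P)$ for all $P\in\mathrm{Prim}(A)$. For $x\in X_\phi$ put $J_x=\bigcap\{P\in\mathrm{Prim}(A):\phi(P)=x\}$ and $H_x=\bigcap\{Q\in\mathrm{Prim}(M(A)):\overline\phi(Q)=x\}$; for $x\in X\setminus X_\phi$ put $J_x=A$. ''Strictly closed'' means closed in the strict topology of $M(A)$. The $C_0(X)$-algebra $A$ is continuous if for every $a\in A$ the function $x\mapsto\Vert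 a+J_x\Vert$ is continuous on $X$ (equivalently, by Lee's theorem, $\phi$ is open). Let $\theta_A:C^b(\mathrm{Prim}(A))\to Z(M(A))$ be the Dauns-Hofmann isomorphism, characterized by $\theta_A(f)a+P=f(P)(a+P)$ for $f\in C^b(\mathrm{Prim}(A))$, $a\in A$, $P\in\mathrm{Prim}(A)$. Let $\mu:C_0(X)\to Z(M(A))$, $\mu(f)=\theta_A(f\circ\phi)$, and $Z'(A)=\mu(C_0(X))\cap A$. Put $U_\phi=\{x\in X_\phi:J_x\not\supseteq Z'(A)\}$ (an open subset of $X_\phi$) and $W_\phi=X_\phi\setminus U_\phi$; $\mathrm{Int}\,W_\phi$ is the interior of $W_\phi$ in $X_\phi$. A point $x$ of a completely regular Hausdorff space is a P-point if every continuous real-valued function on the space vanishing at $x$ vanishes in a neighbourhood of $x$. *)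

(* Defs.v *)
From HB Require Import structures.
From mathcomp Require Import all_boot all_order all_algebra.
From mathcomp Require Import sesquilinear.
From mathcomp Require Import complex.
From mathcomp Require Import all_classical all_reals all_analysis.

Set Implicit Arguments.
Unset Strict Implicit.
Unset Printing Implicit Defensive.

Import Order.TTheory GRing.Theory Num.Theory.
Import numFieldNormedType.Exports.

Local Open Scope classical_set_scope.
Local Open Scope ring_scope.

(* Not necessarily unital, hence not an instance of the library's algebras. *)
HB.mixin Record isStarAlgebra (C : numClosedFieldType) A
    of GRing.Lmodule C A := {
  smul : A -> A -> A;
  star : A -> A;
  smulA : forall a b c, smul a (smul b c) = smul (smul a b) c;
  smulDl : forall a b c, smul (a + b) c = smul a c + smul b c;
  smulDr : forall a b c, smul a (b + c) = smul a b + smul a c;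
  scale_smull : forall (k : C) a b, smul (k *: a) b = k *: smul a b;
  scale_smulr : forall (k : C) a b, smul a (k *: b) = k *: smul a b;
  starK : forall a, star (star a) = a;
  starD : forall a b, star (a + b) = star a + star b;
  starZ : forall (k : C) a, star (k *: a) = k^* *: star a;
  starM : forall a b, star (smul a b) = smul (star b) (star a)
}.

#[short(type="starAlgType")]
HB.structure Definition StarAlgebra (C : numClosedFieldType) :=
  {A of GRing.Lmodule C A & isStarAlgebra C A}.

Declare Scope starAlg_scope.
Delimit Scope starAlg_scope with SA.
Notation "a ** b" := (smul a b) (at level 40, left associativity)
  : starAlg_scope.
Local Open Scope starAlg_scope.

HB.mixin Record isCStar (R : realType) A
    of StarAlgebra R[i] A & CompleteNormedModule R[i] A := {
  norm_smul : forall a b : A, `|a ** b| <= `|a| * `|b|;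
  norm_star_smul : forall a : A, `|star a ** a| = `|a| ^+ 2
}.

#[short(type="cstarAlgType")]
HB.structure Definition CStarAlgebra (R : realType) :=
  {A of StarAlgebra R[i] A & CompleteNormedModule R[i] A & isCStar R A}.

Section primitive_ideals.
Variables (R : realType) (B : starAlgType R[i]).
Local Notation C := R[i].

(* A nonzero topologically irreducible *-representation of B by bounded
   operators on the Hilbert space (H, ip). *)
Record irreducible_rep (H : completeNormedModType C)
    (ip : {dot H for (@Num.conj C)}) (pi : B -> H -> H) : Prop := {
  hilbert_norm : forall u, ip u u = `|u| ^+ 2;
  rep_linear : forall b, linear (pi b);
  rep_continuous : forall b, continuous (pi b);
  repD : forall a b u, pi (a + b) u = pi a u + pi b u;
  repZ : forall k b u, pi (k *: b) u = k *: pi b u;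
  repM : forall a b u, pi (a ** b) u = pi a (pi b u);
  rep_star : forall b u v, ip (pi (star b) u) v = ip u (pi b v);
  rep_nonzero : exists b u, pi b u != 0;
  rep_irreducible : forall V : set H, closed V -> V 0 ->
    (forall k u v, V u -> V v -> V (k *: u + v)) ->
    (forall b u, V u -> V (pi b u)) -> V = [set 0] \/ V = setT
}.

Lemma rep0 (H : completeNormedModType C) (ip : {dot H for (@Num.conj C)}) pi b :
  irreducible_rep ip pi -> pi b 0 = 0.
Proof.
move=> rp; have := rep_linear rp b 1 0 0.
by rewrite !scale1r addr0 -[LHS]addr0 => /addrI.
Qed.

Definition primitive_ideal (P : set B) : Prop :=
  exists (H : completeNormedModType C) (ip : {dot H for (@Num.conj C)})
    (pi : B -> H -> H),
    irreducible_rep ip pi /\ P = [set b | forall u, pi b u = 0].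

Record Prim : Type :=
  PrimIdeal { prim_ideal :> set B; prim_idealP : primitive_ideal prim_ideal }.

HB.instance Definition _ := gen_eqMixin Prim.
HB.instance Definition _ := gen_choiceMixin Prim.

Definition hull (I : set B) : set Prim := [set P | I `<=` prim_ideal P].
Definition ker_of (S : set Prim) : set B :=
  \bigcap_(P in S) prim_ideal P.

(* U is open iff its complement F satisfies hull (ker_of F) = F; the other
   inclusion is automatic. *)
Definition hk_open (U : set Prim) : Prop := hull (ker_of (~` U)) `<=` ~` U.

Lemma prim_ideal_lr (P : Prim) (a b : B) :
  prim_ideal P a -> prim_ideal P (a ** b) /\ prim_ideal P (b ** a).
Proof.
case: (prim_idealP P) => H [ip [pi [rp ->]]] /= Pa.
by split => u; rewrite (repM rp) !Pa ?(rep0 _ rp).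
Qed.

Lemma prim_ideal_prime (P : Prim) (I J : set B) :
  (forall a b, I a -> I (a ** b)) ->
  (forall a b, I a -> J b -> prim_ideal P (a ** b)) ->
  I `<=` prim_ideal P \/ J `<=` prim_ideal P.
Proof.
case: (prim_idealP P) => H [ip [pi [rp ->]]] /= Ir IJ.
pose V := \bigcap_(a in I) (pi a @^-1` [set 0]).
have [| | | |V0|VT] := rep_irreducible rp (V := V).
- apply: closed_bigI => a _; apply: preimage_closed.
    by move=> u _; exact: (rep_continuous rp).
  exact/accessible_closed_set1/hausdorff_accessible/norm_hausdorff.
- by move=> a _ /=; rewrite (rep0 _ rp).
- move=> k u v Vu Vv a Ia /=.
  by rewrite (rep_linear rp) (Vu a Ia) (Vv a Ia) scaler0 addr0.
- by move=> b u Vu a Ia /=; rewrite -(repM rp) (Vu _ (Ir a b Ia)).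
- right=> b Jb u; have : V (pi b u).
    by move=> a Ia /=; rewrite -(repM rp) (IJ a b Ia Jb).
  by rewrite V0.
- by left=> a Ia u; have : V u by [rewrite VT]; apply.
Qed.

Lemma hk_openT : hk_open setT.
Proof.
move=> P PT; case: (prim_idealP P) => H [ip [pi [rp E]]] _.
have [b [u /eqP]] := rep_nonzero rp; apply.
suff : prim_ideal P b by rewrite E; apply.
by apply: PT => Q [].
Qed.

Lemma hk_openI : setI_closed hk_open.
Proof.
move=> U V oU oV P PUV [PU PV].
have ker_lr (S : set Prim) a b :
    ker_of S a -> ker_of S (a ** b) /\ ker_of S (b ** a).
  by move=> Sa; split => Q SQ; have [] := prim_ideal_lr b (Sa Q SQ).
have [||h|h] := @prim_ideal_prime P (ker_of (~` U)) (ker_of (~` V)).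
- by move=> a b Ua; exact: (ker_lr _ _ b Ua).1.
- move=> a b Ua Vb; apply: PUV => Q /not_andP[/= nU|/= nV].
    exact: (ker_lr _ _ b Ua).1.
  exact: (ker_lr _ _ a Vb).2.
- exact: (oU P h).
- exact: (oV P h).
Qed.

Lemma hk_open_bigU (I : Type) (f : I -> set Prim) :
  (forall i, hk_open (f i)) -> hk_open (\bigcup_i f i).
Proof.
move=> of_ P Pf [i _ fiP]; apply: (of_ i P _ fiP) => a ka.
by apply: Pf => Q nQ; apply: ka => fiQ; apply: nQ; exists i.
Qed.

HB.instance Definition _ :=
  isOpenTopological.Build Prim hk_openT hk_openI hk_open_bigU.

End primitive_ideals.
Arguments ker_of {R B} S.

Section multiplier_algebra.
Variables (R : realType) (A : cstarAlgType R).
Local Notation C := R[i].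

Definition bounded_operator (L : A -> A) : Prop :=
  exists2 k : C, 0 <= k & forall a, `|L a| <= k * `|a|.

(* A multiplier m is encoded by (L, R) = (a |-> m a, a |-> a m). *)
Record double_centralizer (m : (A -> A) * (A -> A)) : Prop := {
  dc_linearl : linear m.1;
  dc_linearr : linear m.2;
  dc_boundedl : bounded_operator m.1;
  dc_boundedr : bounded_operator m.2;
  dc_left : forall a b, m.1 (a ** b) = m.1 a ** b;
  dc_right : forall a b, m.2 (a ** b) = a ** m.2 b;
  dc_mid : forall a b, m.2 a ** b = a ** m.1 b
}.

Definition dc_pred : {pred (A -> A) * (A -> A)} :=
  fun m => `[< double_centralizer m >].

Lemma smul0 (a : A) : a ** 0 = 0.
Proof. by apply: (addrI (a ** 0)); rewrite -smulDr !addr0. Qed.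

Lemma smul0l (a : A) : 0 ** a = 0.
Proof. by apply: (addrI (0 ** a)); rewrite -smulDl !addr0. Qed.

Lemma bounded_operatorD k f g : bounded_operator f -> bounded_operator g ->
  bounded_operator (k *: f + g).
Proof.
move=> [x x0 fx] [y y0 gy]; exists (`|k| * x + y).
  by rewrite addr_ge0// mulr_ge0.
move=> a; rewrite mulrDl (le_trans (ler_normD _ _))// lerD// normrZ -mulrA.
by rewrite ler_wpM2l.
Qed.

Lemma bounded_operator_comp f g : bounded_operator f -> bounded_operator g ->
  bounded_operator (f \o g).
Proof.
move=> [x x0 fx] [y y0 gy]; exists (x * y); first exact: mulr_ge0.
by move=> a; rewrite (le_trans (fx _))// -mulrA ler_wpM2l.
Qed.

Lemma norm_star (a : A) : `|star a| = `|a|.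
Proof.
suff le_star (b : A) : `|b| <= `|star b|.
  by apply/le_anti/andP; split; rewrite // -{2}(starK a).
have [->|b0] := eqVneq b 0; first by rewrite normr0.
have nb : 0 < `|b| by rewrite normr_gt0.
by rewrite -(ler_pM2r nb) -expr2 -norm_star_smul norm_smul.
Qed.

Lemma bounded_operator_star f : bounded_operator f ->
  bounded_operator (star \o f \o star).
Proof.
by move=> [x x0 fx]; exists x => // a /=; rewrite norm_star (le_trans (fx _))// norm_star.
Qed.

Lemma dc_submod_closed : submod_closed dc_pred.
Proof.
split.
  apply/asboolP; split => /=.
  - by move=> k u v /=; rewrite scaler0 addr0.
  - by move=> k u v /=; rewrite scaler0 addr0.
  - by exists 0 => // a; rewrite normr0 mul0r.
  - by exists 0 => // a; rewrite normr0 mul0r.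
  - by move=> a b; rewrite smul0l.
  - by move=> a b; rewrite smul0.
  - by move=> a b; rewrite smul0 smul0l.
move=> k m n /asboolP[ml mr mbl mbr m1 m2 m3] /asboolP[nl nr nbl nbr n1 n2 n3].
apply/asboolP; split => /=.
- move=> x u v; rewrite !fctE ml nl /= !scalerDr !scalerA (mulrC k).
  by rewrite -!addrA; congr (_ + _); rewrite addrCA.
- move=> x u v; rewrite !fctE mr nr /= !scalerDr !scalerA (mulrC k).
  by rewrite -!addrA; congr (_ + _); rewrite addrCA.
- exact: bounded_operatorD.
- exact: bounded_operatorD.
- by move=> a b; rewrite !fctE m1 n1 smulDl scale_smull.
- by move=> a b; rewrite !fctE m2 n2 smulDr scale_smulr.
- by move=> a b; rewrite !fctE smulDl smulDr scale_smull scale_smulr m3 n3.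
Qed.

HB.instance Definition _ :=
  GRing.isSubmodClosed.Build C ((A -> A) * (A -> A))%type dc_pred
    dc_submod_closed.

Record multiplier : Type :=
  Multiplier { mult_pair : (A -> A) * (A -> A); _ : mult_pair \in dc_pred }.

HB.instance Definition _ := [isSub for mult_pair].
HB.instance Definition _ := [Choice of multiplier by <:].
HB.instance Definition _ := [SubChoice_isSubLmodule of multiplier by <:].

Definition mulL (m : multiplier) : A -> A := (mult_pair m).1.
Definition mulR (m : multiplier) : A -> A := (mult_pair m).2.

Lemma multP m : double_centralizer (mulL m, mulR m).
Proof. by rewrite /mulL /mulR; case: m => -[L S] h; exact: (elimT (asboolP _) h). Qed.

Lemma mult_ext m n : mulL m =1 mulL n -> mulR m =1 mulR n -> m = n.
Proof.
move=> /funext L /funext S; apply: val_inj => /=.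
by move: L S; rewrite /mulL /mulR; case: (mult_pair m) => ? ? /= -> ->;
  case: (mult_pair n).
Qed.

Definition mult_of_dc L S (h : double_centralizer (L, S)) : multiplier :=
  Multiplier (introT (asboolP _) h).

Fact mult_mul_subproof m n :
  double_centralizer (mulL m \o mulL n, mulR n \o mulR m).
Proof.
case: (multP m) => /= ml mr mbl mbr m1 m2 m3.
case: (multP n) => /= nl nr nbl nbr n1 n2 n3.
split => /=.
- by move=> k u v /=; rewrite nl ml.
- by move=> k u v /=; rewrite mr nr.
- exact: bounded_operator_comp.
- exact: bounded_operator_comp.
- by move=> a b; rewrite n1 m1.
- by move=> a b; rewrite m2 n2.
- by move=> a b; rewrite n3 m3.
Qed.

Fact mult_star_subproof m :
  double_centralizer (star \o mulR m \o star, star \o mulL m \o star).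
Proof.
case: (multP m) => /= ml mr mbl mbr m1 m2 m3; split => /=.
- by move=> k u v /=; rewrite starD starZ mr starD starZ conjCK.
- by move=> k u v /=; rewrite starD starZ ml starD starZ conjCK.
- exact: bounded_operator_star.
- exact: bounded_operator_star.
- by move=> a b; rewrite starM m2 starM starK.
- by move=> a b; rewrite starM m1 starM starK.
- by move=> a b; rewrite -[in LHS](starK b) -starM -m3 starM starK.
Qed.

Definition mult_mul m n := mult_of_dc (mult_mul_subproof m n).
Definition mult_star m := mult_of_dc (mult_star_subproof m).

Fact mult_mulA a b c :
  mult_mul a (mult_mul b c) = mult_mul (mult_mul a b) c.
Proof. exact: mult_ext. Qed.

Fact mult_mulDl a b c :
  mult_mul (a + b) c = mult_mul a c + mult_mul b c.
Proof.
apply: mult_ext => // x; have := dc_linearr (multP c) 1 (mulR a x) (mulR b x).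
by rewrite !scale1r.
Qed.

Fact mult_mulDr a b c :
  mult_mul a (b + c) = mult_mul a b + mult_mul a c.
Proof.
apply: mult_ext => // x; have := dc_linearl (multP a) 1 (mulL b x) (mulL c x).
by rewrite !scale1r.
Qed.

Fact mult_scale_mull k a b : mult_mul (k *: a) b = k *: mult_mul a b.
Proof.
apply: mult_ext => // x; have /= hl := dc_linearr (multP b).
by have := hl k (mulR a x) 0; have := hl 1 0 0;
  rewrite !scale1r !addr0 -[LHS]addr0 => /addrI <-; rewrite addr0.
Qed.

Fact mult_scale_mulr k a b : mult_mul a (k *: b) = k *: mult_mul a b.
Proof.
apply: mult_ext => // x; have /= hl := dc_linearl (multP a).
by have := hl k (mulL b x) 0; have := hl 1 0 0;
  rewrite !scale1r !addr0 -[LHS]addr0 => /addrI <-; rewrite addr0.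
Qed.

Fact mult_starK a : mult_star (mult_star a) = a.
Proof. by apply: mult_ext => x; rewrite /mulL /mulR /= !starK. Qed.

Fact mult_starD a b : mult_star (a + b) = mult_star a + mult_star b.
Proof. by apply: mult_ext => x; exact: starD. Qed.

Fact mult_starZ k a : mult_star (k *: a) = k^* *: mult_star a.
Proof. by apply: mult_ext => x; exact: starZ. Qed.

Fact mult_starM a b :
  mult_star (mult_mul a b) = mult_mul (mult_star b) (mult_star a).
Proof.
apply: mult_ext => x.
  transitivity (star (mulR b (star (star (mulR a (star x)))))) => //.
  by rewrite starK.
transitivity (star (mulL a (star (star (mulL b (star x)))))) => //.
by rewrite starK.
Qed.

HB.instance Definition _ := isStarAlgebra.Build C multiplier
  mult_mulA mult_mulDl mult_mulDr mult_scale_mull mult_scale_mulr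
  mult_starK mult_starD mult_starZ mult_starM.

Fact mult_incl_subproof (a : A) :
  double_centralizer (fun b => a ** b, fun b => b ** a).
Proof.
split => /=.
- by move=> k u v; rewrite smulDr scale_smulr.
- by move=> k u v; rewrite smulDl scale_smull.
- by exists `|a| => // b; exact: norm_smul.
- by exists `|a| => // b; rewrite mulrC norm_smul.
- by move=> b c; rewrite smulA.
- by move=> b c; rewrite smulA.
- by move=> b c; rewrite smulA.
Qed.

Definition mult_incl (a : A) : multiplier := mult_of_dc (mult_incl_subproof a).

Definition mult_center : set multiplier :=
  [set z | forall m : multiplier, z ** m = m ** z].

Definition mult_tilde (J : set A) : set multiplier :=
  [set b | forall a, J (mulL b a) /\ J (mulR b a)].

(* The strict topology, given by the seminorms m |-> `|m a| and m |-> `|a m|,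
   is the topology of pointwise convergence of the pair (L, R). *)
Definition strict_topology : Type :=
  initial_topology (fun m : multiplier =>
    ((mulL m : {ptws A -> A}), (mulR m : {ptws A -> A}))).

Definition strictly_closed (S : set multiplier) : Prop :=
  closed (S : set strict_topology).

End multiplier_algebra.

Section stone_cech.
Variables (R : realType) (X : topologicalType).

Definition unit_function : Type :=
  {f : X -> R | continuous f /\ forall x, 0 <= f x <= 1}.

Definition cube_eval (x : X) : {ptws unit_function -> R} :=
  fun f => sval f x.

(* The closure of the canonical image of X in the cube [0, 1]^C(X, [0, 1]). *)
Definition stone_cech : topologicalType :=
  set_type (closure (range cube_eval)).

Definition stone_cech_incl (x : X) : stone_cech :=
  SigSub (mem_set (subset_closure (imageT cube_eval x))).
End stone_cech.

Section C0X_algebras.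
Variables (R : realType) (A : cstarAlgType R).
Local Notation C := R[i].

Definition positive_elt (a : A) : Prop := exists b : A, a = star b ** b.

Definition sigma_unital : Prop := exists u : nat -> A,
  [/\ forall n, positive_elt (u n) /\ `|u n| <= 1,
      forall n, positive_elt (u n.+1 - u n) &
      forall a, (fun n => u n ** a) @ \oo --> a /\
                (fun n => a ** u n) @ \oo --> a].

Definition quotient_norm (J : set A) (a : A) : R :=
  inf [set complex.Re `|a + j| | j in J].

(* Meaningful for bounded continuous f only. *)
Definition dauns_hofmann (f : Prim A -> C) : multiplier A :=
  xget 0 [set z | mult_center z /\
    forall (a : A) (P : Prim A), prim_ideal P (mulL z a - f P *: a)].

Variables (X : topologicalType) (phi : Prim A -> X).

Definition C0_algebra : Prop :=
  [/\ locally_compact [set: X], hausdorff_space X & continuous phi].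

Definition base_image : topologicalType := set_type (range phi).

(* Off X_phi this is an intersection of no sets, i.e. J_x = A. *)
Definition fiber_ideal (x : X) : set A :=
  \bigcap_(P in phi @^-1` [set x]) prim_ideal P.

Definition continuous_C0_algebra : Prop :=
  forall a : A, continuous (fun x => quotient_norm (fiber_ideal x) a).

Definition C0_functions : set (X -> C) :=
  [set f | continuous (f : X -> C^o) /\
    forall e : C, 0 < e -> compact [set x | e <= `|f x|]].

(* Z'(A), viewed in A rather than in M(A). *)
Definition Zprime : set A :=
  [set a | exists2 f, C0_functions f & dauns_hofmann (f \o phi) = mult_incl a].

Definition Uphi : set base_image :=
  [set x | ~ (Zprime `<=` fiber_ideal (set_val x))].
Definition Wphi : set base_image := ~` Uphi.

(* tilde P is always primitive, so each P has exactly one such Q. *)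
Definition is_extension
    (phibar : Prim (multiplier A) -> stone_cech R X) : Prop :=
  continuous phibar /\
  forall (P : Prim A) (Q : Prim (multiplier A)),
    prim_ideal Q = mult_tilde (prim_ideal P) ->
    phibar Q = stone_cech_incl R (phi P).

Definition mult_fiber_ideal (phibar : Prim (multiplier A) -> stone_cech R X)
    (x : X) : set (multiplier A) :=
  \bigcap_(Q in phibar @^-1` [set stone_cech_incl R x]) prim_ideal Q.
End C0X_algebras.
Arguments Uphi {R A X} phi _.
Arguments Wphi {R A X} phi _.

Definition P_point (R : realType) (T : topologicalType) (x : T) : Prop :=
  forall f : T -> R, continuous f -> f x = 0 -> \forall y \near x, f y = 0.

(* Main.v *)
(** Write [tilde J = {m | m A, A m <= J}] and let [N_y] be the norm of [M(A) / tilde J_y].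
    Always [J_x <= H_x <= tilde J_x], and [tilde J_x] is the strict closure of [J_x], so
    [H_x] is strictly closed iff [tilde J_x <= H_x].

    Two facts control [H_x].  If [phibar Q = x] and [m] lies in [tilde P] for all [P] with
    [phi P] near [x], then [m] lies in [Q] (primeness of [Q]).  Conversely, if [m] lies in
    [H_x], then [limsup_(y -> x) N_y m = 0]: this limsup is a C*-seminorm, hence attained by
    an irreducible representation, whose kernel is forced by the Dauns-Hofmann theorem to lie
    over [x].

    (ii) => (i).  If [x] is in [U_phi], an element of [Z'(A)] acts as a function not vanishing
    at [x], so [b] in [tilde J_x] is, modulo an element of [Q], in [A], hence in [J_x].  If [x]
    is a P-point and [u_n] is an approximate unit, all the functions
    [y |-> norm (b u_n + J_y)] vanish on a common neighbourhood of [x].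

    (i) => (ii).  If [N_x (1 - u_n) < 1] for some [n], then [A / J_x] is unital; lifting the
    unit to [e], the limsup of [N_y (1 - e)] at [x] is 0, so a Neumann series near [x] shows
    that a bump function at [x] acts as an element of [A], and [x] is in [U_phi].  Otherwise
    [1/2 <= norm ((1 - u_n) a_n + J_x)] for suitable [a_n] in the unit ball.  Given [f]
    continuous with [f x = 0], take an increasing sequence [s_n] of functions vanishing at [x],
    tending to 1 where [f <> 0], with [s_n = 1] wherever [norm ((1 - u_k) a_k + J_y) <= 1/4]
    for some [k <= n + 1].  Then [b = sum_n (s_(n+1) - s_n)(1 - u_(n+1))] is in
    [tilde J_x = H_x], but [1/8 <= N_y b] at the points [y] near [x] where [f <> 0]; so there
    are none, and [x] is a P-point.  The same functions then give the neighbourhood of [x]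
    in [W_phi]. *)
Require Import Defs.
From HB Require Import structures.
From mathcomp Require Import all_boot all_order all_algebra.
From mathcomp Require Import sesquilinear.
From mathcomp Require Import complex.
From mathcomp Require Import all_classical all_reals all_analysis.
From mathcomp Require Import ring lra.

Set Implicit Arguments.
Unset Strict Implicit.
Unset Printing Implicit Defensive.

Import Order.TTheory GRing.Theory Num.Theory.
Import numFieldNormedType.Exports.

Local Open Scope classical_set_scope.
Local Open Scope ring_scope.
Local Open Scope complex_scope.
Local Open Scope starAlg_scope.

(** Quotients are never formed. A quotient of $A$ or $M(A)$ is represented by its seminorm on the
    algebra itself, so that fibre norms, their upper limits and the operator norm are all
    C*-seminorms on [multiplier A], and one existence theorem for irreducible representations, about
    a C*-seminorm [p] below a complete norm [nm], serves them all. Spectra do not occur either: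
    positivity is expressed by norms, and the only functional calculus is an iteration for square
    roots. If [p x <= 1] but [nm x] is large, the iteration need not converge; hence arguments about
    [p] use approximate roots and carry an epsilon.

    Representations of $M(A)$ itself are needed: a primitive ideal over [x] may contain all of $A$,
    and the upper limit of the [N_y] at [x] is not determined by the fibre at [x]. This gap between
    a fibre and its neighbours is what the theorem measures; the series [b] exhibits it, being 0 in
    the fibre at [x] and large in fibres nearby. *)

Local Notation Re := complex.Re.
Local Notation Im := complex.Im.

(** * Star-algebras and C*-seminorms *)

(* The square-zero extension [K (+) V], a commutative ring in which the tactic
   [ring] decides identities between linear combinations of elements of [V]. *)
Section square_zero_extension.
Variables (K : comNzRingType) (V : lmodType K).

Definition sqz : Type := (K * V)%type.
HB.instance Definition _ := GRing.Zmodule.on sqz.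

Let one : sqz := (1, 0).
Let mul (x y : sqz) : sqz := (x.1 * y.1, x.1 *: y.2 + y.1 *: x.2).

Fact sqz_mulA : associative mul.
Proof.
move=> [a u] [b v] [c w]; congr pair; rewrite /= ?mulrA//.
by rewrite !scalerDr !scalerA -addrA (mulrC c a) (mulrC c b).
Qed.

Fact sqz_mulC : commutative mul.
Proof. by move=> [a u] [b v]; congr pair; rewrite /= 1?mulrC// addrC. Qed.

Fact sqz_mul1 : left_id one mul.
Proof. by move=> [a u]; congr pair; rewrite /= ?mul1r// scale1r scaler0 addr0. Qed.

Fact sqz_mulD : left_distributive mul +%R.
Proof.
move=> [a u] [b v] [c w]; congr pair; rewrite /= ?mulrDl//.
by rewrite scalerDl scalerDr addrACA.
Qed.

Fact sqz_1neq0 : one != 0.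
Proof. by apply/eqP => -[] /eqP; rewrite oner_eq0. Qed.

HB.instance Definition _ := GRing.Zmodule_isComNzRing.Build sqz
  sqz_mulA sqz_mulC sqz_mul1 sqz_mulD sqz_1neq0.

Definition sqz_scal (k : K) : sqz := (k, 0).
Definition sqz_vec (v : V) : sqz := (0, v).

Fact sqz_scal_zmod : zmod_morphism sqz_scal.
Proof. by move=> a b; congr pair; rewrite /= subrr. Qed.
Fact sqz_scal_monoid : monoid_morphism sqz_scal.
Proof.
split=> [//|a b]; congr pair; rewrite /= scaler0 scaler0 addr0 //.
Qed.
HB.instance Definition _ := GRing.isZmodMorphism.Build K sqz sqz_scal sqz_scal_zmod.
HB.instance Definition _ := GRing.isMonoidMorphism.Build K sqz sqz_scal sqz_scal_monoid.

Lemma sqz_vecD u v : sqz_vec (u + v) = sqz_vec u + sqz_vec v.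
Proof. by congr pair; rewrite /= addr0. Qed.
Lemma sqz_vecN u : sqz_vec (- u) = - sqz_vec u.
Proof. by congr pair; rewrite /= oppr0. Qed.
Lemma sqz_vec0 : sqz_vec 0 = 0. Proof. by []. Qed.
Lemma sqz_vecMn u n : sqz_vec (u *+ n) = sqz_vec u *+ n.
Proof. by elim: n => [|n IH]; rewrite ?mulr0n// !mulrS sqz_vecD IH. Qed.
Lemma sqz_vecZ k u : sqz_vec (k *: u) = sqz_scal k * sqz_vec u.
Proof. by congr pair; rewrite /= ?mulr0// scale0r addr0. Qed.
Lemma sqz_inj u v : sqz_vec u = sqz_vec v -> u = v. Proof. by case. Qed.
Definition sqzE := (sqz_vecD, sqz_vecN, sqz_vecZ, sqz_vecMn, sqz_vec0).

End square_zero_extension.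

Ltac lmod := apply: sqz_inj; rewrite !sqzE; ring.

Section star_algebra.
Variables (R : realType) (B : starAlgType R[i]).
Implicit Types (a b c : B) (k : R[i]) (t : R).

Lemma smulr0 a : a ** 0 = 0.
Proof. by apply: (addrI (a ** 0)); rewrite -smulDr !addr0. Qed.
Lemma smul0r a : 0 ** a = 0.
Proof. by apply: (addrI (0 ** a)); rewrite -smulDl !addr0. Qed.
Lemma smulrN a b : a ** (- b) = - (a ** b).
Proof. by apply: (addrI (a ** b)); rewrite -smulDr !subrr smulr0. Qed.
Lemma smulNr a b : (- a) ** b = - (a ** b).
Proof. by apply: (addrI (a ** b)); rewrite -smulDl !subrr smul0r. Qed.
Lemma smulrMn a b n : a ** (b *+ n) = (a ** b) *+ n.
Proof. by elim: n => [|n IH]; rewrite ?mulr0n ?smulr0// !mulrS smulDr IH. Qed.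
Lemma smulMnr a b n : (a *+ n) ** b = (a ** b) *+ n.
Proof. by elim: n => [|n IH]; rewrite ?mulr0n ?smul0r// !mulrS smulDl IH. Qed.
Lemma smulBr a b c : a ** (b - c) = a ** b - a ** c.
Proof. by rewrite smulDr smulrN. Qed.
Lemma smulBl a b c : (a - b) ** c = a ** c - b ** c.
Proof. by rewrite smulDl smulNr. Qed.

Lemma conj_realC t : (t%:C)^*%R = t%:C :> R[i].
Proof. by apply: conj_Creal; apply/complex_realP; exists t. Qed.

Lemma star0 : star (0 : B) = 0.
Proof. by apply: (addrI (star 0)); rewrite -starD !addr0. Qed.
Lemma starN a : star (- a) = - star a.
Proof. by apply: (addrI (star a)); rewrite -starD !subrr star0. Qed.
Lemma starB a b : star (a - b) = star a - star b.
Proof. by rewrite starD starN. Qed.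
Lemma starZR t a : star (t%:C *: a) = t%:C *: star a.
Proof. by rewrite starZ conj_realC. Qed.
Lemma starMn a n : star (a *+ n) = star a *+ n.
Proof. by elim: n => [|n IH]; rewrite ?mulr0n ?star0// !mulrS starD IH. Qed.

Definition smulE := (@smulDl _ B, @smulDr _ B, smulNr, smulrN, smulMnr,
  smulrMn, @scale_smull _ B, @scale_smulr _ B, smulr0, smul0r, @smulA _ B).
Definition starE :=
  (@starD _ B, starN, starZR, starMn, @starM _ B, @starK _ B, star0).

Definition scomm a b := a ** b = b ** a.

Lemma scomm0 a : scomm a 0. Proof. by rewrite /scomm smulr0 smul0r. Qed.
Lemma scomm_sym a b : scomm a b -> scomm b a. Proof. by []. Qed.
Lemma scommD a b c : scomm a b -> scomm a c -> scomm a (b + c).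
Proof. by rewrite /scomm smulDl smulDr => -> ->. Qed.
Lemma scommN a b : scomm a b -> scomm a (- b).
Proof. by rewrite /scomm smulNr smulrN => ->. Qed.
Lemma scommZ k a b : scomm a b -> scomm a (k *: b).
Proof. by rewrite /scomm scale_smulr scale_smull => ->. Qed.
Lemma scommM a b c : scomm a b -> scomm a c -> scomm a (b ** c).
Proof. by rewrite /scomm => h1 h2; rewrite smulA h1 -!smulA h2. Qed.

End star_algebra.

(** The norm of [R[i]] takes its values in [R[i]]; [cabs], and [nrm] below for normed spaces, move
    it to [R], where infima and linear arithmetic apply. *)
Definition cabs (R : realType) (k : R[i]) : R := Re `|k|.

Section cabs.
Variable R : realType.
Implicit Types (k : R[i]) (t : R).

Lemma cabsE k : `|k| = (cabs k)%:C.
Proof. by rewrite /cabs normc_def. Qed.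
Lemma cabs_ge0 k : 0 <= cabs k.
Proof. by rewrite -ler0c -cabsE. Qed.
Lemma cabsR t : cabs t%:C = `|t|.
Proof. by rewrite /cabs normc_def /= expr0n addr0 sqrtr_sqr. Qed.
Lemma cabsM k l : cabs (k * l) = cabs k * cabs l.
Proof.
have : (cabs (k * l))%:C = (cabs k * cabs l)%:C.
  by rewrite rmorphM /= -!cabsE normrM.
by case.
Qed.
Lemma cabsD k l : cabs (k + l) <= cabs k + cabs l.
Proof. by rewrite -lecR rmorphD /= -!cabsE ler_normD. Qed.
Lemma cabsN k : cabs (- k) = cabs k.
Proof. by rewrite /cabs normrN. Qed.
Lemma cabs_eq0 k : cabs k = 0 -> k = 0.
Proof. by move=> h; apply/normr0_eq0; rewrite cabsE h. Qed.
Lemma cabs0 : cabs 0 = 0 :> R.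
Proof. by rewrite /cabs normr0. Qed.
Lemma cabsi : cabs 'i%R = 1 :> R.
Proof. by rewrite /cabs normCi. Qed.
Lemma cabs_conj k : cabs k^*%R = cabs k.
Proof. by rewrite /cabs norm_conjC. Qed.
Lemma Re_le_cabs k : Re k <= cabs k.
Proof.
rewrite -lecR -cabsE; apply: le_trans (normc_ge_Re k).
by rewrite lecR ler_norm.
Qed.
Lemma cabs_sqr k : (cabs k ^+ 2)%:C = k * k^*%R.
Proof. by rewrite rmorphXn /= -cabsE normCK. Qed.
End cabs.

(* It is convenient to let the C*-inequality be the weak one; see [csn_C]. *)
Record cstar_seminorm (R : realType) (B : starAlgType R[i]) (p : B -> R) :
  Prop := CstarSeminorm {
  csn_D : forall a b, p (a + b) <= p a + p b;
  csn_Z : forall k a, p (k *: a) = cabs k * p a;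
  csn_M : forall a b, p (a ** b) <= p a * p b;
  csn_C_le : forall a, p a ^+ 2 <= p (star a ** a) }.

Section cstar_seminorm.
Variables (R : realType) (B : starAlgType R[i]) (p : B -> R).
Hypothesis csn : cstar_seminorm p.
Implicit Types (a b c : B) (k : R[i]) (t : R).

Lemma csn0 : p 0 = 0.
Proof. by rewrite -(scale0r 0) (csn_Z csn) cabs0 mul0r. Qed.
Lemma csnN a : p (- a) = p a.
Proof. by rewrite -scaleN1r (csn_Z csn) /cabs normrN normr1 mul1r. Qed.
Lemma csn_ge0 a : 0 <= p a.
Proof. by have := csn_D csn a (- a); rewrite subrr csn0 csnN; lra. Qed.
Lemma csnB a b : p (a - b) <= p a + p b.
Proof. by rewrite -(csnN b) (csn_D csn). Qed.
Lemma csn_dist a b : p (a - b) = p (b - a).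
Proof. by rewrite -csnN opprB. Qed.
Lemma csnZR t a : p (t%:C *: a) = `|t| * p a.
Proof. by rewrite (csn_Z csn) cabsR. Qed.
Lemma csn_triangle c a b : p (a - b) <= p (a - c) + p (c - b).
Proof. by have := csn_D csn (a - c) (c - b); rewrite addrA subrK. Qed.
Lemma csn_sub a b : p a <= p b + p (a - b).
Proof. by have := csn_D csn b (a - b); rewrite addrC subrK. Qed.

(** Cancel [p b] in [p b ^+ 2 <= p (star b ** b) <= p (star b) * p b], then exchange [b] and
    [star b]. *)
Lemma csn_star a : p (star a) = p a.
Proof.
suff le b : p b <= p (star b) by apply/eqP; rewrite eq_le le -{2}(starK a) le.
have := csn_C_le csn b; have := csn_M csn (star b) b.
have := csn_ge0 b; rewrite le0r => /predU1P[-> _ _|b0 h1 h2].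
  exact: csn_ge0.
by rewrite -(ler_pM2r b0) -expr2 (le_trans h2).
Qed.

Lemma csn_C a : p (star a ** a) = p a ^+ 2.
Proof.
apply/eqP; rewrite eq_le (csn_C_le csn) andbT.
by rewrite (le_trans (csn_M csn _ _))// csn_star expr2.
Qed.

Lemma csn_sa_sqr a : star a = a -> p (a ** a) = p a ^+ 2.
Proof. by move=> sa; rewrite -csn_C sa. Qed.

End cstar_seminorm.

(** The constant [C] collects whatever multiplies the epsilon in an estimate; its sign and size do
    not matter. *)
Lemma le_eps (R : realType) (r s C : R) :
  (forall e, 0 < e -> r <= s + C * e) -> r <= s.
Proof.
move=> h; rewrite leNgt; apply/negP => rs.
have C1 : 0 < `|C| + 1 by rewrite ltr_wpDl.
pose e := (r - s) / (2 * (`|C| + 1)).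
have e0 : 0 < e by rewrite divr_gt0 ?mulr_gt0 ?subr_gt0.
have := h e e0; have : C * e <= (`|C| + 1) * e.
  by rewrite ler_wpM2r ?(ltW e0)// (le_trans (ler_norm C))// lerDl.
have -> : (`|C| + 1) * e = (r - s) / 2 by rewrite /e; field; exact: lt0r_neq0.
lra.
Qed.

(** * Square roots by iteration *)

Section square_root_iteration.
Variables (R : realType) (B : starAlgType R[i]).
Implicit Types (a b d x y : B) (t : R).

(* If [2 d - d^2 = x] then [(1 - d)^2 = 1 - x]; [d] is the limit of the
   iterates of [d |-> (x + d^2) / 2]. *)
Fixpoint sqit x n : B :=
  if n is m.+1 then (2^-1)%:C *: (x + sqit x m ** sqit x m) else 0.

(** The same iteration for the scalar 1. It increases to 1, and its increments majorise those of
    [sqit x] when [p x <= 1]. *)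
Fixpoint sqit1 n : R := if n is m.+1 then 2^-1 * (1 + sqit1 m ^+ 2) else 0.

Lemma sqit1_bounds n : 0 <= sqit1 n <= 1.
Proof. by elim: n => [|n /andP[h1 h2]] /=; [rewrite lexx ler01|nra]. Qed.

(** The error [e] satisfies the recursion [e' = e - e ^+ 2 / 2], for which [2 / (n + 2)] is a
    majorant. The rate is not geometric because norm 1 is allowed, where [1 - x] may fail to be
    invertible. *)
Lemma sqit1_rate n : 1 - sqit1 n <= 2 / n.+2%:R.
Proof.
elim: n => [|n IH]; first by rewrite /= subr0 divff.
set e := 1 - sqit1 n in IH.
have [h1 h2] : 0 <= e /\ e <= 1.
  by have /andP[? ?] := sqit1_bounds n; rewrite /e; split; lra.
have -> : 1 - sqit1 n.+1 = e - e ^+ 2 / 2 by rewrite /e /=; field.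
rewrite ler_pdivlMr ?ltr0n//.
move: IH; rewrite ler_pdivlMr ?ltr0n// -[n.+3]addn3 -[n.+2]addn2 !natrD.
move: (n%:R : R) => N h3; rewrite -subr_ge0.
have -> : 2 - (e - e ^+ 2 / 2) * (N + 3%:R) =
  ((2 - e * (N + 2%:R)) * (2 - e) + e ^+ 2) / 2 by field.
by rewrite divr_ge0// addr_ge0 ?sqr_ge0// mulr_ge0 ?subr_ge0//; lra.
Qed.

Lemma sqit_star x n : star x = x -> star (sqit x n) = sqit x n.
Proof. by move=> sx; elim: n => [|n IH] /=; rewrite ?star0// !starE sx IH. Qed.

Lemma scomm_subr_sqr a b : scomm a b -> (a - b) ** (a + b) = a ** a - b ** b.
Proof. by rewrite /scomm => ab; rewrite !smulE ab; lmod. Qed.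

Lemma sqit_comm x y n : scomm y x -> scomm y (sqit x n).
Proof.
move=> yx; elim: n => [|n IH]; first exact: scomm0.
by apply/scommZ/scommD => //; apply: scommM.
Qed.

(** The residual of the equation is twice a step of the iteration, so a bound on steps also bounds
    residuals. *)
Lemma sqit_eq x n : sqit x n *+ 2 - sqit x n ** sqit x n - x
  = 2%:C *: (sqit x n - sqit x n.+1).
Proof.
rewrite /= scalerBr scalerA -rmorphM/= divff// scale1r; lmod.
Qed.

Variables (p : B -> R) (csn : cstar_seminorm p).

Lemma sqit_le x n : p x <= 1 -> p (sqit x n) <= sqit1 n.
Proof.
move=> px; elim: n => [|n IH] /=; first by rewrite (csn0 csn).
rewrite (csnZR csn) ger0_norm ?invr_ge0// ler_wpM2l ?invr_ge0//.
rewrite (le_trans (csn_D csn _ _))// lerD// (le_trans (csn_M csn _ _))// expr2.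
by apply: ler_pM => //; exact: csn_ge0.
Qed.

(** All iterates commute, so a difference of squares factors; the scalar iteration obeys the same
    recursion with equality. *)
Lemma sqit_step x n : p x <= 1 ->
  p (sqit x n.+1 - sqit x n) <= sqit1 n.+1 - sqit1 n.
Proof.
move=> px; elim: n => [|n IH].
  rewrite /= smulr0 addr0 subr0 (csnZR csn) ger0_norm ?invr_ge0//; lra.
set d := sqit x n.+1; set d' := sqit x n in IH *.
have dd' : scomm d d' by apply/sqit_comm/scomm_sym/sqit_comm.
have -> : sqit x n.+2 - d = (2^-1)%:C *: ((d - d') ** (d + d')).
  rewrite scomm_subr_sqr//.
  transitivity ((2^-1)%:C *: (x + d ** d) - (2^-1)%:C *: (x + d' ** d')) => //.
  by lmod.
rewrite (csnZR csn) ger0_norm ?invr_ge0//.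
have -> : sqit1 n.+2 - sqit1 n.+1 =
    2^-1 * ((sqit1 n.+1 - sqit1 n) * (sqit1 n.+1 + sqit1 n)) by rewrite /=; field.
rewrite ler_wpM2l ?invr_ge0// (le_trans (csn_M csn _ _))//.
apply: ler_pM; rewrite ?(csn_ge0 csn)// (le_trans (csn_D csn _ _))//.
by rewrite lerD// sqit_le.
Qed.

Lemma sqit_dist x n k : p x <= 1 -> p (sqit x (n + k) - sqit x n) <= 2 / n.+2%:R.
Proof.
move=> px; apply: (@le_trans _ _ (sqit1 (n + k) - sqit1 n)); last first.
  by apply: le_trans (sqit1_rate n); have /andP[] := sqit1_bounds (n + k); lra.
elim: k => [|k IH]; first by rewrite addn0 !subrr (csn0 csn).
rewrite addnS (le_trans (csn_triangle csn (sqit x (n + k)) _ _))//.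
have := sqit_step (n + k) px; rewrite /= in IH *; lra.
Qed.

Lemma inv_nat_small (e : R) : 0 < e -> exists n, forall m, (n <= m)%N -> 2 / m.+2%:R <= e.
Proof.
move=> e0; exists (Num.bound (2 / e)) => m nm.
rewrite ler_pdivrMr ?ltr0n// mulrC -ler_pdivrMr//.
have := archi_boundP (ltW (divr_gt0 (ltr0Sn R 1) e0)) => /ltW/le_trans; apply.
by rewrite ler_nat (leq_trans nm)// -addn2 leq_addr.
Qed.

(** A single iterate serves. This is the form for a seminorm [p] in an algebra that is complete only
    for a larger norm. *)
Lemma approx_sqrt x e : p x <= 1 -> 0 < e -> exists d,
  [/\ p (d *+ 2 - d ** d - x) <= e, star x = x -> star d = d &
      forall y, scomm y x -> scomm y d].
Proof.
move=> px e0; have [n hn] := inv_nat_small (divr_gt0 e0 (ltr0Sn R 1)).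
exists (sqit x n); split; [|exact: sqit_star|by move=> y; apply: sqit_comm].
rewrite sqit_eq (csnZR csn) normr_nat (csn_dist csn) mulrC -ler_pdivlMr//.
by rewrite -addn1 (le_trans (sqit_dist _ _ _))// hn.
Qed.

Definition seq_complete (q : B -> R) := forall u : nat -> B,
  (forall e, 0 < e -> exists N, forall m n, (N <= m)%N -> (N <= n)%N ->
    q (u m - u n) <= e) ->
  exists l, forall e, 0 < e -> exists N, forall n, (N <= n)%N -> q (u n - l) <= e.

Hypothesis p_eq0 : forall a, p a = 0 -> a = 0.
Hypothesis p_complete : seq_complete p.

Lemma csn_small_eq (C : R) a b : (forall e, 0 < e -> p (a - b) <= C * e) -> a = b.
Proof.
move=> h; apply/eqP; rewrite -subr_eq0; apply/eqP/p_eq0/eqP.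
rewrite eq_le (csn_ge0 csn) andbT; apply: (@le_eps _ _ _ C) => e /h.
by rewrite add0r.
Qed.

Lemma exact_sqrt x : p x <= 1 -> exists d,
  [/\ d *+ 2 - d ** d = x, p d <= 1, star x = x -> star d = d &
      forall y, scomm y x -> scomm y d].
Proof.
move=> px.
have [|d hd] := @p_complete (sqit x).
  move=> e e0; have [N hN] := inv_nat_small e0; exists N.
  have key m n : (N <= n)%N -> (n <= m)%N -> p (sqit x m - sqit x n) <= e.
    by move=> Nn nm; rewrite -(subnKC nm) (le_trans (sqit_dist _ _ _))// hN.
  move=> m n Nm Nn; case: (leqP n m) => [|/ltnW] h; first exact: key.
  by rewrite (csn_dist csn); exact: key.
have {}hd e : 0 < e -> exists2 n, p (sqit x n - d) <= e & p (sqit x n.+1 - d) <= e.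
  move=> /hd[N hN]; exists N; apply: hN => //; exact: leqW.
have pd : p d <= 1.
  apply: (@le_eps _ _ _ 1) => e /hd[n h _].
  have := csn_sub csn d (sqit x n); rewrite (csn_dist csn).
  have := sqit_le n px; have /andP[_] := sqit1_bounds n; rewrite mul1r; lra.
exists d; split => //.
(* The four terms of the decomposition below contribute [2 * e], [e], [e] and [4 * e]. *)
- apply: (@csn_small_eq 8) => e /hd[n h1 h2]; set s := sqit x n in h1 *.
  have -> : d *+ 2 - d ** d - x = (d - s) *+ 2 - (d - s) ** d - s ** (d - s)
       + 2%:C *: (s - sqit x n.+1).
    by rewrite -sqit_eq -/s !smulE; lmod.
  have hs : p s <= 1.
    by have := sqit_le n px; have /andP[_] := sqit1_bounds n; rewrite -/s; lra.
  have h3 : p ((d - s) ** d) <= e.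
    rewrite (le_trans (csn_M csn _ _))// -[leRHS]mulr1 (csn_dist csn).
    by apply: ler_pM => //; exact: csn_ge0.
  have h4 : p (s ** (d - s)) <= e.
    rewrite (le_trans (csn_M csn _ _))// -[leRHS]mul1r (csn_dist csn).
    by apply: ler_pM => //; exact: csn_ge0.
  have h5 : p (2%:C *: (s - sqit x n.+1)) <= 2 * (e + e).
    rewrite (csnZR csn) normr_nat ler_wpM2l// (le_trans (csn_triangle csn d _ _))//.
    by rewrite lerD// (csn_dist csn).
  have := csn_D csn ((d - s) *+ 2 - (d - s) ** d - s ** (d - s))
    (2%:C *: (s - sqit x n.+1)).
  have := csnB csn ((d - s) *+ 2 - (d - s) ** d) (s ** (d - s)).
  have := csnB csn ((d - s) *+ 2) ((d - s) ** d).
  have := csn_D csn (d - s) (d - s); rewrite -mulr2n (csn_dist csn d s).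
  lra.
- move=> sx; apply: (@csn_small_eq 2) => e /hd[n h1 _].
  rewrite (le_trans (csn_triangle csn (sqit x n) _ _))// mulr2n mulrDl mul1r lerD//.
  by rewrite -{1}(sqit_star n sx) -starB (csn_star csn) (csn_dist csn).
- move=> y yx; apply: (@csn_small_eq (2 * p y)) => e /hd[n h1 _].
  have -> : y ** d - d ** y =
      (sqit x n - d) ** y - y ** (sqit x n - d).
    by rewrite !smulE (sqit_comm n yx); lmod.
  rewrite (le_trans (csnB csn _ _))//.
  have := csn_M csn (sqit x n - d) y; have := csn_M csn y (sqit x n - d).
  have : p (sqit x n - d) * p y <= e * p y by rewrite ler_wpM2r// (csn_ge0 csn).
  lra.
Qed.

End square_root_iteration.

Lemma scommM_sqr (R : realType) (B : starAlgType R[i]) (a b : B) :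
  scomm a b -> (a ** b) ** (a ** b) = (a ** a) ** (b ** b).
Proof. by move=> ab; rewrite -!smulA (smulA b) -ab !smulA. Qed.

Section sum_of_squares.
Variables (R : realType) (B : starAlgType R[i]) (p : B -> R).
Hypothesis csn : cstar_seminorm p.
Implicit Types (a b : B).

(* [w = a + i b] satisfies [w^* w = a^2 + b^2]. *)
Lemma csn_sqr_le a b : star a = a -> star b = b -> scomm a b ->
  p a ^+ 2 <= p (a ** a + b ** b).
Proof.
move=> sa sb ab; pose w := a + 'i%R *: b.
have sw : star w = a - 'i%R *: b.
  by rewrite starD starZ sa sb conjCi scaleNr.
have ww : star w ** w = a ** a + b ** b.
  rewrite sw /w !smulE ab !scalerA -expr2 sqrCi; lmod.
rewrite -ww (csn_C csn) lerXn2r ?nnegrE ?(csn_ge0 csn)//.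
have h : p (a *+ 2) <= p w + p w.
  rewrite -{1}(csn_star csn w) (le_trans _ (csn_D csn _ _))// sw /w.
  by rewrite addrACA addNr addr0 mulr2n.
have := h; rewrite -scaler_nat (csn_Z csn) /cabs normr_nat.
rewrite (_ : Re (2%:R : R[i]) = 2) ?raddfMn//=; lra.
Qed.
End sum_of_squares.

(** * Positive elements of a unital C*-algebra *)

Section unital_cstar_norm.
Variables (R : realType) (B : starAlgType R[i]) (one : B) (p : B -> R).
Hypotheses (smul1r : forall a : B, one ** a = a)
  (smulr1 : forall a : B, a ** one = a).
Implicit Types (a b c s x y : B) (t : R).

Local Notation sc t := (t%:C *: one).

Lemma star_one : star one = one.
Proof. by rewrite -{2}(starK one) -{2}[star one]smulr1 starM starK smulr1. Qed.

Lemma scomm1 a : scomm a one. Proof. by rewrite /scomm smul1r smulr1. Qed.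

Lemma scomm_sc a t : scomm a (sc t). Proof. exact/scommZ/scomm1. Qed.

Hypothesis csn : cstar_seminorm p.

Lemma csn_one_le : p one <= 1.
Proof.
have := csn_C csn one; rewrite star_one smulr1 => h.
have := csn_ge0 csn one; nra.
Qed.

Lemma csn_sc t : 0 <= t -> p (sc t) <= t.
Proof.
by move=> t0; rewrite (csnZR csn) ger0_norm// -[leRHS]mulr1 ler_wpM2l// csn_one_le.
Qed.

(** For self-adjoint [a] the norm condition says that the spectrum lies in [[0, 2t]]. In this form
    sums of positive elements are positive by the triangle inequality. *)
Definition pos a := star a = a /\ exists2 t, 0 <= t & p (sc t - a) <= t.

Lemma pos0 : pos 0.
Proof. by split; [exact: star0|exists 0 => //; rewrite scale0r subr0 csn0]. Qed.

Lemma posD a b : pos a -> pos b -> pos (a + b).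
Proof.
move=> [sa [t t0 h]] [sb [u u0 k]]; split; first by rewrite starD sa sb.
exists (t + u); first exact: addr_ge0.
have -> : sc (t + u) - (a + b) = (sc t - a) + (sc u - b) by lmod.
by rewrite (le_trans (csn_D csn _ _))// lerD.
Qed.

Lemma posZ a t : 0 <= t -> pos a -> pos (t%:C *: a).
Proof.
move=> t0 [sa [u u0 k]]; split; first by rewrite starZR sa.
exists (t * u); first exact: mulr_ge0.
have -> : sc (t * u) - t%:C *: a = t%:C *: (sc u - a) by lmod.
by rewrite (csnZR csn) ger0_norm// ler_wpM2l.
Qed.

Lemma pos_subr a t : star a = a -> p a <= t -> pos (sc t - a).
Proof.
move=> sa pa; split; first by rewrite !starE star_one sa.
exists t; first exact: le_trans (csn_ge0 csn a) pa.
by rewrite opprD opprK addrA subrr add0r.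
Qed.

Hypothesis p_eq0 : forall a, p a = 0 -> a = 0.
Hypothesis p_complete : seq_complete p.

Lemma p_le0 a : p a <= 0 -> a = 0.
Proof. by move=> h; apply/p_eq0/le_anti; rewrite h (csn_ge0 csn). Qed.

Lemma sqrt_subr x : star x = x -> p x <= 1 -> exists r,
  [/\ star r = r, r ** r = one - x, p (one - r) <= 1 &
      forall y, scomm y x -> scomm y r].
Proof.
move=> sx px; have [d [dE pd sd cd]] := exact_sqrt csn p_eq0 p_complete px.
exists (one - d); split.
- by rewrite starB star_one sd.
- by rewrite -dE !smulE !smulr1 !smul1r; lmod.
- by rewrite opprB addrCA subrr addr0.
- by move=> y /cd yd; apply/scommD/scommN => //; exact: scomm1.
Qed.

(** After division by [t] the element is [1 - x] with [p x <= 1]; if [t = 0], then [a = 0]. *)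
Lemma pos_sqrt a : pos a -> exists s,
  [/\ star s = s, s ** s = a, pos s & forall y, scomm y a -> scomm y s].
Proof.
move=> [sa [t]]; rewrite le0r => /predU1P[->|t0 h].
  rewrite scale0r sub0r (csnN csn) => /p_le0 ->; exists 0.
  by split; rewrite ?star0 ?smulr0//; exact: pos0.
have [||r [sr rE pr cr]] := @sqrt_subr (one - (t^-1)%:C *: a).
- by rewrite !starE sa star_one.
- have -> : one - (t^-1)%:C *: a = (t^-1)%:C *: (sc t - a).
    by rewrite scalerBr scalerA -rmorphM/= mulVf ?lt0r_neq0// scale1r.
  by rewrite (csnZR csn) gtr0_norm ?invr_gt0// mulrC ler_pdivrMr// mul1r.
pose u : R := Num.sqrt t; have u0 : 0 <= u := sqrtr_ge0 _.
have uu : u * u = t by rewrite -expr2 sqr_sqrtr ?ltW.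
exists (u%:C *: r); split.
- by rewrite starZR sr.
- rewrite !smulE rE scalerA -rmorphM/= uu subKr scalerA -rmorphM/= mulfV ?lt0r_neq0//.
  by rewrite scale1r.
- split; first by rewrite starZR sr.
  by exists u => //; rewrite -scalerBr (csnZR csn) ger0_norm// ler_piMr.
- move=> y ya; apply/scommZ/cr/scommD; first exact: scomm1.
  exact/scommN/scommZ.
Qed.

(** Put [z = s / sqrt t] and let [r] be the root of [1 - z ** z]. Since [r ** r + z ** z = 1],
    [csn_sqr_le] bounds [r] by 1, and [t - s ** s] is [t] times the square of [r]. *)
Lemma sa_sqr_subr s t : star s = s -> p s ^+ 2 <= t -> p (sc t - s ** s) <= t.
Proof.
move=> ss; have [t0|t0] := leP t 0.
  move=> h; have s0 : s = 0.
    by apply: p_le0; have := csn_ge0 csn s; nra.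
  have -> : t = 0 by apply/le_anti; rewrite t0 (le_trans (sqr_ge0 _) h).
  by rewrite s0 smulr0 scale0r subr0 (csn0 csn).
move=> h; pose u : R := (Num.sqrt t)^-1; have u0 : 0 <= u by rewrite invr_ge0 sqrtr_ge0.
have uu : t * (u * u) = 1.
  by rewrite -expr2 exprVn sqr_sqrtr ?ltW// mulfV ?lt0r_neq0.
pose z := u%:C *: s; have sz : star z = z by rewrite starZR ss.
have [||r [sr rE _ cr]] := @sqrt_subr (z ** z).
- by rewrite starM sz.
- rewrite (csn_sa_sqr csn)// (csnZR csn) ger0_norm// exprMn -uu mulrC expr2.
  by rewrite ler_wpM2r// mulr_ge0.
have rz : scomm r z by apply/scomm_sym/cr; exact: scommM.
have pr : p (r ** r) <= 1.
  rewrite (csn_sa_sqr csn)// (le_trans (csn_sqr_le csn sr sz rz))//.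
  by rewrite rE subrK csn_one_le.
have -> : sc t - s ** s = t%:C *: (r ** r).
  rewrite rE scalerBr; congr (_ - _); rewrite /z !smulE !scalerA -!rmorphM/=.
  by rewrite uu scale1r.
by rewrite (csnZR csn) gtr0_norm// ler_piMr// ltW.
Qed.

Lemma pos_sa_sqr s : star s = s -> pos (s ** s).
Proof.
move=> ss; split; first by rewrite starM ss.
by exists (p s ^+ 2); [exact: sqr_ge0|exact: sa_sqr_subr].
Qed.

(** [pos] provides one [t]; here every [t] above the norm is shown to serve. *)
Lemma pos_le a t : pos a -> p a <= t -> p (sc t - a) <= t.
Proof.
by move=> /pos_sqrt[s [ss <- _ _]]; rewrite (csn_sa_sqr csn)// => /sa_sqr_subr; apply.
Qed.

(** The roots [v] of [a] and [w] of [t - a] commute, and [v ** v] is dominated in norm by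
    [v ** v + w ** w = t]. *)
Lemma pos_norm_le a t : 0 <= t -> pos a -> pos (sc t - a) -> p a <= t.
Proof.
move=> t0 /pos_sqrt[v [sv vE _ cv]] /pos_sqrt[w [sw wE _ cw]].
have vw : scomm v w.
  apply: cw; apply/scommD; first exact: scomm_sc.
  by apply/scommN; rewrite -vE; exact: scommM.
rewrite -vE (csn_sa_sqr csn)// (le_trans (csn_sqr_le csn sv sw vw))//.
by rewrite vE wE addrC subrK csn_sc.
Qed.

Lemma pos_norm_mono a b : pos a -> pos b -> p a <= p (a + b).
Proof.
move=> pa pb; apply: pos_norm_le => //; first exact: csn_ge0.
have -> : sc (p (a + b)) - a = (sc (p (a + b)) - (a + b)) + b by lmod.
apply: posD => //; apply: pos_subr => //.
by rewrite starD (proj1 pa) (proj1 pb).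
Qed.

(* The two sums of squares [c^* c + c c^*] of real and imaginary part show that
   [n = c c^*] is positive; then [n (T + n)^2 = c (T + c^* c)^2 c^*] has norm at
   most [T^3], where [T = |c|^2], although it dominates [2 T n^2]. *)
Lemma neg_star_smul_eq0 c : pos (- (star c ** c)) -> c = 0.
Proof.
move=> pm; set T := p c ^+ 2; pose n := c ** star c.
have T0 : 0 <= T by exact: sqr_ge0.
have pn : pos n.
  pose X := c + star c; pose Y := 'i%R *: (c - star c).
  have sX : star X = X by rewrite !starE addrC.
  have sY : star Y = Y.
    by rewrite starZ starB starK conjCi scaleNr -scalerN opprB.
  have -> : n = (2^-1)%:C *: (X ** X + Y ** Y) + (- (star c ** c)).
    have -> : X ** X + Y ** Y = 2%:C *: (c ** star c + star c ** c).
      have -> : Y ** Y = - ((c - star c) ** (c - star c)).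
        by rewrite scale_smull scale_smulr scalerA -expr2 sqrCi scaleN1r.
      by rewrite /X !smulE; lmod.
    by rewrite scalerA -rmorphM/= mulVf// scale1r addrK.
  by apply: posD => //; apply: posZ; [rewrite invr_ge0|apply: posD; exact: pos_sa_sqr].
have [sn _] := pn.
have pT : p (sc T + star c ** c) <= T.
  by rewrite -[_ ** _]opprK; apply: pos_le => //; rewrite (csnN csn) (csn_C csn).
have [v [sv vE _ cv]] := pos_sqrt pn.
have vn : scomm v n by rewrite -vE; exact: scommM.
have h1 : p ((2 * T)%:C *: (n ** n)) <= T ^+ 3.
  apply: le_trans (_ : p (n ** (sc T + n) ** (sc T + n)) <= _).
    have -> : n ** (sc T + n) ** (sc T + n) = (2 * T)%:C *: (n ** n) +
        ((T ^+ 2)%:C *: n + n ** n ** n).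
      by rewrite !smulE ?smulr1; lmod.
    apply: pos_norm_mono; first by apply: posZ; [rewrite mulr_ge0|exact: pos_sa_sqr].
    apply: posD; first by apply: posZ => //; exact: sqr_ge0.
    have -> : n ** n ** n = (v ** n) ** (v ** n).
      by rewrite (scommM_sqr vn) vE smulA.
    by apply: pos_sa_sqr; rewrite starM sn sv vn.
  have -> : n ** (sc T + n) ** (sc T + n) =
      c ** ((sc T + star c ** c) ** (sc T + star c ** c)) ** star c.
    by rewrite /n !smulE ?smulr1 ?smul1r.
  rewrite (le_trans (csn_M csn _ _))// (csn_star csn).
  have h : p (c ** ((sc T + star c ** c) ** (sc T + star c ** c))) <= p c * (T * T).
    rewrite (le_trans (csn_M csn _ _))// ler_wpM2l ?(csn_ge0 csn)//.
    by rewrite (le_trans (csn_M csn _ _))// ler_pM// (csn_ge0 csn).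
  rewrite (le_trans (ler_wpM2r (csn_ge0 csn c) h))// mulrAC -expr2 -/T.
  by rewrite !exprS expr0 mulr1.
have pnT : p n = T.
  by have := csn_C csn (star c); rewrite starK (csn_star csn).
(* With [p n = T], [h1] reads [2 * T * T ^+ 2 <= T ^+ 3]. *)
move: h1; rewrite (csnZR csn) (csn_sa_sqr csn)// pnT ger0_norm; last by lra.
move=> h1.
have hT : T ^+ 3 <= 0 by lra.
have T00 : T = 0.
  by have : T ^+ 3 == 0; [rewrite eq_le hT exprn_ge0|rewrite expf_eq0/= => /eqP].
apply: p_le0; move: T00; rewrite /T => /eqP; rewrite expf_eq0/= => /eqP ->; exact: lexx.
Qed.

(** Let [s] be the absolute value of [h = star c ** c]; then [x = s - h] is twice the negative part
    of [h]. From [x ** x = 2 s x] follows [x h x = - x s x], so minus [star (c ** x) ** (c ** x)] is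
    positive and [c ** x = 0] by the previous lemma. Hence [x ** x ** x = 0], so [x = 0] and
    [h = s]. *)
Lemma pos_star_smul c : pos (star c ** c).
Proof.
set h := star c ** c; have sh : star h = h by rewrite starM starK.
have [s [ss sE ps cs]] := pos_sqrt (pos_sa_sqr sh).
have hs : scomm h s by apply: cs; exact: scommM.
pose x := s - h; have sx : star x = x by rewrite starB ss sh.
have sx_comm : scomm s x by apply: scommD => //; exact: scommN.
have xx : x ** x = (s ** x) *+ 2.
  have : x ** (s + h) = 0 by rewrite /x scomm_subr_sqr ?sE ?subrr//; exact: scomm_sym.
  have -> : s + h = s *+ 2 - x by rewrite /x; lmod.
  rewrite smulBr smulrMn sx_comm => e; apply/eqP; rewrite eq_sym -subr_eq0; exact/eqP.
have xxx : x ** x ** x = (x ** s ** x) *+ 2.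
  by rewrite -smulA xx smulrMn smulA.
have xhx : x ** h ** x = - (x ** s ** x).
  have -> : h = s - x by rewrite /x; lmod.
  by rewrite smulBr smulBl xxx; lmod.
have [r [sr rE _ cr]] := pos_sqrt ps.
have xr : scomm x r by apply: cr; exact: scomm_sym.
have xsx : x ** s ** x = (x ** r) ** (x ** r).
  by rewrite (scommM_sqr xr) rE -!smulA sx_comm.
have c0 : c ** x = 0.
  apply: neg_star_smul_eq0.
  have -> : - (star (c ** x) ** (c ** x)) = (x ** r) ** (x ** r).
    rewrite -xsx starM sx smulA -(smulA x) -/h xhx; lmod.
  by apply: pos_sa_sqr; rewrite starM sx sr.
have x0 : x = 0.
  have : x ** h ** x = 0 by rewrite -{1}sx /h !smulA -starM c0 star0 !smul0r.
  rewrite xhx => /eqP; rewrite oppr_eq0 => /eqP xsx0.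
  have xxx0 : x ** x ** x = 0 by rewrite xxx xsx0 mul0rn.
  have : p ((x ** x) ** (x ** x)) = 0 by rewrite smulA xxx0 smul0r (csn0 csn).
  rewrite (csn_sa_sqr csn) ?starM ?sx// (csn_sa_sqr csn)//.
  by move/eqP; rewrite !expf_eq0/= => /eqP/p_eq0.
suff -> : h = s by [].
by apply/esym/eqP; rewrite -subr_eq0 -/x x0.
Qed.

Lemma star_smul_subr c t : p c ^+ 2 <= t -> p (sc t - star c ** c) <= t.
Proof. by move=> h; apply: (pos_le (pos_star_smul c)); rewrite (csn_C csn). Qed.

Fixpoint spow v n : B := if n is m.+1 then v ** spow v m else one.

Lemma spow_scomm y v n : scomm y v -> scomm y (spow v n).
Proof. by move=> yv; elim: n => [|n IH]; [exact: scomm1|exact: scommM]. Qed.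

Lemma spow_star v n : star v = v -> star (spow v n) = spow v n.
Proof.
move=> sv; elim: n => [|n IH] /=; first exact: star_one.
by rewrite starM IH sv; apply/scomm_sym/spow_scomm.
Qed.

Lemma spow_le1 v n : p v <= 1 -> p (spow v n) <= 1.
Proof.
move=> pv; elim: n => [|n IH] /=; first exact: csn_one_le.
by rewrite (le_trans (csn_M csn _ _))// mulr_ile1// (csn_ge0 csn).
Qed.

Lemma spow_sqr r v n : r ** r = v -> spow r n ** spow r n = spow v n.
Proof.
move=> rr; elim: n => [|n IH] /=; first exact: smul1r.
by rewrite scommM_sqr ?rr ?IH//; exact: spow_scomm.
Qed.

(* [1 - v^n - n h v^n] is positive for [v = 1 - h], [0 <= h <= 1]: passing from
   [n] to [n + 1] adds [(n + 1) h^2 v^n]. *)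
Lemma spow_smul_le j n : p j <= 1 ->
  n%:R * p (spow (one - j ** star j) n ** j) ^+ 2 <= 1.
Proof.
move=> pj; have ph : pos (j ** star j) by rewrite -{1}(starK j); exact: pos_star_smul.
have ph1 : p (j ** star j) <= 1.
  have := csn_C csn (star j); rewrite starK (csn_star csn) => ->.
  by rewrite exprn_ile1// (csn_ge0 csn).
have EK : forall w, star w = w -> p (w ** j) ^+ 2 = p (w ** (j ** star j) ** w).
  by move=> w sw; rewrite -(csn_star csn (w ** j)) -(csn_C csn) starK starM sw !smulA.
move: (j ** star j) ph ph1 EK => h ph ph1 EK.
have [sh _] := ph.
pose v := one - h; have vE : v = one - h by [].
have sv : star v = v by rewrite vE starB sh star_one.
have hv : scomm h v by rewrite vE; apply: scommD; [exact: scomm1|exact/scommN].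
have pv1 : p v <= 1 by have := pos_le ph ph1; rewrite scale1r.
have pv : pos v by have := pos_subr sh ph1; rewrite scale1r.
rewrite -vE; clearbody v.
have [r [sr rE _ cr]] := pos_sqrt pv; have hr := cr _ hv.
have [s [ss sE _ cs]] := pos_sqrt ph.
have sr_comm : scomm s r by apply/scomm_sym/cs/scomm_sym.
have phv m : pos (h ** spow v m).
  rewrite -(spow_sqr m rE) -sE -scommM_sqr; last exact: spow_scomm.
  by apply: pos_sa_sqr; rewrite starM ss spow_star//; apply/esym/spow_scomm.
have claim m : pos (one - spow v m - m%:R%:C *: (h ** spow v m)).
  elim: m => [|m IH]; first by rewrite /= subrr scale0r subrr; exact: pos0.
  have -> : one - spow v m.+1 - m.+1%:R%:C *: (h ** spow v m.+1) =
    (one - spow v m - m%:R%:C *: (h ** spow v m)) +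
      m.+1%:R%:C *: (h ** h ** spow v m).
    have -> : spow v m.+1 = spow v m - h ** spow v m by rewrite /= vE smulBl smul1r.
    by rewrite -natr1 smulBr smulA; lmod.
  apply: posD => //; apply: posZ => //.
  rewrite -(spow_sqr m rE) -scommM_sqr; last exact: spow_scomm.
  by apply: pos_sa_sqr; rewrite starM sh spow_star//; apply/esym/spow_scomm.
have hn : n%:R * p (h ** spow v n) <= 1.
  rewrite -[leLHS](_ : p (n%:R%:C *: (h ** spow v n)) = _); last first.
    by rewrite (csnZR csn) normr_nat.
  apply: pos_norm_le => //; first exact: posZ.
  rewrite scale1r.
  have -> : one - n%:R%:C *: (h ** spow v n) =
    (one - spow v n - n%:R%:C *: (h ** spow v n)) + spow r n ** spow r n.
    by rewrite (spow_sqr n rE); lmod.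
  by apply: posD => //; apply: pos_sa_sqr; exact: spow_star.
(* By [EK] the square to be bounded is the norm of [v^n h v^n], at most that of [v^n h] because
   [v^n] has norm at most 1. *)
rewrite EK ?spow_star// (spow_scomm n hv : _ = _) in hn *.
rewrite (le_trans _ hn)// ler_wpM2l// (le_trans (csn_M csn _ _))//.
by rewrite ler_piMr ?(csn_ge0 csn)// spow_le1.
Qed.

End unital_cstar_norm.

(** * Irreducible representations attaining a C*-seminorm *)

Section sublinear.
Variables (R : realType) (V : lmodType R[i]).
Implicit Types (q f g : V -> R) (a b h : V) (t : R).

Record sublinear q : Prop := Sublinear {
  sublinearD : forall a b, q (a + b) <= q a + q b;
  sublinearZ : forall t a, 0 <= t -> q (t%:C *: a) = t * q a }.

Record real_linear f : Prop := RealLinear {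
  real_linearD : forall a b, f (a + b) = f a + f b;
  real_linearZ : forall t a, f (t%:C *: a) = t * f a }.

Lemma sublinear0 q : sublinear q -> q 0 = 0.
Proof. by move=> sq; rewrite -(scale0r 0) (sublinearZ sq) ?mul0r. Qed.

Lemma sublinear_ge q a : sublinear q -> - q (- a) <= q a.
Proof. by move=> sq; have := sublinearD sq a (- a); rewrite subrr sublinear0//; lra. Qed.

Lemma real_linearN f a : real_linear f -> f (- a) = - f a.
Proof.
move=> rf; have -> : - a = (-1)%:C *: a by rewrite rmorphN scaleN1r.
by rewrite (real_linearZ rf) mulN1r.
Qed.

Section infimum.
Variables (I : Type) (i0 : I) (F : I -> V -> R).
Hypotheses (Flb : forall a, exists m, forall i, m <= F i a)
  (FD : forall i j a b, exists k, F k (a + b) <= F i a + F j b)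
  (FZ : forall i t a, 0 < t -> exists k, F k (t%:C *: a) <= t * F i a).

Definition infF a := inf (range (F^~ a)).

Lemma infF_le i a : infF a <= F i a.
Proof.
apply: ge_inf; last by exists i.
by have [m hm] := Flb a; exists m => _ [j _ <-].
Qed.

Lemma le_infF m a : (forall i, m <= F i a) -> m <= infF a.
Proof.
move=> hm; apply: lb_le_inf; first by exists (F i0 a), i0.
by move=> _ [i _ <-].
Qed.

Lemma infF_sublinear : sublinear infF.
Proof.
have Zle t a : 0 < t -> infF (t%:C *: a) <= t * infF a.
  move=> t0; rewrite -ler_pdivrMl//; apply: le_infF => i; rewrite ler_pdivrMl//.
  by have [k hk] := FZ i a t0; exact: le_trans (infF_le _ _) hk.
have Z t a : 0 < t -> infF (t%:C *: a) = t * infF a.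
  move=> t0; apply/le_anti; rewrite Zle//= -ler_pdivlMl//.
  rewrite (le_trans _ (Zle t^-1 _ _)) ?invr_gt0// scalerA -rmorphM/=.
  by rewrite mulVf ?lt0r_neq0// scale1r.
split=> [a b|t a].
  rewrite -lerBlDr; apply: le_infF => i; rewrite lerBlDl -lerBlDr.
  apply: le_infF => j; rewrite lerBlDr [leRHS]addrC.
  by have [k hk] := FD i j a b; exact: le_trans (infF_le _ _) hk.
rewrite le0r => /predU1P[->|]; last exact: Z.
(* Homogeneity at [t = 2] gives [infF 0 = 2 * infF 0]. *)
rewrite scale0r mul0r; have := Z 2 0 (ltr0Sn _ 1); rewrite scaler0; lra.
Qed.
End infimum.

(** The functionals below [q] form a face of the set of those below [q0]; for linear [q] this is
    extremality. The [g]s stand for multiples [l * f] of functionals, so that weight 0 needs no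
    division. *)
Definition extreme_below q0 q := forall l1 l2 g1 g2, 0 <= l1 -> 0 <= l2 ->
  l1 + l2 = 1 -> real_linear g1 -> real_linear g2 ->
  (forall a, g1 a <= l1 * q0 a) -> (forall a, g2 a <= l2 * q0 a) ->
  (forall a, g1 a + g2 a <= q a) ->
  (forall a, g1 a <= l1 * q a) /\ (forall a, g2 a <= l2 * q a).

(* The sublinear functional of the face [{f <= q | f h = q h}]. *)
Definition face_at q h a :=
  infF (fun (t : {nonneg R}) a => q (a + t%:num%:C *: h) - t%:num * q h) a.

Lemma face_at_lb q h a : sublinear q -> exists m,
  forall t : {nonneg R}, m <= q (a + t%:num%:C *: h) - t%:num * q h.
Proof.
move=> sq; exists (- q (- a)) => t.
have := sublinearD sq (a + t%:num%:C *: h) (- a); rewrite addrAC subrr add0r.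
by rewrite (sublinearZ sq)//; lra.
Qed.

Lemma face_at_le q h t a : sublinear q -> 0 <= t ->
  face_at q h a <= q (a + t%:C *: h) - t * q h.
Proof.
by move=> sq t0; exact: (infF_le (fun a => face_at_lb h a sq) (NngNum t0)).
Qed.

Lemma face_at_sublinear q h : sublinear q -> sublinear (face_at q h).
Proof.
move=> sq; apply: (infF_sublinear 0%:nng) => [a|i j a b|i t a t0].
- exact: face_at_lb.
- exists (i%:num + j%:num)%:nng => /=.
  have -> : a + b + (i%:num + j%:num)%:C *: h =
    (a + i%:num%:C *: h) + (b + j%:num%:C *: h) by lmod.
  have := sublinearD sq (a + i%:num%:C *: h) (b + j%:num%:C *: h); lra.
- exists (NngNum (mulr_ge0 (ltW t0) (ge0 i))) => /=.
  have -> : t%:C *: a + (t * i%:num)%:C *: h = t%:C *: (a + i%:num%:C *: h) by lmod.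
  by rewrite (sublinearZ sq) ?(ltW t0)// mulrBr mulrA.
Qed.

(** A sum below [face_at q h] takes at [h] at least the value [q h], while each summand is at most
    [l * q h] there; so both bounds are attained. A functional below [l * q] that attains it at [h]
    lies below [l * face_at q h], as is seen at [a + t h]. *)
Lemma face_at_extreme q0 q h : sublinear q -> (forall a, q a <= q0 a) ->
  extreme_below q0 q -> extreme_below q0 (face_at q h).
Proof.
move=> sq qq0 eq l1 l2 g1 g2 l10 l20 l12 r1 r2 h1 h2 h12.
have fq a : face_at q h a <= q a.
  by have := face_at_le h a sq (lexx 0); rewrite scale0r addr0 mul0r subr0.
have [k1 k2] := eq l1 l2 g1 g2 l10 l20 l12 r1 r2 h1 h2
  (fun a => le_trans (h12 a) (fq a)).
have hh : q h <= g1 h + g2 h.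
  have := h12 (- h); have := face_at_le h (- h) sq ler01.
  rewrite scale1r addNr sublinear0// (real_linearN _ r1) (real_linearN _ r2); lra.
have e12 : q h = l1 * q h + l2 * q h by rewrite -mulrDl l12 mul1r.
have [e1 e2] : g1 h = l1 * q h /\ g2 h = l2 * q h.
  by have := k1 h; have := k2 h; split; lra.
have key l g a : 0 <= l -> real_linear g -> (forall a, g a <= l * q a) ->
    g h = l * q h -> g a <= l * face_at q h a.
  move=> l0 rg hg gh; move: l0; rewrite le0r => /predU1P[E|l0].
    by have := hg a; rewrite E !mul0r.
  rewrite mulrC -ler_pdivrMr//; apply: (le_infF 0%:nng) => t.
  rewrite ler_pdivrMr// mulrBl.
  have := hg (a + t%:num%:C *: h); rewrite (real_linearD rg) (real_linearZ rg) gh; lra.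
by split=> a; apply: key.
Qed.

(* Replaces Hahn-Banach and Krein-Milman: a minimal element among the sublinear
   functionals cut out by faces is linear. *)
Lemma extreme_real_linear q0 h : sublinear q0 -> exists f,
  [/\ real_linear f, forall a, f a <= q0 a, f h = q0 h & extreme_below q0 f].
Proof.
move=> s0; have le0 a : face_at q0 h a <= q0 a.
  by have := face_at_le h a s0 (lexx 0); rewrite scale0r addr0 mul0r subr0.
pose good q := [/\ sublinear q, forall a, q a <= face_at q0 h a & extreme_below q0 q].
have good0 : good (face_at q0 h).
  split; [exact: face_at_sublinear| by []|apply: face_at_extreme => //].
pose T := {q | good q}.
pose le (x y : T) := `[< forall a, sval y a <= sval x a >].
(* The order [le] is reversed, so a maximal element is a smallest sublinear functional. *)
have [| | | |[q gq] qmax] := @Zorn T le.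
- by move=> x; apply/asboolP.
- move=> x y z /asboolP xy /asboolP yz; apply/asboolP => a; exact: le_trans (xy a).
- move=> [x gx] [y gy] /asboolP xy /asboolP yx; apply: eq_exist => /=.
  by apply/funext => a; apply/le_anti; rewrite xy yx.
(* A nonempty chain is bounded by its pointwise infimum, the empty one by [face_at q0 h]. *)
- move=> A totA; have [exA|A0] := pselect (exists x : T, A x); last first.
    by exists (exist _ _ good0) => s As; case: A0; exists s.
  case: exA => q1 Aq1; pose I := {x : T | A x}.
  pose i0 : I := exist _ q1 Aq1.
  pose F (i : I) := sval (sval i).
  have gF i : good (F i) by exact: (svalP (sval i)).
  have Flb a : exists m, forall i, m <= F i a.
    exists (- q0 (- a)) => i; have [sF F0 _] := gF i.
    have := sublinear_ge a sF; have := le_trans (F0 (- a)) (le0 (- a)); lra.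
  have sI : sublinear (infF F).
    apply: (infF_sublinear i0) => // [i j a b|i t a t0]; last first.
      by exists i; have [sF _ _] := gF i; rewrite (sublinearZ sF) ?(ltW t0).
    have [si _ _] := gF i; have [sj _ _] := gF j.
    have [/asboolP ij|/asboolP ji] := totA _ _ (svalP i) (svalP j).
      exists j; rewrite (le_trans (sublinearD sj _ _))// lerD2r; exact: ij.
    exists i; rewrite (le_trans (sublinearD si _ _))// lerD2l; exact: ji.
  have gI : good (infF F).
    split=> // [a|].
      by have [_ k _] := gF i0; exact: le_trans (infF_le Flb i0 a) (k a).
    move=> l1 l2 g1 g2 l10 l20 l12 r1 r2 h1 h2 h12.
    have k i : (forall a, g1 a <= l1 * F i a) /\ (forall a, g2 a <= l2 * F i a).
      have [_ _ ei] := gF i; apply: ei => // a.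
      exact: le_trans (h12 a) (infF_le Flb i a).
    have key l g a : 0 <= l -> (forall i a, g a <= l * F i a) -> g a <= l * infF F a.
      rewrite le0r => /predU1P[->|l0] hg; first by have := hg i0 a; rewrite !mul0r.
      by rewrite mulrC -ler_pdivrMr//; apply: (le_infF i0) => i; rewrite ler_pdivrMr// mulrC.
    by split=> a; apply: key => // i; [exact: (k i).1|exact: (k i).2].
  exists (exist _ _ gI) => s As; apply/asboolP => a /=.
  exact: (@infF_le _ F Flb (exist _ s As)).
have [sq qle eq] := gq.
(* Minimality forbids cutting out a smaller face. With [t = 1] the equality gives
   [q a + q k <= q (a + k)], the missing half of additivity. *)
have qh k a : face_at q k a = q a.
  have gk : good (face_at q k).
    split; first exact: face_at_sublinear.
      move=> b; apply: le_trans (qle b).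
      by have := face_at_le k b sq (lexx 0); rewrite scale0r addr0 mul0r subr0.
    by apply: face_at_extreme => // b; exact: le_trans (qle b) (le0 b).
  have E : exist _ _ gk = exist _ q gq :> T.
    apply: qmax; apply/asboolP => b /=.
    by have := face_at_le k b sq (lexx 0); rewrite scale0r addr0 mul0r subr0.
  by have /= -> := congr1 (@sval _ good) E.
have qD a b : q (a + b) = q a + q b.
  apply/le_anti; rewrite (sublinearD sq)/= -lerBrDr.
  by have := face_at_le b a sq ler01; rewrite qh scale1r mul1r.
have qN a : q (- a) = - q a.
  by apply/eqP; rewrite -addr_eq0 -qD addNr sublinear0.
have lq : real_linear q.
  split=> // t a; have [t0|t0] := leP 0 t; first exact: sublinearZ.
  have -> : t%:C *: a = - ((- t)%:C *: a) by lmod.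
  by rewrite qN (sublinearZ sq) ?oppr_ge0 ?ltW// mulNr opprK.
exists q; split => // [a|]; first exact: le_trans (qle a) (le0 a).
(* The value at [h] is attained because [q] lies below [face_at q0 h], which at [- h] is at most
   [- q0 h]. *)
apply/le_anti; rewrite (le_trans (qle h) (le0 h))/= -lerN2 -qN.
rewrite (le_trans (qle _))// (le_trans (face_at_le _ _ s0 ler01))//.
by rewrite scale1r addNr sublinear0// mul1r sub0r.
Qed.

End sublinear.

(** * The Jordan-von Neumann theorem *)

Section jordan_von_neumann.
Variables (R : realType) (V : lmodType R[i]) (N : V -> R).
Hypotheses (N_ge0 : forall u, 0 <= N u)
  (NZ : forall k u, N (k *: u) = cabs k ^+ 2 * N u)
  (N_parallelogram : forall u v, N (u + v) + N (u - v) = 2 * N u + 2 * N v).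
Implicit Types (u v w : V) (t : R) (k : R[i]).

Definition polar u v : R := (N (u + v) - N u - N v) / 2.

Lemma quad0 : N 0 = 0.
Proof. by rewrite -(scale0r 0) NZ cabs0 expr0n mul0r. Qed.

Lemma quadi u : N ('i%R *: u) = N u.
Proof. by rewrite NZ cabsi expr1n mul1r. Qed.

Lemma polarC u v : polar u v = polar v u.
Proof. by rewrite /polar (addrC v u) addrAC. Qed.

Lemma polarDl u v w : polar (u + v) w = polar u w + polar v w.
Proof.
have h1 := N_parallelogram (u + w) v.
have h2 := N_parallelogram (v + w) u.
have h3 := N_parallelogram w (u - v).
have h4 := N_parallelogram u v.
move: h1 h2 h3; rewrite /polar.
have -> : u + w + v = u + v + w by rewrite addrAC.
have -> : v + w + u = u + v + w by lmod.
have -> : w + (u - v) = u + w - v by lmod.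
have -> : w - (u - v) = v + w - u by lmod.
lra.
Qed.

Lemma polar0l u : polar 0 u = 0.
Proof. by rewrite /polar add0r quad0; lra. Qed.

Lemma polarNl u v : polar (- u) v = - polar u v.
Proof. by apply/eqP; rewrite -addr_eq0 -polarDl addNr polar0l. Qed.

Lemma polarMnl u v n : polar (u *+ n) v = polar u v *+ n.
Proof. by elim: n => [|n IH]; rewrite ?mulr0n ?polar0l// !mulrS polarDl IH. Qed.

Lemma polar_bounded u v : exists C, forall t, 0 <= t <= 1 ->
  `|polar (t%:C *: u) v| <= C.
Proof.
exists (2 * N u + 2 * N v) => t /andP[t0 t1].
have NtZ : N (t%:C *: u) <= N u.
  by rewrite NZ cabsR ler_piMl// real_normK ?num_real// expr_le1.
have := N_parallelogram (t%:C *: u) v.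
have := N_ge0 (t%:C *: u + v); have := N_ge0 (t%:C *: u - v).
have := N_ge0 u; have := N_ge0 v; have := N_ge0 (t%:C *: u).
by rewrite /polar ler_norml => *; apply/andP; split; lra.
Qed.

(* [polar] is additive, and bounded for [t] in [0, 1]. *)
Lemma polarZl t u v : polar (t%:C *: u) v = t * polar u v.
Proof.
have [C hC] := polar_bounded u v.
(* Removing the integer part of [s] leaves the deviation from linearity unchanged, so it is bounded
   uniformly in [s]. Replacing [s] by [n s] multiplies it by [n], so it vanishes. *)
have key s : 0 <= s -> `|polar (s%:C *: u) v - s * polar u v| <= C + `|polar u v|.
  move=> s0; have /andP[h1 h2] := truncn_itv s0.
  set n := Num.truncn s in h1 h2; pose r := s - n%:R.
  have r01 : 0 <= r <= 1 by rewrite /r subr_ge0 h1/= lerBlDr addrC natr1 ltW.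
  have -> : polar (s%:C *: u) v - s * polar u v = polar (r%:C *: u) v - r * polar u v.
    have -> : s%:C *: u = r%:C *: u + u *+ n.
      by rewrite -scaler_nat /r rmorphB/= scalerBl rmorph_nat subrK.
    by rewrite polarDl polarMnl -mulr_natl /r; ring.
  rewrite (le_trans (ler_normB _ _))// lerD ?hC// normrM ler_piMl//.
  by case/andP: r01 => r0 r1; rewrite ger0_norm.
have pos_case s : 0 <= s -> polar (s%:C *: u) v = s * polar u v.
  move=> s0; apply/eqP; rewrite -subr_eq0 -normr_le0.
  set D := `|_|; rewrite leNgt; apply/negP => D0.
  have K0 : 0 <= C + `|polar u v|.
    by rewrite (le_trans _ (key 0 _))// normr_ge0.
  pose n := Num.bound ((C + `|polar u v|) / D).
  have := archi_boundP (divr_ge0 K0 (ltW D0)); rewrite -/n ltr_pdivrMr// => h.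
  have := key (n%:R * s) (mulr_ge0 (ler0n _ _) s0).
  have -> : (n%:R * s)%:C *: u = (s%:C *: u) *+ n.
    by rewrite -scaler_nat rmorphM/= rmorph_nat scalerA.
  rewrite polarMnl (_ : _ - _ = n%:R * (polar (s%:C *: u) v - s * polar u v)).
    by rewrite normrM normr_nat -/D; lra.
  by rewrite -mulr_natl; ring.
have [t0|t0] := leP 0 t; first exact: pos_case.
have -> : t%:C *: u = - ((- t)%:C *: u) by lmod.
by rewrite polarNl pos_case ?oppr_ge0 ?ltW// mulNr opprK.
Qed.

Lemma polar_id u : polar u u = N u.
Proof.
rewrite /polar -mulr2n -scaler_nat NZ -(rmorph_nat (real_complex R)) cabsR normr_nat.
by field.
Qed.

Lemma polar_i u v : polar ('i%R *: u) ('i%R *: v) = polar u v.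
Proof. by rewrite /polar -scalerDr !quadi. Qed.

Lemma scale_i_i u : 'i%R *: ('i%R *: u) = - u :> V.
Proof. by rewrite scalerA -expr2 sqrCi scaleN1r. Qed.

Lemma polar_il u v : polar ('i%R *: u) v = - polar u ('i%R *: v).
Proof. by rewrite -polar_i scale_i_i polarNl. Qed.

Lemma quadD u v : N (u + v) = N u + N v + 2 * polar u v.
Proof. by rewrite /polar; field. Qed.

Lemma polar_cs u v : polar u v ^+ 2 <= N u * N v.
Proof.
have h t : 0 <= N u + t ^+ 2 * N v + 2 * t * polar u v.
  have := N_ge0 (u + t%:C *: v).
  by rewrite quadD polarC polarZl polarC NZ cabsR real_normK ?num_real// mulrA.
have := N_ge0 v; rewrite le0r => /predU1P[Nv0|Nv0].
  rewrite Nv0 mulr0; have [->|P0] := eqVneq (polar u v) 0; first by rewrite expr0n.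
  have := h (- (N u + 1) / (2 * polar u v)); rewrite Nv0 mulr0 addr0.
  have -> : 2 * (- (N u + 1) / (2 * polar u v)) * polar u v = - (N u + 1) by field.
  lra.
have := h (- polar u v / N v).
have -> : N u + (- polar u v / N v) ^+ 2 * N v + 2 * (- polar u v / N v) * polar u v
   = (N u * N v - polar u v ^+ 2) / N v by field; exact: lt0r_neq0.
by rewrite pmulr_lge0 ?invr_gt0// subr_ge0.
Qed.

Lemma quad_triangle u v : Num.sqrt (N (u + v)) <= Num.sqrt (N u) + Num.sqrt (N v).
Proof.
have := polar_cs u v; have := quadD u v.
have := sqr_sqrtr (N_ge0 (u + v)); have := sqr_sqrtr (N_ge0 u).
have := sqr_sqrtr (N_ge0 v); have := sqrtr_ge0 (N (u + v)).
have := sqrtr_ge0 (N u); have := sqrtr_ge0 (N v).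
move: (Num.sqrt (N u)) (Num.sqrt (N v)) (Num.sqrt (N (u + v))) => a b c.
move: (polar u v) => P b0 a0 c0 <- <- <- hc hP.
have hPab : P <= a * b.
  rewrite leNgt; apply/negP => h.
  have := mulr_ge0 a0 b0; move: h hP; rewrite -exprMn; move: (a * b) => d; nra.
rewrite leNgt; apply/negP => h; nra.
Qed.

(** For a form that is linear in [u] and antilinear in [v], the imaginary part at [(u, v)] is the
    real part at [(u, i v)]. *)
Definition polar_form u v : R[i] :=
  (polar u v)%:C + 'i%R * (polar u ('i%R *: v))%:C.

Lemma polar_formDl u v w : polar_form (u + v) w = polar_form u w + polar_form v w.
Proof. by rewrite /polar_form !polarDl !rmorphD/=; ring. Qed.

Lemma polar_formZl k u v : polar_form (k *: u) v = k * polar_form u v.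
Proof.
have [x [y ->]] : exists x y : R, k = x%:C + 'i%R * y%:C.
  by exists (Re k), (Im k); rewrite -complexiE -complexE.
have e1 w : polar ((x%:C + 'i%R * y%:C) *: u) w
    = x * polar u w - y * polar u ('i%R *: w).
  have -> : (x%:C + 'i%R * y%:C) *: u = x%:C *: u + y%:C *: ('i%R *: u) by lmod.
  by rewrite polarDl !polarZl polar_il; ring.
have i2 : 'i%R * 'i%R = -1 :> R[i] by rewrite -expr2 sqrCi.
rewrite /polar_form !e1 scale_i_i.
rewrite (polarC u (- v)) polarNl (polarC v).
move: (polar u v) (polar u ('i%R *: v)) => p q.
rewrite !rmorphB/= !rmorphM/= !rmorphN/=.
transitivity (x%:C * p%:C + ('i%R * 'i%R) * (y%:C * q%:C) +
   'i%R * (x%:C * q%:C + y%:C * p%:C)); last by ring.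
by rewrite i2; ring.
Qed.

Lemma polar_form_conj u v : polar_form u v = (polar_form v u)^*%R.
Proof.
rewrite /polar_form rmorphD rmorphM /= !conj_realC conjCi.
rewrite (polarC v u) (polarC v) polar_il rmorphN; ring.
Qed.

Lemma polar_form_id u : polar_form u u = (N u)%:C.
Proof.
have h : polar u ('i%R *: u) = 0 by have := polar_il u u; rewrite polarC; lra.
by rewrite /polar_form polar_id h mulr0 addr0.
Qed.

End jordan_von_neumann.

Section complex_norm.
Variables (R : realType) (V : normedModType R[i]).
Implicit Types (u v : V) (k : R[i]).

Definition nrm v : R := Re `|v|.

Lemma nrmE v : `|v| = (nrm v)%:C.
Proof.
have := ger0_Im (normr_ge0 v); rewrite /nrm; case: `|v| => a b /= ->.
by [].
Qed.

Lemma nrm_ge0 v : 0 <= nrm v.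
Proof. by rewrite -ler0c -nrmE. Qed.
Lemma nrmD u v : nrm (u + v) <= nrm u + nrm v.
Proof. by rewrite -lecR rmorphD /= -!nrmE ler_normD. Qed.
Lemma nrmZ k v : nrm (k *: v) = cabs k * nrm v.
Proof. by apply: complexI; rewrite rmorphM /= -!nrmE normrZ cabsE. Qed.
Lemma nrm0 : nrm 0 = 0.
Proof. by rewrite /nrm normr0. Qed.
Lemma nrmN v : nrm (- v) = nrm v.
Proof. by rewrite /nrm normrN. Qed.
Lemma nrm_eq0 v : nrm v = 0 -> v = 0.
Proof. by move=> h; apply/normr0_eq0; rewrite nrmE h. Qed.
Lemma nrmB u v : nrm (u - v) <= nrm u + nrm v.
Proof. by rewrite -(nrmN v) nrmD. Qed.
Lemma nrm_dist u v : nrm (u - v) = nrm (v - u).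
Proof. by rewrite -nrmN opprB. Qed.
Lemma nrm_triangle w u v : nrm (u - v) <= nrm (u - w) + nrm (w - v).
Proof. by have := nrmD (u - w) (w - v); rewrite addrA subrK. Qed.
Lemma nrm_sub u v : nrm u <= nrm v + nrm (u - v).
Proof. by have := nrmD v (u - v); rewrite addrC subrK. Qed.

Lemma ballC_nrm u v (e : R) : ball u e%:C v <-> nrm (u - v) < e.
Proof. by rewrite -ball_normE /ball_ /= nrmE ltcR. Qed.

End complex_norm.

Lemma posC (R : realType) (e : R[i]) : 0 < e -> exists2 t : R, 0 < t & e = t%:C.
Proof.
move=> e0; exists (Re e).
  by move: e0; rewrite ltcE => /andP[_].
by have := ger0_Im (ltW e0); case: e {e0} => a b /= ->.
Qed.

(** * The Hilbert space of bounded antilinear functionals of a semidefinite form *)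

Record prehilbert (R : realType) (B : lmodType R[i]) := Prehilbert {
  pform :> B -> B -> R[i];
  pformP : forall k a b c, pform (k *: a + b) c = k * pform a c + pform b c;
  pform_conj : forall a b, pform a b = (pform b a)^*%R;
  pform_ge0 : forall a, 0 <= Re (pform a a) }.

Section antidual.
Variables (R : realType) (B : lmodType R[i]) (S : prehilbert B).
Implicit Types (a b c : B) (t : R) (k : R[i]).

Local Notation sq b := (Re (S b b)).

Lemma pformDl a b c : S (a + b) c = S a c + S b c.
Proof. by rewrite -[a in LHS]scale1r pformP mul1r. Qed.
Lemma pform0l c : S 0 c = 0.
Proof. by apply: (addrI (S 0 c)); rewrite -pformDl !addr0. Qed.
Lemma pformZl k a c : S (k *: a) c = k * S a c.
Proof. by rewrite -[k *: a]addr0 pformP pform0l addr0. Qed.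
Lemma pformDr a b c : S a (b + c) = S a b + S a c.
Proof. by rewrite pform_conj pformDl rmorphD /= -!pform_conj. Qed.
Lemma pformZr k a c : S a (k *: c) = k^*%R * S a c.
Proof. by rewrite pform_conj pformZl rmorphM /= -!pform_conj. Qed.
Lemma pformNl a b : S (- a) b = - S a b.
Proof. by rewrite -scaleN1r pformZl mulN1r. Qed.
Lemma pformNr a b : S a (- b) = - S a b.
Proof. by rewrite -scaleN1r pformZr rmorphN rmorph1 mulN1r. Qed.

Lemma ReJ k : Re (k^*%R) = Re k.
Proof. by case: k. Qed.
Lemma ReD k l : Re (k + l) = Re k + Re l. Proof. exact: raddfD. Qed.
Lemma ReN k : Re (- k) = - Re k. Proof. exact: raddfN. Qed.
Lemma ReM_real t k : Re (t%:C * k) = t * Re k.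
Proof. by case: k => x y /=; rewrite mul0r subr0. Qed.

Lemma sqD a b : sq (a + b) = sq a + sq b + 2 * Re (S a b).
Proof.
rewrite pformDl !pformDr !ReD (_ : Re (S b a) = Re (S a b)).
  by ring.
by rewrite pform_conj ReJ.
Qed.

Lemma sqZ k a : sq (k *: a) = cabs k ^+ 2 * sq a.
Proof. by rewrite pformZl pformZr mulrA -cabs_sqr ReM_real. Qed.

(** The supremum of [2 * Re (f b) - sq b] is the squared dual norm of [f]. It makes sense for a
    degenerate form and forces [f] to vanish on null vectors, so the space of such [f] is the
    separated completion without any quotient. *)
Record antilinear_bounded (f : B -> R[i]) : Prop := AntilinearBounded {
  antilinearP : forall k a b, f (k *: a + b) = k^*%R * f a + f b;
  antilinear_bound : exists K, forall b, 2 * Re (f b) - sq b <= K }.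

Lemma antiD f a b : antilinear_bounded f -> f (a + b) = f a + f b.
Proof. by move=> fa; rewrite -{1}[a]scale1r (antilinearP fa) rmorph1 mul1r. Qed.
Lemma anti0 f : antilinear_bounded f -> f 0 = 0.
Proof. by move=> fa; apply: (addrI (f 0)); rewrite -antiD// !addr0. Qed.
Lemma antiZ f k a : antilinear_bounded f -> f (k *: a) = k^*%R * f a.
Proof. by move=> fa; rewrite -[k *: a]addr0 (antilinearP fa) anti0// addr0. Qed.

(* Halving the arguments makes [2 Re f b - sq b] subadditive up to a factor. *)
Lemma antilinear_half f a : antilinear_bounded f ->
  2 * Re (f ((2^-1)%:C *: a)) - sq ((2^-1)%:C *: a) = Re (f a) - sq a / 4.
Proof.
move=> fa; rewrite antiZ// conj_realC ReM_real sqZ cabsR ger0_norm ?invr_ge0//.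
by field.
Qed.

Definition antidual_pred : {pred B -> R[i]} := fun f => `[< antilinear_bounded f >].

Lemma antidual_bound_scale f k b K : antilinear_bounded f ->
  (forall b, 2 * Re (f b) - sq b <= K) ->
  2 * Re (k * f b) - sq b <= cabs k ^+ 2 * K.
Proof.
move=> fa hK; have [->|k0] := eqVneq k 0.
  by rewrite mul0r /= mulr0 cabs0 expr0n mul0r sub0r oppr_le0 pform_ge0.
have c0 : cabs k != 0 by apply: contra_neq k0 => /cabs_eq0.
have c20 : 0 < cabs k ^+ 2 by rewrite exprn_gt0// lt0r c0 cabs_ge0.
have := hK (k^-1 *: b); rewrite antiZ// sqZ.
have -> : cabs k^-1 = (cabs k)^-1.
  by apply: (mulfI c0); rewrite divff// -cabsM divff// /cabs normr1.
rewrite -(ler_pM2l c20); apply: le_trans.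
rewrite mulrBr (mulrA _ (_ ^+ 2)) exprVn divff ?gt_eqF// mul1r lerD2r.
have -> : k * f b = (cabs k ^+ 2)%:C * ((k^-1)^*%R * f b).
  by rewrite cabs_sqr mulrA -(mulrA k) -rmorphM divff// rmorph1 mulr1.
by rewrite ReM_real; lra.
Qed.

Lemma antidual_submod_closed : submod_closed antidual_pred.
Proof.
split.
  apply/asboolP; split=> [k a b|]; first by rewrite mulr0 addr0.
  by exists 0 => b; rewrite /= mulr0 sub0r oppr_le0 pform_ge0.
move=> k f g /asboolP fa /asboolP ga; apply/asboolP.
have [_ [K hK]] := fa; have [_ [L hL]] := ga.
split=> [l a b|].
  by rewrite !fctE (antilinearP fa) (antilinearP ga) /GRing.scale/=; ring.
(* The expression for [k f + g] is the average of those for [2 k f] and [2 g]. *)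
exists (cabs (2%:C * k) ^+ 2 * K / 2 + cabs 2%:C ^+ 2 * L / 2) => b; rewrite !fctE.
have := antidual_bound_scale (2%:C * k) b fa hK.
have := antidual_bound_scale 2%:C b ga hL.
rewrite -mulrA !ReM_real ReD /GRing.scale/=; lra.
Qed.

HB.instance Definition _ :=
  GRing.isSubmodClosed.Build R[i] (B -> R[i]) antidual_pred antidual_submod_closed.

Record antidual : Type :=
  Antidual { antidual_fun :> B -> R[i]; _ : antidual_fun \in antidual_pred }.

HB.instance Definition _ := [isSub for antidual_fun].
HB.instance Definition _ := [Choice of antidual by <:].
HB.instance Definition _ := [SubChoice_isSubLmodule of antidual by <:].

Implicit Types (f g : antidual).

Lemma antidualP f : antilinear_bounded f.
Proof. by case: f => f /= /asboolP. Qed.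

Lemma antidual_ext f g : f =1 g -> f = g.
Proof. by move=> /funext h; exact: val_inj. Qed.

Lemma antidualD f g b : (f + g) b = f b + g b. Proof. by []. Qed.
Lemma antidualZ k f b : (k *: f) b = k * f b. Proof. by []. Qed.
Lemma antidualN f b : (- f) b = - f b. Proof. by []. Qed.

Definition antidual_quad f : R := sup (range (fun b => 2 * Re (f b) - sq b)).

Lemma antidual_quad_ub f b : 2 * Re (f b) - sq b <= antidual_quad f.
Proof.
have [_ [K hK]] := antidualP f.
by apply: ub_le_sup; [exists K => _ [c _ <-]|exists b].
Qed.

Lemma antidual_quad_lub f K : (forall b, 2 * Re (f b) - sq b <= K) ->
  antidual_quad f <= K.
Proof.
move=> hK; apply: ge_sup; first by exists (2 * Re (f 0) - sq 0), 0.
by move=> _ [c _ <-].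
Qed.

Lemma antidual_quad_ge0 f : 0 <= antidual_quad f.
Proof.
have := antidual_quad_ub f 0; rewrite (anti0 (antidualP f)) pform0l /=; lra.
Qed.

Lemma antidual_quadZ k f : antidual_quad (k *: f) = cabs k ^+ 2 * antidual_quad f.
Proof.
have le l g : antidual_quad (l *: g) <= cabs l ^+ 2 * antidual_quad g.
  apply: antidual_quad_lub => b.
  exact: (antidual_bound_scale l b (antidualP g) (antidual_quad_ub g)).
apply/le_anti; rewrite le/=.
have [->|k0] := eqVneq k 0.
  by rewrite cabs0 expr0n mul0r antidual_quad_ge0.
have := le k^-1 (k *: f); rewrite scalerA mulVf// scale1r => h.
have h2 : cabs k ^+ 2 * cabs k^-1 ^+ 2 = 1.
  by rewrite -exprMn -cabsM divff// /cabs normr1 expr1n.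
have := ler_wpM2l (sqr_ge0 (cabs k)) h; rewrite mulrA h2; lra.
Qed.

(** Testing the suprema of [u] and [v] at the half sum and half difference of [b] and [c] gives one
    inequality; for [f + g] and [f - g] it becomes the reverse one. *)
Lemma antidual_parallelogram f g :
  antidual_quad (f + g) + antidual_quad (f - g) =
  2 * antidual_quad f + 2 * antidual_quad g.
Proof.
have le u v : antidual_quad (u + v) + antidual_quad (u - v) <=
    2 * antidual_quad u + 2 * antidual_quad v.
  rewrite -lerBrDr; apply: antidual_quad_lub => b; rewrite lerBrDr -lerBrDl.
  apply: antidual_quad_lub => c; rewrite lerBrDl.
  have := antidual_quad_ub u ((2^-1)%:C *: (b + c)).
  have := antidual_quad_ub v ((2^-1)%:C *: (b - c)).
  rewrite !(antilinear_half _ (antidualP _)).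
  rewrite (antiD _ _ (antidualP u)) (antiD _ _ (antidualP v)).
  have hN (w : antidual) : w (- c) = - w c.
    by rewrite -scaleN1r (antiZ _ _ (antidualP w)) rmorphN rmorph1 mulN1r.
  rewrite !hN !sqD pformNr pformNl pformNr opprK ReN antidualD antidualD antidualN !ReD !ReN.
  lra.
apply/le_anti; rewrite le/=.
have := le (f + g) (f - g).
have -> : f + g + (f - g) = 2%:C *: f by lmod.
have -> : f + g - (f - g) = 2%:C *: g by lmod.
rewrite !antidual_quadZ cabsR normr_nat; lra.
Qed.

Fact antidual_incl_subproof a : (S a : B -> R[i]) \in antidual_pred.
Proof.
apply/asboolP; split=> [k b c|]; first by rewrite pformDr pformZr.
exists (sq a) => b; have := pform_ge0 S (a - b).
rewrite sqD pformNl !pformNr opprK ReN; lra.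
Qed.

Definition antidual_incl a : antidual := Antidual (antidual_incl_subproof a).

(** The translation of test vectors by [a] completes the square. As a consequence, a vector that
    nearly attains the supremum for [f] is close to [f], whence density of the image of [B]. *)
Lemma antidual_quad_sub_incl f a :
  antidual_quad (f - antidual_incl a) = antidual_quad f - 2 * Re (f a) + sq a.
Proof.
have E b : 2 * Re ((f - antidual_incl a) b) - sq b =
    2 * Re (f (b + a)) - sq (b + a) - 2 * Re (f a) + sq a.
  rewrite antidualD antidualN (antiD _ _ (antidualP f)) sqD !ReD ReN /=.
  rewrite (_ : Re (S b a) = Re (S a b)); first by ring.
  by rewrite pform_conj ReJ.
apply/le_anti/andP; split.
  by apply: antidual_quad_lub => b; rewrite E; have := antidual_quad_ub f (b + a); lra.
have h : antidual_quad f <= antidual_quad (f - antidual_incl a) + 2 * Re (f a) - sq a.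
  apply: antidual_quad_lub => b.
  have := antidual_quad_ub (f - antidual_incl a) (b - a); rewrite E subrK; lra.
lra.
Qed.

Lemma antidual_incl_dense f e : 0 < e -> exists a,
  antidual_quad (f - antidual_incl a) < e.
Proof.
move=> e0; have [|_ [a _ <-] h] := @sup_adherent _ (range (fun b => 2 * Re (f b) - sq b)) e e0.
  split; first by exists (2 * Re (f 0) - sq 0), 0.
  by exists (antidual_quad f) => _ [b _ <-]; exact: antidual_quad_ub.
by exists a; rewrite antidual_quad_sub_incl; rewrite /antidual_quad in h *; lra.
Qed.

Lemma antidual_eval f b : cabs (f b) ^+ 2 <= antidual_quad f * sq b.
Proof.
have h t : 2 * t * cabs (f b) ^+ 2 - t ^+ 2 * cabs (f b) ^+ 2 * sq b <= antidual_quad f.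
  have := antidual_quad_ub f ((t%:C * f b) *: b).
  rewrite (antiZ _ _ (antidualP f)) sqZ cabsM cabsR rmorphM /= conj_realC -mulrA.
  rewrite (mulrC (_^*%R)) -cabs_sqr ReM_real exprMn real_normK ?num_real//=.
  lra.
have q0 := antidual_quad_ge0 f; have s0 := pform_ge0 S b.
have c0 := sqr_ge0 (cabs (f b)); move: s0; rewrite le0r => /predU1P[s0|s0].
  (* On a null vector [h] is linear in [t]; this [t] would give
     [antidual_quad f + 1 <= antidual_quad f] unless [f b = 0]. *)
  rewrite s0 mulr0; have := h ((antidual_quad f + 1) / (2 * cabs (f b) ^+ 2)).
  rewrite s0 mulr0 subr0; have [->//|F0] := eqVneq (cabs (f b) ^+ 2) 0.
  have -> : 2 * ((antidual_quad f + 1) / (2 * cabs (f b) ^+ 2)) * cabs (f b) ^+ 2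
    = antidual_quad f + 1 by field; rewrite sqrf_eq0 in F0.
  lra.
have := h (sq b)^-1; have -> : 2 * (sq b)^-1 * cabs (f b) ^+ 2 -
   (sq b)^-1 ^+ 2 * cabs (f b) ^+ 2 * sq b = cabs (f b) ^+ 2 / sq b.
  by field; exact: lt0r_neq0.
by rewrite ler_pdivrMr.
Qed.

Lemma antidual_quad_eq0 f : antidual_quad f = 0 -> f = 0.
Proof.
move=> f0; apply: antidual_ext => b; apply: cabs_eq0; apply/eqP.
rewrite -sqrf_eq0 eq_le sqr_ge0 andbT.
by have := antidual_eval f b; rewrite f0 mul0r.
Qed.

Definition antidual_norm f : R[i] := (Num.sqrt (antidual_quad f))%:C.

Lemma antidual_normD f g : antidual_norm (f + g) <= antidual_norm f + antidual_norm g.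
Proof.
rewrite /antidual_norm -rmorphD lecR.
exact: (quad_triangle antidual_quad_ge0 antidual_quadZ antidual_parallelogram).
Qed.

Lemma antidual_normZ k f : antidual_norm (k *: f) = `|k| * antidual_norm f.
Proof.
rewrite /antidual_norm cabsE -rmorphM antidual_quadZ sqrtrM ?sqr_ge0//.
by rewrite sqrtr_sqr ger0_norm// cabs_ge0.
Qed.

Lemma antidual_norm_eq0 f : antidual_norm f = 0 -> f = 0.
Proof.
move=> /complexI/eqP; rewrite sqrtr_eq0 => h; apply: antidual_quad_eq0.
by apply/le_anti; rewrite h antidual_quad_ge0.
Qed.

HB.instance Definition _ := Lmodule_isNormed.Build R[i] antidual
  antidual_normD antidual_normZ antidual_norm_eq0.

Lemma antidual_normE f : `|f| = (Num.sqrt (antidual_quad f))%:C.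
Proof. by []. Qed.

Lemma antidual_norm_sqr f : `|f| ^+ 2 = (antidual_quad f)%:C.
Proof. by rewrite antidual_normE -rmorphXn sqr_sqrtr// antidual_quad_ge0. Qed.

Definition antidual_ip f g := polar_form antidual_quad f g.

Fact antidual_ip_bilinear : bilinear_for ( *%R) (Num.conj \; *%R) antidual_ip.
Proof.
have l k f g h : antidual_ip (k *: f + g) h = k * antidual_ip f h + antidual_ip g h.
  rewrite /antidual_ip polar_formDl ?polar_formZl//;
    first [exact: antidual_quad_ge0|exact: antidual_quadZ|exact: antidual_parallelogram].
have c f g : antidual_ip f g = (antidual_ip g f)^*%R.
  exact: (polar_form_conj antidual_quadZ antidual_parallelogram).
split=> h k f g /=; first exact: l.
by rewrite c l rmorphD rmorphM /= -!c.
Qed.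

HB.instance Definition _ := bilinear_isBilinear.Build R[i] antidual antidual R[i]
  ( *%R) (Num.conj \; *%R) antidual_ip antidual_ip_bilinear.

End antidual.

Section cabs_parts.
Variable R : realType.
Implicit Types (z w : R[i]).

Lemma cabs_def z : cabs z = Num.sqrt (Re z ^+ 2 + Im z ^+ 2).
Proof. by rewrite /cabs normc_def. Qed.

Lemma normr_Re_le z : `|Re z| <= cabs z.
Proof. by rewrite cabs_def -sqrtr_sqr ler_sqrt ?addr_ge0 ?sqr_ge0// lerDl sqr_ge0. Qed.

Lemma normr_Im_le z : `|Im z| <= cabs z.
Proof. by rewrite cabs_def -sqrtr_sqr ler_sqrt ?addr_ge0 ?sqr_ge0// lerDr sqr_ge0. Qed.

Lemma normr_ReB_le z w : `|Re z - Re w| <= cabs (z - w).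
Proof. by rewrite -raddfB; exact: normr_Re_le. Qed.

Lemma normr_ImB_le z w : `|Im z - Im w| <= cabs (z - w).
Proof. by rewrite -raddfB; exact: normr_Im_le. Qed.

Lemma cabs_le z : cabs z <= `|Re z| + `|Im z|.
Proof.
rewrite cabs_def -[leRHS]ger0_norm ?addr_ge0// -sqrtr_sqr ler_sqrt ?sqr_ge0//.
have := mulr_ge0 (normr_ge0 (Re z)) (normr_ge0 (Im z)).
by rewrite sqrrD !real_normK ?num_real// mulr2n; lra.
Qed.

End cabs_parts.

Section antidual_hilbert.
Variables (R : realType) (B : lmodType R[i]) (S : prehilbert B).
Implicit Types (a b c : B) (t : R) (k : R[i]) (f g : antidual S).
Local Notation sq b := (Re (S b b)).

Fact antidual_ip_hermitian f g :
  antidual_ip f g = (-1) ^+ false * (antidual_ip g f)^*%R.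
Proof.
rewrite expr0 mul1r.
exact: (polar_form_conj (@antidual_quadZ _ _ S) (@antidual_parallelogram _ _ S)).
Qed.

HB.instance Definition _ := isHermitianSesquilinear.Build R[i] (antidual S) false
  Num.conj (@antidual_ip R B S) antidual_ip_hermitian.

Lemma antidual_ip_id f : antidual_ip f f = (antidual_quad f)%:C.
Proof. exact: (polar_form_id (@antidual_quadZ _ _ S) (@antidual_parallelogram _ _ S)). Qed.

Fact antidual_ip_gt0 f : f != 0 -> 0 < antidual_ip f f.
Proof.
move=> f0; rewrite antidual_ip_id ltcR lt0r antidual_quad_ge0 andbT.
by apply: contra_neq f0 => /antidual_quad_eq0.
Qed.

HB.instance Definition _ :=
  isDotProduct.Build R[i] (antidual S) (@antidual_ip R B S) antidual_ip_gt0.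

Definition antidual_dot : {dot (antidual S) for (@Num.conj R[i])} := @antidual_ip R B S.

Lemma antidual_ip_norm f : antidual_dot f f = `|f| ^+ 2.
Proof. by rewrite /antidual_dot /= antidual_ip_id antidual_norm_sqr. Qed.

Lemma antidual_nrm f : nrm f = Num.sqrt (antidual_quad f).
Proof. by []. Qed.

Lemma antidual_nrm_sqr f : nrm f ^+ 2 = antidual_quad f.
Proof. by rewrite antidual_nrm sqr_sqrtr// antidual_quad_ge0. Qed.

Lemma antidual_eval_nrm f b : cabs (f b) <= nrm f * Num.sqrt (sq b).
Proof.
rewrite -ler_sqr ?nnegrE ?cabs_ge0 ?mulr_ge0 ?sqrtr_ge0 ?nrm_ge0//.
by rewrite exprMn antidual_nrm_sqr sqr_sqrtr ?pform_ge0// antidual_eval.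
Qed.

(** Evaluations are Lipschitz, so a Cauchy filter converges pointwise. The inequalities that define
    the dual norm survive pointwise limits, which makes the limit bounded and the convergence one in
    norm. *)
Fact antidual_cauchy_cvg (F : set_system (antidual S)) :
  ProperFilter F -> cauchy F -> cvg F.
Proof.
move=> FF /cauchyP cF.
have cFR (e : R) : 0 < e -> exists f0, F [set f | nrm (f0 - f) < e].
  move=> e0; have [|f0 Ff0] := cF e%:C; first by rewrite ltcR.
  by exists f0; apply: filterS Ff0 => f /ballC_nrm.
have real_lim (g : antidual S -> R) (C : R) :
    (forall u v, `|g u - g v| <= C * nrm (u - v)) ->
    exists l, forall e : R, 0 < e -> F [set f | `|l - g f| < e].
  move=> gC; have : cauchy (g @ F).
    apply: cauchy_exP; move=> e e0.
    have C1 : 0 < `|C| + 1 by rewrite ltr_wpDl.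
    have [f0 Ff0] := cFR (e / (`|C| + 1)) (divr_gt0 e0 C1).
    exists (g f0); change (F (fun f => ball (g f0) e (g f))).
    apply: filterS Ff0 => f /= hf.
    rewrite -ball_normE /=; apply: (le_lt_trans (gC _ _)).
    apply: (@le_lt_trans _ _ ((`|C| + 1) * nrm (f0 - f))).
      by rewrite ler_wpM2r ?nrm_ge0// (le_trans (ler_norm C))// lerDl.
    by rewrite mulrC -ltr_pdivlMr.
  move=> /cauchy_cvg /cvg_ex[l gl]; exists l => e e0.
  by move/cvgrPdist_lt : gl => /(_ e e0).
have lim b : exists z : R[i], forall e, 0 < e -> F [set f | cabs (z - f b) < e].
  have dist (u v : antidual S) : cabs (u b - v b) <= Num.sqrt (sq b) * nrm (u - v).
    by rewrite mulrC; exact: (antidual_eval_nrm (u - v) b).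
  have [x hx] := real_lim (fun f => Re (f b)) _ (fun u v =>
    le_trans (normr_ReB_le (u b) (v b)) (dist u v)).
  have [y hy] := real_lim (fun f => Im (f b)) _ (fun u v =>
    le_trans (normr_ImB_le (u b) (v b)) (dist u v)).
  exists (x +i* y) => e e0; have e20 : 0 < e / 2 by rewrite divr_gt0.
  apply: filterS (filterI (hx _ e20) (hy _ e20)) => f [/= h1 h2].
  apply: le_lt_trans (cabs_le _) _; rewrite /=; case: (f b) h1 h2 => u v /=; lra.
have {lim}[z hz] : exists z : B -> R[i], forall b e, 0 < e -> F [set f | cabs (z b - f b) < e].
  by exists (fun b => xget 0 [set w | forall e, 0 < e -> F [set f | cabs (w - f b) < e]]) => b;
    case: xgetP => [w _ //|nw]; have [w hw] := lim b; have := nw w.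
have [f0 Ff0] := cFR 1 ltr01.
have bound g K b : F [set f | antidual_quad (f - g) <= K] ->
    2 * Re (z b - g b) - sq b <= K.
  move=> Fg; apply: (@le_eps _ _ _ 2) => e e0.
  have [f [/= h1 h2]] := filter_ex (filterI Fg (hz b e e0)).
  have := antidual_quad_ub (f - g) b.
  have := le_trans (ler_norm _) (le_trans (normr_Re_le (z b - f b)) (ltW h2)).
  rewrite antidualD antidualN !ReD !ReN; lra.
have anti k a b : z (k *: a + b) = k^*%R * z a + z b.
  apply/eqP; rewrite -subr_eq0; apply/eqP/cabs_eq0/le_anti; rewrite cabs_ge0 andbT.
  apply: (@le_eps _ _ _ (2 + cabs k)) => e e0; rewrite add0r.
  have [f [[/= h1 h2] h3]] :=
    filter_ex (filterI (filterI (hz (k *: a + b) e e0) (hz a e e0)) (hz b e e0)).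
  have -> : z (k *: a + b) - (k^*%R * z a + z b) =
      (z (k *: a + b) - f (k *: a + b)) - k^*%R * (z a - f a) - (z b - f b).
    by rewrite (antilinearP (antidualP f)); ring.
  have := cabsD (z (k *: a + b) - f (k *: a + b) - k^*%R * (z a - f a)) (- (z b - f b)).
  have := cabsD (z (k *: a + b) - f (k *: a + b)) (- (k^*%R * (z a - f a))).
  rewrite !cabsN cabsM cabs_conj.
  have := ler_wpM2l (cabs_ge0 k) (ltW h2); lra.
have zP : z \in @antidual_pred R B S.
  apply/asboolP; split=> //; exists ((nrm f0 + 1) ^+ 2) => b.
  have := bound 0 ((nrm f0 + 1) ^+ 2) b; rewrite [(0 : antidual S) b]/= subr0; apply.
  apply: filterS Ff0 => f /= h; rewrite subr0 -antidual_nrm_sqr.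
  rewrite ler_sqr ?nnegrE ?addr_ge0 ?nrm_ge0//.
  by have := nrm_sub f f0; rewrite nrm_dist; lra.
pose z' : antidual S := Antidual zP.
apply/cvg_ex; exists z'; apply/cvgrPdist_lt => /= _ /posC[e e0 ->].
have e20 : 0 < e / 2 by rewrite divr_gt0.
have [f1 Ff1] := cFR _ e20.
have h1 : antidual_quad (z' - f1) <= (e / 2) ^+ 2.
  apply: antidual_quad_lub => b; rewrite antidualD antidualN.
  apply: (bound f1); apply: filterS Ff1 => f /= h; rewrite -antidual_nrm_sqr nrm_dist.
  by rewrite ler_sqr ?nnegrE ?nrm_ge0 ?(ltW e20)// ltW.
rewrite -antidual_nrm_sqr ler_sqr ?nnegrE ?nrm_ge0 ?(ltW e20)// in h1.
apply: filterS Ff1 => f /= h2; rewrite nrmE ltcR.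
by apply: (le_lt_trans (nrm_triangle f1 z' f)); rewrite (splitr e) ler_ltD.
Qed.

HB.instance Definition _ := Uniform_isComplete.Build (antidual S) antidual_cauchy_cvg.

End antidual_hilbert.

Section complex_norm_topology.
Variables (R : realType).

Lemma nrm_seq_complete (V : completeNormedModType R[i]) (u : nat -> V) :
  (forall e, 0 < e -> exists N, forall m n, (N <= m)%N -> (N <= n)%N ->
    nrm (u m - u n) <= e) ->
  exists l, forall e, 0 < e -> exists N, forall n, (N <= n)%N -> nrm (u n - l) <= e.
Proof.
move=> uC; have : cauchy (u @ \oo).
  apply: cauchy_exP => _ /posC[e e0 ->].
  have [N hN] := uC (e / 2) (divr_gt0 e0 (ltr0Sn _ 1)).
  exists (u N), N => // n /= Nn; apply/ballC_nrm.
  by have := hN N n (leqnn N) Nn; lra.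
move=> /cauchy_cvg /cvg_ex[l /cvgrPdist_le ul]; exists l => e e0.
have [|N _ hN] := ul e%:C; first by rewrite ltcR.
by exists N => n Nn; have := hN n Nn; rewrite /= nrmE lecR nrm_dist.
Qed.

Lemma closed_nrm (V : normedModType R[i]) (A : set V) l : closed A ->
  (forall e, 0 < e -> exists2 v, A v & nrm (l - v) < e) -> A l.
Proof.
move=> clA h; apply: clA => U /nbhs_ballP[_ /posC[e e0 ->]] lU.
by have [v Av lv] := h e e0; exists v; split=> //; apply/lU/ballC_nrm.
Qed.

Lemma cvg_nrm (V : normedModType R[i]) (x : nat -> V) l :
  x @ \oo --> l <-> forall e : R, 0 < e -> exists N, forall n, (N <= n)%N -> nrm (x n - l) <= e.
Proof.
split=> [/cvgrPdist_le h e e0|h].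
  have [|N _ hN] := h e%:C; first by rewrite ltcR.
  by exists N => n Nn; have := hN n Nn; rewrite /= nrmE lecR nrm_dist.
apply/cvgrPdist_le => _ /posC[e e0 ->]; have [N hN] := h e e0; exists N => // n Nn.
by rewrite /= nrmE lecR nrm_dist; exact: hN.
Qed.

Lemma lipschitz_nrm_continuous (V W : normedModType R[i]) (f : V -> W) (C : R) :
  (forall u v, nrm (f u - f v) <= C * nrm (u - v)) -> continuous f.
Proof.
move=> fC u; apply/cvgrPdist_lt => _ /posC[e e0 ->].
have C1 : 0 < `|C| + 1 by rewrite ltr_wpDl.
apply/nbhs_ballP; exists (e / (`|C| + 1))%:C => /=.
  by rewrite ltcR divr_gt0.
move=> v /ballC_nrm uv; rewrite nrmE ltcR (le_lt_trans (fC _ _))//.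
rewrite (@le_lt_trans _ _ ((`|C| + 1) * nrm (u - v)))//.
  by rewrite ler_wpM2r ?nrm_ge0// (le_trans (ler_norm C))// lerDl.
by rewrite mulrC -ltr_pdivlMr.
Qed.

End complex_norm_topology.

(** * Hilbert spaces: Cauchy-Schwarz and orthogonal projection *)

Section hilbert.
Variables (R : realType) (H : completeNormedModType R[i])
  (ip : {dot H for (@Num.conj R[i])}).
Hypothesis ip_norm : forall u, ip u u = `|u| ^+ 2.
Implicit Types (u v w : H) (k : R[i]) (t : R).

Lemma ip_conj u v : ip u v = (ip v u)^*%R.
Proof. by rewrite (hermC ip u v) expr0 mul1r. Qed.
Lemma ipDl u v w : ip (u + v) w = ip u w + ip v w.
Proof. exact: linearDl. Qed.
Lemma ipZl k u v : ip (k *: u) v = k * ip u v.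
Proof. exact: linearZl_LR. Qed.
Lemma ipDr u v w : ip u (v + w) = ip u v + ip u w.
Proof. by rewrite ip_conj ipDl rmorphD /= -!ip_conj. Qed.
Lemma ipZr k u v : ip u (k *: v) = k^*%R * ip u v.
Proof. by rewrite ip_conj ipZl rmorphM /= -!ip_conj. Qed.
Lemma ipNl u v : ip (- u) v = - ip u v.
Proof. by rewrite -scaleN1r ipZl mulN1r. Qed.
Lemma ipNr u v : ip u (- v) = - ip u v.
Proof. by rewrite -scaleN1r ipZr rmorphN rmorph1 mulN1r. Qed.
Lemma ip0l u : ip 0 u = 0.
Proof. by rewrite -(scale0r 0) ipZl mul0r. Qed.

Lemma Re_ip_id u : Re (ip u u) = nrm u ^+ 2.
Proof. by rewrite ip_norm nrmE -rmorphXn. Qed.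
Lemma Re_ipC u v : Re (ip u v) = Re (ip v u).
Proof. by rewrite ip_conj ReJ. Qed.

Lemma nrm_sqrD u v : nrm (u + v) ^+ 2 = nrm u ^+ 2 + nrm v ^+ 2 + 2 * Re (ip u v).
Proof.
by rewrite -!Re_ip_id ipDl !ipDr !ReD (Re_ipC v u); ring.
Qed.

Lemma nrm_sqrB u v : nrm (u - v) ^+ 2 = nrm u ^+ 2 + nrm v ^+ 2 - 2 * Re (ip u v).
Proof. by rewrite nrm_sqrD nrmN ipNr ReN; ring. Qed.

Lemma Re_ip_le u v : Re (ip u v) <= nrm u * nrm v.
Proof.
have h : Re (ip u v) * (nrm u * nrm v) <= (nrm u * nrm v) ^+ 2.
  have := nrm_sqrB ((nrm v)%:C *: u) ((nrm u)%:C *: v).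
  rewrite ipZl ipZr conj_realC mulrA -rmorphM/= ReM_real !nrmZ !cabsR.
  rewrite !ger0_norm ?nrm_ge0//.
  have := sqr_ge0 (nrm ((nrm v)%:C *: u - (nrm u)%:C *: v)).
  by move=> h1 h2; rewrite h2 in h1; lra.
have := mulr_ge0 (nrm_ge0 u) (nrm_ge0 v); rewrite le0r => /predU1P[E|nn0].
  have [u0|v0] : u = 0 \/ v = 0.
    by move/eqP: E; rewrite mulf_eq0 => /orP[]/eqP/nrm_eq0 ->; [left|right].
  - by rewrite u0 ip0l nrm0 mul0r.
  - by rewrite v0 Re_ipC ip0l nrm0 mulr0.
by rewrite -(ler_pM2r nn0) -expr2.
Qed.

Lemma normr_Re_ip_le u v : `|Re (ip u v)| <= nrm u * nrm v.
Proof.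
rewrite ler_norml Re_ip_le andbT; have := Re_ip_le (- u) v.
by rewrite nrmN ipNl ReN; lra.
Qed.

Lemma Re_ip_i u v : Re (ip u ('i%R *: v)) = Im (ip u v).
Proof.
rewrite ipZr conjCi; case: (ip u v) => x y; rewrite -complexiE /=; ring.
Qed.

(** The factor 2 comes from bounding real and imaginary parts separately; the estimate serves only
    for continuity. *)
Lemma cabs_ip_le u v : cabs (ip u v) <= 2 * (nrm u * nrm v).
Proof.
apply: le_trans (cabs_le _) _; rewrite -Re_ip_i.
have := normr_Re_ip_le u v; have := normr_Re_ip_le u ('i%R *: v).
rewrite nrmZ cabsi mul1r; lra.
Qed.

Lemma Re_ip_eq0 u v : (forall k, Re (ip u (k *: v)) = 0) -> ip u v = 0.
Proof.
move=> h; have := h 1; have := h 'i%R; rewrite Re_ip_i scale1r.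
by case: (ip u v) => x y /= -> ->.
Qed.

Lemma orthogonal_projection (V : set H) u : closed V -> V 0 ->
  (forall k v w, V v -> V w -> V (k *: v + w)) ->
  exists2 v, V v & forall w, V w -> ip (u - v) w = 0.
Proof.
move=> clV V0 lV.
pose D := [set nrm (u - v) ^+ 2 | v in V]; pose d := inf D.
have dle v : V v -> d <= nrm (u - v) ^+ 2.
  by move=> Vv; apply: ge_inf; [exists 0 => _ [w _ <-]; exact: sqr_ge0|exists v].
have infD : has_inf D.
  split; first by exists (nrm (u - 0) ^+ 2), 0.
  by exists 0 => _ [w _ <-]; exact: sqr_ge0.
have ex n : exists v, V v /\ nrm (u - v) ^+ 2 < d + n.+1%:R^-1.
  have [|_ [v Vv <-] h] := @inf_adherent R D n.+1%:R^-1 _ infD.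
    by rewrite invr_gt0.
  by exists v.
have [x hx] := choice ex.
(* Parallelogram law: the midpoint of [x m] and [x n] lies in [V], hence at squared distance at
   least [d] from [u]. *)
have dist m n : nrm (x m - x n) ^+ 2 <= 2 * m.+1%:R^-1 + 2 * n.+1%:R^-1.
  have [Vm hm] := hx m; have [Vn hn] := hx n.
  have Vmn : V ((2^-1)%:C *: (x m + x n)).
    rewrite -[_ *: _]addr0; apply: (lV) => //.
    by rewrite -[x m]scale1r; exact: (lV).
  have h1 := dle _ Vmn.
  have h2 := nrm_sqrD (u - x m) (u - x n); have h3 := nrm_sqrB (u - x m) (u - x n).
  have E1 : u - x m - (u - x n) = x n - x m by lmod.
  have E2 : u - x m + (u - x n) = 2%:C *: (u - (2^-1)%:C *: (x m + x n)).
    rewrite scalerBr scalerA -rmorphM/= divff// scale1r; lmod.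
  rewrite E1 nrm_dist in h3; rewrite E2 nrmZ cabsR normr_nat in h2.
  rewrite exprMn in h2; move: h1 h2 h3 hm hn.
  move: (m.+1%:R^-1) (n.+1%:R^-1) (nrm _ ^+ 2) => p q X; move: (Re _) => r; lra.
have [|v hv] := @nrm_seq_complete R H x.
  move=> e e0; have e20 : 0 < e ^+ 2 / 2 by rewrite divr_gt0// exprn_gt0.
  have [N hN] := inv_nat_small e20; exists N.+1 => m n Nm Nn.
  rewrite -ler_sqr ?nnegrE ?nrm_ge0 ?(ltW e0)// (le_trans (dist m n))//.
  case: m n Nm Nn => [//|m] [//|n]; rewrite !ltnS => /hN h1 /hN h2.
  by move: h1 h2; move: (m.+2%:R^-1) (n.+2%:R^-1) => p q; lra.
have Vv : V v.
  apply: (closed_nrm clV) => e e0.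
  have [N hN] := hv (e / 2) (divr_gt0 e0 (ltr0Sn _ 1)); exists (x N).
    by have [] := hx N.
  by have := hN N (leqnn N); rewrite nrm_dist; lra.
have d0 : 0 <= d by apply: lb_le_inf; [case: infD|move=> _ [w _ <-]; exact: sqr_ge0].
have vmin : nrm (u - v) ^+ 2 <= d.
  rewrite -(sqr_sqrtr d0) ler_sqr ?nnegrE ?nrm_ge0 ?sqrtr_ge0//.
  apply: (@le_eps _ _ _ 2) => e e0.
  have [N1 h1] := hv e e0.
  have [N2 h2] := inv_nat_small (exprn_gt0 2 e0).
  pose n := (N1 + N2.+1)%N; have {}h1 := h1 n (leq_addr _ _).
  have {}h2 := h2 (N1 + N2)%N (leq_addl _ _); have [_ h3] := hx n.
  have h4 : nrm (u - x n) <= Num.sqrt d + e.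
    rewrite -ler_sqr ?nnegrE ?nrm_ge0 ?addr_ge0 ?sqrtr_ge0 ?(ltW e0)//.
    rewrite sqrrD sqr_sqrtr// (le_trans (ltW h3))//.
    have := mulr_ge0 (sqrtr_ge0 d) (ltW e0).
    have : 0 < (n.+1%:R^-1 : R) by rewrite invr_gt0.
    move: h2; have -> : (N1 + N2).+2 = n.+1 by rewrite /n addnS.
    by move: (n.+1%:R^-1) => p; lra.
  have := nrm_triangle (x n) u v; lra.
exists v => // w Vw; apply: Re_ip_eq0 => k; set z := k *: w.
have Vz : V z by rewrite /z -[_ *: _]addr0; exact: (lV).
have h t : 0 <= t ^+ 2 * nrm z ^+ 2 - 2 * (t * Re (ip (u - v) z)).
  have Vt : V (v + t%:C *: z) by rewrite addrC; exact: (lV).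
  have := le_trans vmin (dle _ Vt).
  have -> : u - (v + t%:C *: z) = (u - v) - t%:C *: z by lmod.
  rewrite (nrm_sqrB (u - v)) ipZr conj_realC ReM_real nrmZ cabsR exprMn real_normK ?num_real//.
  lra.
set r := Re _ in h *; apply/eqP; rewrite -sqrf_eq0 eq_le sqr_ge0 andbT.
have z1 : 0 < nrm z ^+ 2 + 1 by rewrite ltr_wpDl ?sqr_ge0.
have := h (r / (nrm z ^+ 2 + 1)).
have -> : (r / (nrm z ^+ 2 + 1)) ^+ 2 * nrm z ^+ 2 - 2 * (r / (nrm z ^+ 2 + 1) * r)
  = - (r ^+ 2 * ((nrm z ^+ 2 + 2) / (nrm z ^+ 2 + 1) ^+ 2)).
  by field; exact: lt0r_neq0.
rewrite oppr_ge0 pmulr_lle0// divr_gt0 ?exprn_gt0//.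
by have := sqr_ge0 (nrm z); lra.
Qed.

End hilbert.

(** * States dominated by a C*-seminorm and their GNS spaces *)

Section states.
Variables (R : realType) (B : starAlgType R[i]) (one : B) (nm p : B -> R).
Hypotheses (smul1r : forall a : B, one ** a = a)
  (smulr1 : forall a : B, a ** one = a)
  (csn_nm : cstar_seminorm nm) (nm_eq0 : forall a, nm a = 0 -> a = 0)
  (nm_complete : seq_complete nm)
  (csn : cstar_seminorm p) (p_le : forall a, p a <= nm a) (p_one : p one = 1).
Implicit Types (a b m : B) (t : R).

Local Notation sc t := (t%:C *: one).
Let sone : star one = one := star_one smulr1.

Definition real_part b : B := (2^-1)%:C *: (b + star b).

Lemma real_partD a b : real_part (a + b) = real_part a + real_part b.
Proof. by rewrite /real_part starD; lmod. Qed.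
Lemma real_partZ t a : real_part (t%:C *: a) = t%:C *: real_part a.
Proof. by rewrite /real_part starZR; lmod. Qed.
Lemma real_part_sa a : star a = a -> real_part a = a.
Proof.
move=> sa; rewrite /real_part sa (_ : a + a = 2%:C *: a); last by lmod.
by rewrite scalerA -rmorphM/= mulVf// scale1r.
Qed.
Lemma real_part_skew a : star a = - a -> real_part a = 0.
Proof. by move=> sa; rewrite /real_part sa subrr scaler0. Qed.

Lemma p_sc t : 0 <= t -> p (sc t) = t.
Proof. by move=> t0; rewrite (csnZR csn) p_one mulr1 ger0_norm. Qed.

Lemma p_real_part a : p (real_part a) <= p a.
Proof.
rewrite (csnZR csn) ger0_norm ?invr_ge0// mulrC ler_pdivrMr//.
by rewrite (le_trans (csn_D csn _ _))// (csn_star csn); lra.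
Qed.

(* The right derivative of the norm at [one] in the direction [Re b]. *)
Definition upper_state b : R :=
  infF (fun (t : {nonneg R}) b => p (sc t%:num + real_part b) - t%:num) b.

Lemma upper_state_lb b : exists m : R, forall t : {nonneg R},
  m <= p (sc t%:num + real_part b) - t%:num.
Proof.
exists (- p (real_part b)) => t.
by have := csnB csn (sc t%:num + real_part b) (real_part b); rewrite addrK p_sc//; lra.
Qed.

Lemma upper_state_le b t : 0 <= t -> upper_state b <= p (sc t + real_part b) - t.
Proof. by move=> t0; exact: (infF_le upper_state_lb (NngNum t0)). Qed.

Lemma upper_state_sublinear : sublinear upper_state.
Proof.
apply: (infF_sublinear 0%:nng) => [|i j a b|i t a t0]; first exact: upper_state_lb.
  exists (i%:num + j%:num)%:nng; rewrite /= real_partD.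
  have -> : sc (i%:num + j%:num) + (real_part a + real_part b) =
    (sc i%:num + real_part a) + (sc j%:num + real_part b) by lmod.
  have := csn_D csn (sc i%:num + real_part a) (sc j%:num + real_part b); lra.
exists (NngNum (mulr_ge0 (ltW t0) (ge0 i))); rewrite /= real_partZ.
have -> : sc (t * i%:num) + t%:C *: real_part a = t%:C *: (sc i%:num + real_part a).
  by lmod.
by rewrite (csnZR csn) gtr0_norm// mulrBr.
Qed.

Lemma upper_state_le_p b : upper_state b <= p b.
Proof.
have := upper_state_le b (lexx 0); rewrite scale0r add0r subr0 => /le_trans; apply.
exact: p_real_part.
Qed.

(** Take [t = nm b ^+ 2] in the infimum: positivity, known for the complete norm, descends to [p]
    through [p <= nm]. *)
Lemma upper_state_neg b : upper_state (- (star b ** b)) <= 0.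
Proof.
have := upper_state_le (- (star b ** b)) (sqr_ge0 (nm b)).
rewrite real_part_sa; last by rewrite starN starM starK.
have h := star_smul_subr smul1r smulr1 csn_nm nm_eq0 nm_complete (lexx (nm b ^+ 2)).
have := p_le (sc (nm b ^+ 2) - star b ** b); lra.
Qed.

Lemma upper_state_skew b : star b = - b -> upper_state b <= 0.
Proof.
move=> sb; have := upper_state_le b ler01.
by rewrite real_part_skew// addr0 p_sc// subrr.
Qed.

Lemma upper_state_one : upper_state one <= 1 /\ upper_state (- one) <= -1.
Proof.
split; first by rewrite (le_trans (upper_state_le_p _))// p_one.
have := upper_state_le (- one) ler01; rewrite real_part_sa ?starN ?sone//.
by rewrite scale1r subrr (csn0 csn) sub0r.
Qed.

(** With [h = star b ** b], the claim is [p h + t <= p (t + h) = T]. An approximate root [w] of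
    [T + e - t - h] commutes with the root [v] of [h], and [csn_sqr_le] gives
    [p h <= p (h + w ** w)], which is about [T + e - t]. *)
Lemma upper_state_ge b : p (star b ** b) <= upper_state (star b ** b).
Proof.
suff key (t : R) : 0 <= t ->
    p (star b ** b) <= p (sc t + real_part (star b ** b)) - t.
  by apply: (le_infF 0%:nng) => t; exact: key.
move=> t0; set h := star b ** b.
have sh : star h = h by rewrite starM starK.
rewrite real_part_sa// lerBrDr.
have [v [sv vE _ cv]] := pos_sqrt smul1r smulr1 csn_nm nm_eq0 nm_complete
  (pos_star_smul smul1r smulr1 csn_nm nm_eq0 nm_complete b).
rewrite -/h in vE cv; set T := p (sc t + h).
have tT : t <= T.
  have s1 : star ((Num.sqrt t)%:C *: one) = (Num.sqrt t)%:C *: one.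
    by rewrite starZR sone.
  have := csn_sqr_le csn s1 sv (scomm_sym (scomm_sc smul1r smulr1 v _)).
  rewrite p_sc ?sqrtr_ge0// sqr_sqrtr// !smulE smul1r scalerA -rmorphM/= -expr2.
  by rewrite sqr_sqrtr// vE.
(* One [e] makes [r] positive, the other is the error of the root. *)
apply: (@le_eps _ _ _ 2) => e e0; pose r := T + e.
have r0 : 0 < r by rewrite /r ltr_wpDl// (csn_ge0 csn).
pose X := (r^-1)%:C *: (sc t + h).
have sX : star X = X by rewrite starZR starD starZR sone sh.
have pX : p X <= 1.
  rewrite (csnZR csn) gtr0_norm ?invr_gt0// mulrC ler_pdivrMr// mul1r -/T /r lerDl.
  exact: ltW.
have [d [hd sd cd]] := approx_sqrt csn pX (divr_gt0 e0 r0).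
pose w := (Num.sqrt r)%:C *: (one - d).
have sw : star w = w by rewrite starZR starB sone sd.
have vw : scomm v w.
  apply/scommZ/scommD; first exact: scomm1.
  apply/scommN/cd/scommZ/scommD; first exact: scomm_sc.
  by rewrite -vE; exact: scommM.
have := csn_sqr_le csn sv sw vw; rewrite -(csn_sa_sqr csn sv) vE.
have -> : h + w ** w = sc (r - t) + r%:C *: (d ** d - d *+ 2 + X).
  have -> : w ** w = r%:C *: (one - d *+ 2 + d ** d).
    rewrite /w scale_smull scale_smulr scalerA -rmorphM/= -expr2 sqr_sqrtr ?(ltW r0)//.
    by rewrite !smulE !smulr1 !smul1r; congr (_ *: _); lmod.
  have -> : h = r%:C *: X - sc t.
    by rewrite /X scalerA -rmorphM/= mulfV ?gt_eqF// scale1r addrC addKr.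
  by lmod.
move=> h1; have h2 := csn_D csn (sc (r - t)) (r%:C *: (d ** d - d *+ 2 + X)).
have h3 : p (r%:C *: (d ** d - d *+ 2 + X)) <= e.
  rewrite (csnZR csn) gtr0_norm// -(csnN csn).
  have -> : - (d ** d - d *+ 2 + X) = d *+ 2 - d ** d - X by lmod.
  by rewrite mulrC -ler_pdivlMr.
have h4 : p (sc (r - t)) = r - t by rewrite p_sc// /r; lra.
rewrite /r in h4 *; rewrite h4 in h2; lra.
Qed.

Section dominated_functional.
Variables (f : B -> R).
Hypotheses (rf : real_linear f) (fq : forall a, f a <= upper_state a).

Lemma state_norm_le a : `|f a| <= p a.
Proof.
have h b : f b <= p b := le_trans (fq b) (upper_state_le_p b).
by rewrite ler_norml h andbT lerNl -(real_linearN _ rf) -(csnN csn) h.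
Qed.

Lemma state_star a : f (star a) = f a.
Proof.
have h b : star b = - b -> f b = 0.
  move=> sb; apply/le_anti/andP; split.
    by rewrite (le_trans (fq b))// upper_state_skew.
  rewrite -oppr_le0 -(real_linearN _ rf) (le_trans (fq _))// upper_state_skew//.
  by rewrite starN sb.
have := h (star a - a); rewrite starB starK opprB => /(_ erefl).
by rewrite (real_linearD rf) (real_linearN _ rf); lra.
Qed.

Lemma state_pos a : 0 <= f (star a ** a).
Proof.
by rewrite -oppr_le0 -(real_linearN _ rf) (le_trans (fq _))// upper_state_neg.
Qed.

Lemma state_one : f one = 1.
Proof.
have [h1 h2] := upper_state_one; apply/le_anti; rewrite (le_trans (fq _) h1)/=.
by rewrite -lerN2 -(real_linearN _ rf) (le_trans (fq _) h2).
Qed.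

(** For [x = star m ** m / r] with [r] slightly above [p m ^+ 2], [1 - x] is nearly the square of a
    self-adjoint [1 - d], and [f] is nonnegative on the square of [(1 - d) ** b]. *)
Lemma state_contractive m b :
  f (star (m ** b) ** (m ** b)) <= p m ^+ 2 * f (star b ** b).
Proof.
apply: (@le_eps _ _ _ (f (star b ** b))) => e e0; pose r := p m ^+ 2 + e.
have r0 : 0 < r by rewrite /r ltr_wpDl// sqr_ge0.
rewrite -[leRHS](_ : r * f (star b ** b) = _); last by rewrite /r; ring.
pose x := (r^-1)%:C *: (star m ** m).
have sx : star x = x by rewrite starZR starM starK.
have px : p x <= 1.
  rewrite (csnZR csn) gtr0_norm ?invr_gt0// mulrC ler_pdivrMr// mul1r (csn_C csn).
  by rewrite lerDl ltW.
have -> : star (m ** b) ** (m ** b) = r%:C *: (star b ** x ** b).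
  by rewrite /x !smulE scalerA -rmorphM/= mulfV ?gt_eqF// scale1r starM ?smulA.
rewrite (real_linearZ rf) ler_wpM2l ?(ltW r0)//.
apply: (@le_eps _ _ _ (p b * p b)) => e1 e10.
have [d [hd sd _]] := approx_sqrt csn px e10; have {}sd := sd sx.
have := state_pos ((one - d) ** b).
have -> : star ((one - d) ** b) ** ((one - d) ** b) =
   star b ** b - star b ** x ** b - star b ** (d *+ 2 - d ** d - x) ** b.
  by rewrite starM starB sone sd !smulE ?smulr1 ?smul1r; lmod.
rewrite !(real_linearD rf) !(real_linearN _ rf).
have := state_norm_le (star b ** (d *+ 2 - d ** d - x) ** b).
have : p (star b ** (d *+ 2 - d ** d - x) ** b) <= p b * p b * e1.
  rewrite (le_trans (csn_M csn _ _))// [leRHS]mulrAC ler_wpM2r ?(csn_ge0 csn)//.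
  by rewrite (le_trans (csn_M csn _ _))// (csn_star csn) ler_wpM2l// (csn_ge0 csn).
rewrite ler_norml => h1 /andP[h2 h3]; lra.
Qed.

(** [f] is real linear; [f c - i f (i c)] is the complex linear functional with real part [f]. *)
Definition state_form a b : R[i] :=
  (f (star b ** a))%:C - 'i%R * (f ('i%R *: (star b ** a)))%:C.

Fact state_formP k a b c :
  state_form (k *: a + b) c = k * state_form a c + state_form b c.
Proof.
rewrite /state_form smulDr scale_smulr; move: (star c ** a) (star c ** b) => u v.
have [x [y ->]] : exists x y : R, k = x%:C + 'i%R * y%:C.
  by exists (Re k), (Im k); rewrite -complexiE -complexE.
have e1 : (x%:C + 'i%R * y%:C) *: u + v = x%:C *: u + y%:C *: ('i%R *: u) + v by lmod.
have e2 : 'i%R *: ((x%:C + 'i%R * y%:C) *: u + v) =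
    x%:C *: ('i%R *: u) - y%:C *: u + 'i%R *: v.
  have -> : - (y%:C *: u) = y%:C *: (('i%R * 'i%R) *: u).
    by rewrite -expr2 sqrCi scaleN1r scalerN.
  by lmod.
rewrite e2 e1 !(real_linearD rf) (real_linearN _ rf) !(real_linearZ rf).
rewrite !rmorphD/= rmorphN/= !rmorphM/=.
move: (f u) (f ('i%R *: u)) (f v) (f ('i%R *: v)) => p1 p2 p3 p4.
have i2 : 'i%R * 'i%R = -1 :> R[i] by rewrite -expr2 sqrCi.
transitivity (x%:C * p1%:C - ('i%R * 'i%R) * (y%:C * p2%:C) + 'i%R * (y%:C * p1%:C)
   - 'i%R * (x%:C * p2%:C) + p3%:C - 'i%R * p4%:C); last by ring.
by rewrite i2; ring.
Qed.

Fact state_form_conj a b : state_form a b = (state_form b a)^*%R.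
Proof.
rewrite /state_form rmorphB rmorphM /= !conj_realC conjCi.
rewrite -(state_star (star a ** b)) starM starK.
have -> : 'i%R *: (star b ** a) = - star ('i%R *: (star a ** b)).
  by rewrite starZ starM starK conjCi scaleNr opprK.
by rewrite (real_linearN _ rf) state_star rmorphN; ring.
Qed.

Lemma Re_state_form a b : Re (state_form a b) = f (star b ** a).
Proof.
have h (x y : R) : Re (x%:C - 'i%R * y%:C) = x by rewrite -complexiE /=; ring.
exact: h.
Qed.

Fact state_form_ge0 a : 0 <= Re (state_form a a).
Proof. by rewrite Re_state_form state_pos. Qed.

Definition gns : prehilbert B := Prehilbert state_formP state_form_conj state_form_ge0.

Implicit Types (phi : antidual gns).

Lemma gns_quad_smul m b : Re (gns (m ** b) (m ** b)) <= p m ^+ 2 * Re (gns b b).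
Proof. by rewrite !Re_state_form state_contractive. Qed.

Lemma gns_bound phi m b :
  2 * Re (phi (star m ** b)) - Re (gns b b) <= p m ^+ 2 * antidual_quad phi.
Proof.
set N := antidual_quad phi; set s := Re (gns b b).
have s0 : 0 <= s := pform_ge0 gns b.
have N0 : 0 <= N := antidual_quad_ge0 phi.
have h1 := antidual_eval phi (star m ** b).
have h2 := gns_quad_smul (star m) b; rewrite (csn_star csn) -/s in h2.
have h3 := le_trans h1 (ler_wpM2l N0 h2).
have h4 := Re_le_cabs (phi (star m ** b)).
have h5 := cabs_ge0 (phi (star m ** b)); rewrite -/N in h3.
have h6 := sqr_ge0 (p m ^+ 2 * N - s).
have P0 := mulr_ge0 (sqr_ge0 (p m)) N0.
suff : 2 * cabs (phi (star m ** b)) <= p m ^+ 2 * N + s by lra.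
have hc : 0 <= 2 * cabs (phi (star m ** b)) by lra.
have hs : 0 <= p m ^+ 2 * N + s by lra.
rewrite -(ler_sqr hc hs).
by move: h3 h6; move: (cabs _) (p m ^+ 2) => c q; nra.
Qed.

Fact gns_act_subproof m phi :
  (fun b => phi (star m ** b)) \in @antidual_pred R B gns.
Proof.
apply/asboolP; split=> [k a b|].
  by rewrite smulDr scale_smulr (antilinearP (antidualP phi)).
by exists (p m ^+ 2 * antidual_quad phi) => b; exact: gns_bound.
Qed.

(** Acting by transposition defines the operator on the whole Hilbert space at once; [gns_act_incl]
    shows that it extends left multiplication. *)
Definition gns_act m phi : antidual gns := Antidual (gns_act_subproof m phi).

Lemma gns_act_nrm m phi : nrm (gns_act m phi) <= p m * nrm phi.
Proof.
rewrite -ler_sqr ?nnegrE ?mulr_ge0 ?nrm_ge0 ?(csn_ge0 csn)//.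
rewrite exprMn !antidual_nrm_sqr; apply: antidual_quad_lub => b; exact: gns_bound.
Qed.

Lemma gns_act_incl m a :
  gns_act m (antidual_incl gns a) = antidual_incl gns (m ** a).
Proof.
apply: antidual_ext => c /=.
by rewrite /state_form starM starK !smulA.
Qed.

End dominated_functional.
End states.

Section antidual_inner_product.
Variables (R : realType) (B : lmodType R[i]) (S : prehilbert B).
Implicit Types (a b : B) (f g : antidual S).
Local Notation ip := (antidual_dot S).
Local Notation iota := (antidual_incl S).
Let ip_norm : forall f, ip f f = `|f| ^+ 2 := @antidual_ip_norm R B S.

Lemma antidual_inclZ k a : iota (k *: a) = k *: iota a.
Proof. by apply: antidual_ext => b; rewrite /= pformZl. Qed.

Lemma antidual_quad_incl a : antidual_quad (iota a) = Re (S a a).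
Proof.
have := antidual_quad_sub_incl (iota a) a.
rewrite subrr -antidual_nrm_sqr nrm0 expr0n /=; lra.
Qed.

Lemma Re_antidual_ip_incl f a : Re (ip f (iota a)) = Re (f a).
Proof.
have := antidual_quad_sub_incl f a.
rewrite -!antidual_nrm_sqr (nrm_sqrB ip_norm) !antidual_nrm_sqr antidual_quad_incl.
lra.
Qed.

Lemma antidual_ip_incl f a : ip f (iota a) = f a.
Proof.
have h1 := Re_antidual_ip_incl f a.
have h2 := Re_antidual_ip_incl f ('i%R *: a).
rewrite antidual_inclZ Re_ip_i (antiZ _ _ (antidualP f)) conjCi in h2.
apply/eqP; rewrite eq_complex h1 h2 eqxx andTb; apply/eqP.
by case: (f a) => x y; rewrite -complexiE /=; ring.
Qed.

Lemma antidual_incl_nrm_dense f e : 0 < e -> exists a, nrm (f - iota a) < e.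
Proof.
move=> e0; have [a ha] := antidual_incl_dense f (exprn_gt0 2 e0); exists a.
by rewrite -antidual_nrm_sqr ltr_sqr ?nnegrE ?nrm_ge0 ?(ltW e0) in ha.
Qed.

End antidual_inner_product.

(** * Extreme functionals give irreducible representations *)

Section gns_irreducible.
Variables (R : realType) (B : starAlgType R[i]) (one : B) (nm p : B -> R).
Hypotheses (smul1r : forall a : B, one ** a = a)
  (smulr1 : forall a : B, a ** one = a)
  (csn_nm : cstar_seminorm nm) (nm_eq0 : forall a, nm a = 0 -> a = 0)
  (nm_complete : seq_complete nm)
  (csn : cstar_seminorm p) (p_le : forall a, p a <= nm a) (p_one : p one = 1).
Variables (f : B -> R) (rf : real_linear f)
  (fq : forall a, f a <= upper_state one p a)
  (fext : extreme_below (upper_state one p) f).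
Implicit Types (a b m : B) (t : R).

Let G : prehilbert B :=
  gns smul1r smulr1 csn_nm nm_eq0 nm_complete csn p_le p_one rf fq.
Local Notation ip := (antidual_dot G).
Local Notation iota := (antidual_incl G).
Let ip_norm : forall u, ip u u = `|u| ^+ 2 := @antidual_ip_norm R B G.
Let act m (u : antidual G) : antidual G := gns_act m u.
Implicit Types (u v w : antidual G).

Let act_incl m a : act m (iota a) = iota (m ** a).
Proof. exact: gns_act_incl. Qed.

Let act_nrm m u : nrm (act m u) <= p m * nrm u.
Proof. exact: gns_act_nrm. Qed.

Let act_linear m : linear (act m).
Proof. by move=> k u v; apply: antidual_ext. Qed.
Let actM a b u : act (a ** b) u = act a (act b u).
Proof. by apply: antidual_ext => c /=; rewrite starM smulA. Qed.
Let actB m u v : act m (u - v) = act m u - act m v.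
Proof. exact: antidual_ext. Qed.

Let actD a b u : act (a + b) u = act a u + act b u.
Proof. by apply: antidual_ext => c /=; rewrite starD smulDl (antiD _ _ (antidualP u)). Qed.

Let actZ k b u : act (k *: b) u = k *: act b u.
Proof.
apply: antidual_ext => c /=.
by rewrite starZ scale_smull (antiZ _ _ (antidualP u)) conjCK.
Qed.

Let act_star m u v : ip (act (star m) u) v = ip u (act m v).
Proof.
have E a : ip (act (star m) u) (iota a) = ip u (act m (iota a)).
  by rewrite act_incl !antidual_ip_incl /= starK.
apply/eqP; rewrite -subr_eq0; apply/eqP/cabs_eq0/le_anti; rewrite cabs_ge0 andbT.
apply: (@le_eps _ _ _ (4 * (p m * nrm u))) => e e0; rewrite add0r.
have [a ha] := antidual_incl_nrm_dense v e0.
have -> : ip (act (star m) u) v - ip u (act m v) =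
    ip (act (star m) u) (v - iota a) - ip u (act m (v - iota a)).
  by rewrite actB !(ipDr, ipNr) E; ring.
rewrite (le_trans (cabsD _ _))// cabsN.
have h1 := cabs_ip_le ip_norm (act (star m) u) (v - iota a).
have h2 := cabs_ip_le ip_norm u (act m (v - iota a)).
have h3 := act_nrm (star m) u; rewrite (csn_star csn) in h3.
have h4 := act_nrm m (v - iota a).
have u0 := nrm_ge0 u; have n0 := nrm_ge0 (v - iota a); have p0 := csn_ge0 csn m.
have h5 : nrm (act (star m) u) * nrm (v - iota a) <= p m * nrm u * e.
  by apply: ler_pM => //; [exact: nrm_ge0|exact: ltW].
have h6 : nrm u * nrm (act m (v - iota a)) <= p m * nrm u * e.
  rewrite (mulrC (p m)) -mulrA ler_wpM2l// (le_trans h4)// ler_wpM2l//.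
  exact: ltW.
lra.
Qed.

Let xi : antidual G := iota one.

Let act_xi b : act b xi = iota b.
Proof. by rewrite act_incl smulr1. Qed.

Let Re_iota a b : Re (iota a b) = f (star b ** a).
Proof. exact: Re_state_form. Qed.

Let xi_nrm : nrm xi ^+ 2 = 1.
Proof.
rewrite antidual_nrm_sqr antidual_quad_incl Re_state_form (star_one smulr1) smul1r.
exact: (state_one smulr1 csn p_one rf fq).
Qed.

Let vector_le u b : Re (ip (act b u) u) <= nrm u ^+ 2 * upper_state one p b.
Proof.
have h t : 0 <= t -> Re (ip (act b u) u) <=
    nrm u ^+ 2 * (p (t%:C *: one + real_part b) - t).
  move=> t0.
  have E : Re (ip (act (real_part b) u) u) = Re (ip (act b u) u).
    rewrite actZ actD ipZl ipDl ReM_real ReD act_star (Re_ipC _ u); lra.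
  have h1 := Re_ip_le ip_norm (act (t%:C *: one + real_part b) u) u.
  have h2 := ler_wpM2r (nrm_ge0 u) (act_nrm (t%:C *: one + real_part b) u).
  have a1 : act one u = u.
    by apply: antidual_ext => c /=; rewrite (star_one smulr1) smul1r.
  have := le_trans h1 h2; rewrite actD actZ a1 ipDl ipZl ReD ReM_real.
  rewrite (Re_ip_id ip_norm) E -mulrA -expr2; lra.
have := sqr_ge0 (nrm u); rewrite le0r => /predU1P[u0|u0].
  by have := h 0 (lexx 0); rewrite u0 !mul0r.
rewrite mulrC -ler_pdivrMr//; apply: (le_infF 0%:nng) => t.
by rewrite ler_pdivrMr// mulrC h.
Qed.

Let vector_real_linear u : real_linear (fun b => Re (ip (act b u) u)).
Proof.
split=> [a b|t a]; first by rewrite actD ipDl ReD.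
by rewrite actZ ipZl ReM_real.
Qed.

(** Split the cyclic vector [xi] along an invariant subspace [V] and its complement. The two vector
    functionals add up to [f] and are dominated by multiples of [upper_state], so extremality makes
    the first one [l] times [f], and then [xi1 = l xi]. Either [l = 0] and [V] is orthogonal to the
    orbit of [xi], or [V] contains [xi]; the orbit being dense, [V] is trivial. *)
Lemma gns_irreducible : irreducible_rep ip act.
Proof.
split=> //.
- by move=> b; apply: (@lipschitz_nrm_continuous R _ _ _ (p b)) => u v; rewrite -actB.
- exists one, xi; rewrite act_xi; apply/eqP => h.
  by have := xi_nrm; rewrite /xi h nrm0 expr0n => /esym/eqP; rewrite oner_eq0.
move=> V clV V0 lV aV.
have [xi1 V1 orth] := orthogonal_projection ip_norm xi clV V0 lV.
have [xi2 xi2E] : exists z, z = xi - xi1 by exists (xi - xi1).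
rewrite -xi2E in orth.
have xiE : xi = xi1 + xi2 by rewrite xi2E addrC subrK.
have orth2 v : V v -> forall b, ip (act b xi2) v = 0.
  by move=> Vv b; rewrite -(starK b) act_star orth//; exact: aV.
have orth1 v : V v -> ip v xi2 = 0.
  by move=> Vv; rewrite ip_conj orth// rmorph0.
have fE b : Re (ip (act b xi) xi) = f b.
  by rewrite act_xi antidual_ip_incl Re_iota (star_one smulr1) smul1r.
have l12 : nrm xi1 ^+ 2 + nrm xi2 ^+ 2 = 1.
  have := nrm_sqrD ip_norm xi1 xi2; rewrite -xiE xi_nrm (orth1 _ V1) => ->.
  by rewrite /= mulr0 addr0.
have actDr b u v : act b (u + v) = act b u + act b v by exact: antidual_ext.
have sum b : Re (ip (act b xi1) xi1) + Re (ip (act b xi2) xi2) <= f b.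
  rewrite -fE xiE actDr ipDl !ipDr (orth2 _ V1) (orth1 (act b xi1)); last exact: aV.
  by rewrite addr0 add0r ReD.
have [h1 _] := fext (sqr_ge0 _) (sqr_ge0 _) l12 (vector_real_linear xi1)
  (vector_real_linear xi2) (vector_le xi1) (vector_le xi2) sum.
set l := nrm xi1 ^+ 2 in l12 h1.
have e1 b : Re (ip (act b xi1) xi1) = l * f b.
  have := h1 (- b).
  rewrite (real_linearN _ (vector_real_linear xi1)) (real_linearN _ rf) mulrN lerN2 => h.
  by apply/le_anti; rewrite h1 h.
have e2 : xi1 = l%:C *: xi.
  have key b : Re ((xi1 - l%:C *: xi) b) = 0.
    rewrite antidualD antidualN antidualZ ReD ReN ReM_real Re_iota smulr1.
    have := e1 (star b); rewrite (_ : Re (ip _ _) = Re (xi1 b)).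
      by move=> ->; rewrite subrr.
    rewrite -[in RHS](antidual_ip_incl xi1) -act_xi -act_star [in RHS]xiE ipDr.
    by rewrite (orth1 (act _ xi1)) ?addr0//; exact: aV.
  apply/eqP; rewrite -subr_eq0; apply/eqP/antidual_ext => b.
  have := key ('i%R *: b); rewrite (antiZ _ _ (antidualP _)) conjCi.
  move: (key b); case: ((xi1 - l%:C *: xi) b) => x y; rewrite -complexiE /= => -> h.
  by congr Complex; lra.
have [l0|l0] := eqVneq l 0.
  left; apply/seteqP; split => [v Vv|_ ->//]; apply: antidual_ext => b /=.
  have xi10 : xi1 = 0 by rewrite e2 l0 scale0r.
  rewrite -(antidual_ip_incl v) -act_xi -[b]starK -act_star xiE ipDr.
  by rewrite xi10 ip_conj ip0l rmorph0 add0r (orth1 (act _ v))//; exact: aV.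
right; apply/seteqP; split => // u _.
have Vxi : V xi.
  have -> : xi = (l^-1)%:C *: xi1 + 0.
    by rewrite addr0 e2 scalerA -rmorphM/= mulVf// scale1r.
  exact: lV.
apply: (closed_nrm clV) => e e0; have [a ha] := antidual_incl_nrm_dense u e0.
by exists (iota a) => //; rewrite -act_xi; exact: aV.
Qed.

End gns_irreducible.

(** An extreme [f] with the largest possible value at [star b ** b] satisfies
    [f (star b ** b) >= p b ^+ 2], and the left side is the squared norm of [pi b] at the cyclic
    vector. *)
Theorem exists_irreducible_rep (R : realType) (B : starAlgType R[i]) (one : B)
    (nm p : B -> R) (smul1r : forall a : B, one ** a = a)
    (smulr1 : forall a : B, a ** one = a)
    (csn_nm : cstar_seminorm nm) (nm_eq0 : forall a, nm a = 0 -> a = 0)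
    (nm_complete : seq_complete nm) (csn : cstar_seminorm p)
    (p_le : forall a, p a <= nm a) (p_one : p one = 1) (b : B) :
  exists (H : completeNormedModType R[i]) (ip : {dot H for (@Num.conj R[i])})
    (pi : B -> H -> H), [/\ irreducible_rep ip pi,
      forall a u, nrm (pi a u) <= p a * nrm u &
      exists2 u, nrm u <= 1 & p b <= nrm (pi b u)].
Proof.
have sub := upper_state_sublinear csn p_one.
have [f [rf fq fb fext]] := extreme_real_linear (star b ** b) sub.
pose G := gns smul1r smulr1 csn_nm nm_eq0 nm_complete csn p_le p_one rf fq.
exists (antidual G), (antidual_dot G), (fun m (u : antidual G) => gns_act m u); split.
- exact: gns_irreducible.
- by move=> a u; exact: gns_act_nrm.
- exists (antidual_incl G one).
    rewrite -(@expr_le1 _ 2) ?nrm_ge0// antidual_nrm_sqr antidual_quad_incl.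
    rewrite Re_state_form (star_one smulr1) smul1r.
    by rewrite (state_one smulr1 csn p_one rf fq).
  rewrite gns_act_incl smulr1 -ler_sqr ?nnegrE ?nrm_ge0 ?(csn_ge0 csn)//.
  rewrite antidual_nrm_sqr antidual_quad_incl Re_state_form fb -(csn_C csn).
  exact: (upper_state_ge smul1r smulr1 csn_nm nm_eq0 nm_complete csn p_one).
Qed.

(** * Multipliers, closed ideals and primitive ideals *)

Section cstar_norm.
Variables (R : realType) (A : cstarAlgType R).
Implicit Types (a b : A).

Lemma nrm_csn : cstar_seminorm (@nrm R A).
Proof.
split; [exact: nrmD|exact: nrmZ|move=> a b|move=> a].
  by rewrite -lecR rmorphM /= -!nrmE norm_smul.
by rewrite -lecR rmorphXn /= -!nrmE norm_star_smul.
Qed.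

Lemma nrm_complete : seq_complete (@nrm R A).
Proof. exact: nrm_seq_complete. Qed.

Lemma smul_eq0 a : (forall b, a ** b = 0) -> a = 0.
Proof.
move=> h; apply: nrm_eq0; apply/eqP; rewrite -sqrf_eq0.
by rewrite -(csn_star nrm_csn) -(csn_C nrm_csn) starK h nrm0.
Qed.

End cstar_norm.

(** * The multiplier algebra as a unital C*-algebra *)

Section multiplier_basics.
Variables (R : realType) (A : cstarAlgType R).
Implicit Types (a b : A) (m n : multiplier A) (k : R[i]).

Lemma mulLZD m k a b : mulL m (k *: a + b) = k *: mulL m a + mulL m b.
Proof. exact: dc_linearl (multP m) k a b. Qed.
Lemma mulLDr m a b : mulL m (a + b) = mulL m a + mulL m b.
Proof. by have := mulLZD m 1 a b; rewrite !scale1r. Qed.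
Lemma mulL0r m : mulL m 0 = 0.
Proof. by apply: (addrI (mulL m 0)); rewrite -mulLDr !addr0. Qed.
Lemma mulLZr m k a : mulL m (k *: a) = k *: mulL m a.
Proof. by rewrite -[k *: a]addr0 mulLZD mulL0r addr0. Qed.
Lemma mulLNr m a : mulL m (- a) = - mulL m a.
Proof. by rewrite -scaleN1r mulLZr scaleN1r. Qed.
Lemma mulLBr m a b : mulL m (a - b) = mulL m a - mulL m b.
Proof. by rewrite mulLDr mulLNr. Qed.
Lemma mulRDr m a b : mulR m (a + b) = mulR m a + mulR m b.
Proof. by have := dc_linearr (multP m) 1 a b; rewrite !scale1r. Qed.
Lemma mulRBr m a b : mulR m (a - b) = mulR m a - mulR m b.
Proof. by apply/eqP; rewrite eq_sym subr_eq -mulRDr subrK. Qed.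
Lemma mulL_smul m a b : mulL m (a ** b) = mulL m a ** b.
Proof. exact: dc_left (multP m) a b. Qed.
Lemma mulR_smul m a b : mulR m (a ** b) = a ** mulR m b.
Proof. exact: dc_right (multP m) a b. Qed.
Lemma mulR_mulL m a b : mulR m a ** b = a ** mulL m b.
Proof. exact: dc_mid (multP m) a b. Qed.

Lemma mulLM m n a : mulL (m ** n) a = mulL m (mulL n a). Proof. by []. Qed.
Lemma mulRM m n a : mulR (m ** n) a = mulR n (mulR m a). Proof. by []. Qed.
Lemma mulLD m n a : mulL (m + n) a = mulL m a + mulL n a. Proof. by []. Qed.
Lemma mulRD m n a : mulR (m + n) a = mulR m a + mulR n a. Proof. by []. Qed.
Lemma mulLN m a : mulL (- m) a = - mulL m a. Proof. by []. Qed.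
Lemma mulLZ k m a : mulL (k *: m) a = k *: mulL m a. Proof. by []. Qed.
Lemma mulRZ k m a : mulR (k *: m) a = k *: mulR m a. Proof. by []. Qed.
Lemma mulL0 a : mulL (0 : multiplier A) a = 0. Proof. by []. Qed.
Lemma mulL_star m a : mulL (star m) a = star (mulR m (star a)). Proof. by []. Qed.
Lemma mulR_star m a : mulR (star m) a = star (mulL m (star a)). Proof. by []. Qed.
Lemma mulL_incl a b : mulL (mult_incl a) b = a ** b. Proof. by []. Qed.
Lemma mulR_incl a b : mulR (mult_incl a) b = b ** a. Proof. by []. Qed.

Lemma mult_extL m n : mulL m =1 mulL n -> m = n.
Proof.
move=> h; apply: mult_ext => // a; apply/eqP; rewrite -subr_eq0; apply/eqP.
by apply: smul_eq0 => b; rewrite smulBl !mulR_mulL h subrr.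
Qed.

Lemma mult_inclZD k a b : mult_incl (k *: a + b) = k *: mult_incl a + mult_incl b.
Proof. by apply: mult_extL => c; rewrite mulLD mulLZ !mulL_incl smulDl scale_smull. Qed.
Lemma mult_inclD a b : mult_incl (a + b) = mult_incl a + mult_incl b.
Proof. by have := mult_inclZD 1 a b; rewrite !scale1r. Qed.
Lemma mult_inclZ k a : mult_incl (k *: a) = k *: mult_incl a.
Proof. by apply: mult_extL => c; rewrite mulLZ !mulL_incl scale_smull. Qed.
Lemma mult_inclN a : mult_incl (- a) = - mult_incl a.
Proof. by apply: mult_extL => c; rewrite mulLN !mulL_incl smulNr. Qed.
Lemma mult_inclB a b : mult_incl (a - b) = mult_incl a - mult_incl b.
Proof. by rewrite mult_inclD mult_inclN. Qed.
Lemma mult_incl0 : mult_incl (0 : A) = 0.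
Proof. by apply: mult_extL => c; rewrite mulL_incl smul0r. Qed.
Lemma mult_inclM a b : mult_incl (a ** b) = mult_incl a ** mult_incl b.
Proof. by apply: mult_extL => c; rewrite mulLM !mulL_incl smulA. Qed.
Lemma mult_incl_star a : mult_incl (star a) = star (mult_incl a).
Proof. by apply: mult_extL => c; rewrite mulL_star mulR_incl mulL_incl starM starK. Qed.
Lemma mult_incl_inj : injective (@mult_incl R A).
Proof.
move=> a b e; apply/eqP; rewrite -subr_eq0; apply/eqP/smul_eq0 => c.
by rewrite smulBl -!mulL_incl e subrr.
Qed.
Lemma mulL_mult_incl m a : m ** mult_incl a = mult_incl (mulL m a).
Proof. by apply: mult_extL => c; rewrite mulLM !mulL_incl mulL_smul. Qed.
Lemma mulR_mult_incl m a : mult_incl a ** m = mult_incl (mulR m a).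
Proof. by apply: mult_extL => c; rewrite mulLM !mulL_incl mulR_mulL. Qed.

Fact mult_one_subproof : double_centralizer (@id A, @id A).
Proof.
by split => //=; exists 1 => // a; rewrite mul1r.
Qed.
Definition mult_one : multiplier A := mult_of_dc mult_one_subproof.

Lemma mult_mul1 m : mult_one ** m = m. Proof. exact: mult_extL. Qed.
Lemma mult_mulr1 m : m ** mult_one = m. Proof. exact: mult_extL. Qed.

Section multiplier_seminorm.
Variable c : A -> R.
Hypotheses (csn : cstar_seminorm c)
  (c_bounded : forall m, exists2 k : R, 0 <= k & forall a, c (mulL m a) <= k * c a).

(** Operator norm of left multiplication as seen by [c]: the norm of $M(A)$ when [c] is the norm of
    $A$, the norm of $M(A) / \tilde J$ when [c] is the quotient norm of $J$. *)
Definition mult_norm m : R := inf [set k : R | 0 <= k /\ forall a, c (mulL m a) <= k * c a].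

Lemma mult_norm_ub m (k : R) : 0 <= k -> (forall a, c (mulL m a) <= k * c a) ->
  mult_norm m <= k.
Proof. by move=> k0 h; apply: ge_inf => //; exists 0 => j []. Qed.

Lemma mult_norm_ge0 m : 0 <= mult_norm m.
Proof.
by apply: lb_le_inf => [|k []//]; have [k k0 h] := c_bounded m; exists k.
Qed.

Lemma mult_norm_le m a : c (mulL m a) <= mult_norm m * c a.
Proof.
have := csn_ge0 csn a; rewrite le0r => /predU1P[ca|ca].
  by have [k _ /(_ a)] := c_bounded m; rewrite ca !mulr0.
rewrite -ler_pdivrMr//; apply: lb_le_inf.
  by have [k k0 h] := c_bounded m; exists k.
by move=> k [k0 h]; rewrite ler_pdivrMr.
Qed.

Lemma mult_norm_csn : cstar_seminorm mult_norm.
Proof.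
have Zle k m : mult_norm (k *: m) <= cabs k * mult_norm m.
  apply: mult_norm_ub => [|a]; first by rewrite mulr_ge0 ?cabs_ge0 ?mult_norm_ge0.
  by rewrite mulLZ (csn_Z csn) -mulrA ler_wpM2l ?cabs_ge0 ?mult_norm_le.
split=> [m n|k m|m n|m].
- apply: mult_norm_ub => [|a]; first by rewrite addr_ge0 ?mult_norm_ge0.
  by rewrite mulLD mulrDl (le_trans (csn_D csn _ _))// lerD// mult_norm_le.
- apply/le_anti; rewrite Zle/=; have [->|k0] := eqVneq k 0.
    by rewrite cabs0 mul0r mult_norm_ge0.
  have c1 : cabs k * cabs k^-1 = 1 by rewrite -cabsM divff// /cabs normr1.
  have := ler_wpM2l (cabs_ge0 k) (Zle k^-1 (k *: m)).
  by rewrite scalerA mulVf// scale1r mulrA c1 mul1r.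
- apply: mult_norm_ub => [|a]; first by rewrite mulr_ge0 ?mult_norm_ge0.
  rewrite mulLM (le_trans (mult_norm_le _ _))// -mulrA ler_wpM2l ?mult_norm_ge0//.
  exact: mult_norm_le.
- rewrite -[leRHS]sqr_sqrtr ?mult_norm_ge0// ler_sqr ?nnegrE ?mult_norm_ge0 ?sqrtr_ge0//.
  apply: mult_norm_ub => [|a]; first exact: sqrtr_ge0.
  rewrite -ler_sqr ?nnegrE ?mulr_ge0 ?sqrtr_ge0 ?(csn_ge0 csn)//.
  rewrite exprMn sqr_sqrtr ?mult_norm_ge0// -(csn_C csn).
  have -> : star (mulL m a) ** mulL m a = star a ** mulL (star m ** m) a.
    by rewrite mulLM -(mulR_mulL (star m)) mulR_star starK.
  rewrite (le_trans (csn_M csn _ _))// (csn_star csn).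
  by have := ler_wpM2l (csn_ge0 csn a) (mult_norm_le (star m ** m) a); rewrite mulrCA -expr2.
Qed.

Lemma mult_norm_one a : c a != 0 -> mult_norm mult_one = 1.
Proof.
move=> ca; apply/le_anti; rewrite mult_norm_ub//=; last by move=> b; rewrite mul1r.
have a0 : 0 < c a by rewrite lt0r ca (csn_ge0 csn).
by have := mult_norm_le mult_one a; rewrite -[leLHS]mul1r ler_pM2r.
Qed.

Lemma mult_norm_incl a : mult_norm (mult_incl a) = c a.
Proof.
apply/le_anti; rewrite mult_norm_ub ?(csn_ge0 csn)//=; last exact: csn_M.
have := csn_ge0 csn a; rewrite le0r => /predU1P[->|a0]; first exact: mult_norm_ge0.
have := mult_norm_le (mult_incl a) (star a).
rewrite mulL_incl -{1}(starK a) (csn_C csn) (csn_star csn).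
by rewrite expr2 ler_pM2r.
Qed.
End multiplier_seminorm.

Lemma bounded_operator_nrm m : exists2 k : R, 0 <= k & forall a, nrm (mulL m a) <= k * nrm a.
Proof.
have [k k0 h] := dc_boundedl (multP m); exists (Re k).
  by move: k0; rewrite lecE => /andP[].
have kE : k = (Re k)%:C by have := ger0_Im k0; case: k {h k0} => x y /= ->.
by move=> a; have := h a; rewrite kE !nrmE -rmorphM lecR.
Qed.

Lemma bounded_operatorP (f : A -> A) (k : R) : 0 <= k ->
  (forall a, nrm (f a) <= k * nrm a) -> bounded_operator f.
Proof.
move=> k0 h; exists k%:C; first by rewrite ler0c.
by move=> a; rewrite !nrmE -rmorphM lecR.
Qed.

Definition opn := mult_norm (@nrm R A).

Lemma opn_csn : cstar_seminorm opn.
Proof. exact: mult_norm_csn (@nrm_csn R A) bounded_operator_nrm. Qed.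

Lemma opn_le m a : nrm (mulL m a) <= opn m * nrm a.
Proof. exact: mult_norm_le (@nrm_csn R A) bounded_operator_nrm m a. Qed.

Lemma opn_ub m (k : R) : 0 <= k -> (forall a, nrm (mulL m a) <= k * nrm a) -> opn m <= k.
Proof. exact: mult_norm_ub. Qed.

Lemma opn_leR m a : nrm (mulR m a) <= opn m * nrm a.
Proof.
have := opn_le (star m) (star a); rewrite mulL_star starK (csn_star opn_csn).
by rewrite !(csn_star (@nrm_csn R A)).
Qed.

Lemma opn_incl a : opn (mult_incl a) = nrm a.
Proof. exact: mult_norm_incl (@nrm_csn R A) bounded_operator_nrm a. Qed.

Lemma opn_eq0 m : opn m = 0 -> m = 0.
Proof.
move=> h; apply: mult_extL => a; apply: nrm_eq0; apply/le_anti.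
by rewrite nrm_ge0 andbT; have := opn_le m a; rewrite h mul0r.
Qed.

(** The identities of a double centralizer pass to pointwise limits by continuity, and the uniform
    bound passes too. This yields both the completeness of $M(A)$ and the sum of a strictly
    convergent series. *)
Lemma strict_limit (m_ : nat -> multiplier A) (C : R) (L S : A -> A) :
  (forall n : nat, opn (m_ n) <= C) -> (forall a, (fun n : nat => mulL (m_ n) a) @ \oo --> L a) ->
  (forall a, (fun n : nat => mulR (m_ n) a) @ \oo --> S a) ->
  exists m, mulL m =1 L /\ mulR m =1 S.
Proof.
move=> mC hL hS; have csnA := @nrm_csn R A.
have uniq (x y : nat -> A) (l l' : A) : x @ \oo --> l -> y @ \oo --> l' -> x =1 y -> l = l'.
  by move=> + hy /funext xy; rewrite xy => hx; exact: (@norm_cvg_unique _ A (y @ \oo) _ _ _ hx hy).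
have cr b (x : nat -> A) (l : A) : x @ \oo --> l -> (fun n : nat => x n ** b) @ \oo --> l ** b.
  move=> h; apply: (@cvg_comp _ _ _ x (fun c => c ** b) _ _ _ h).
  apply: (@lipschitz_nrm_continuous R A A (fun c => c ** b) (nrm b)) => v w.
  by rewrite -smulBl mulrC (csn_M csnA).
have cl b (x : nat -> A) (l : A) : x @ \oo --> l -> (fun n : nat => b ** x n) @ \oo --> b ** l.
  move=> h; apply: (@cvg_comp _ _ _ x (fun c => b ** c) _ _ _ h).
  apply: (@lipschitz_nrm_continuous R A A (fun c => b ** c) (nrm b)) => v w.
  by rewrite -smulBr (csn_M csnA).
have C0 : 0 <= C by exact: le_trans (csn_ge0 opn_csn _) (mC 0%N).
have bdd (F : multiplier A -> A -> A) (K : A -> A) :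
    (forall m a, nrm (F m a) <= opn m * nrm a) ->
    (forall a, (fun n : nat => F (m_ n) a) @ \oo --> K a) -> bounded_operator K.
  move=> Fle hK; apply: (@bounded_operatorP _ C) => // a.
  apply: (@le_eps _ _ _ 1) => e e0; have /cvg_nrm/(_ e e0)[N hN] := hK a.
  have := hN N (leqnn N); have := nrm_sub (K a) (F (m_ N) a); have := Fle (m_ N) a.
  have := ler_wpM2r (nrm_ge0 a) (mC N); rewrite (nrm_dist (K a)); lra.
have lin (F : multiplier A -> A -> A) (K : A -> A) :
    (forall m k a b, F m (k *: a + b) = k *: F m a + F m b) ->
    (forall a, (fun n : nat => F (m_ n) a) @ \oo --> K a) -> linear K.
  move=> FL hK k a b.
  have hz : (fun n : nat => k *: F (m_ n) a) @ \oo --> k *: K a by exact: cvgZl_tmp (hK a).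
  by apply: uniq (hK _) (cvgD hz (hK b)) _ => n; exact: FL.
have h : double_centralizer (L, S).
  split => /=.
  - by apply: lin hL => m k a b; exact: mulLZD.
  - by apply: lin hS => m k a b; exact: dc_linearr (multP m) k a b.
  - exact: bdd _ _ opn_le hL.
  - exact: bdd _ _ opn_leR hS.
  - by move=> a b; apply: uniq (hL _) (cr b _ _ (hL a)) _ => n; exact: mulL_smul.
  - by move=> a b; apply: uniq (hS _) (cl a _ _ (hS b)) _ => n; exact: mulR_smul.
  - by move=> a b; apply: uniq (cr b _ _ (hS a)) (cl a _ _ (hL b)) _ => n; exact: mulR_mulL.
by exists (mult_of_dc h).
Qed.

Lemma opn_complete : seq_complete opn.
Proof.
move=> u uC; have csn := opn_csn; have [N0 hN0] := uC 1 ltr01.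
(* The shift by [N0] keeps all terms within 1 of [u N0], which supplies the bound required by
   [strict_limit]. *)
have lim (F : multiplier A -> A -> A) : (forall m n a, F (m - n) a = F m a - F n a) ->
    (forall m a, nrm (F m a) <= opn m * nrm a) -> exists K : A -> A, forall a,
      (fun n : nat => F (u (n + N0)%N) a) @ \oo --> K a.
  move=> FB Fle; have ex a : exists l : A, (fun n : nat => F (u (n + N0)%N) a) @ \oo --> l.
    have a1 : 0 < nrm a + 1 by rewrite ltr_wpDl ?nrm_ge0.
    have [|l hl] := @nrm_complete R A (fun n : nat => F (u (n + N0)%N) a).
      move=> e e0; have [N hN] := uC (e / (nrm a + 1)) (divr_gt0 e0 a1); exists N => m n Nm Nn.
      rewrite -FB (le_trans (Fle _ _))//.
      have := hN (m + N0)%N (n + N0)%N (leq_trans Nm (leq_addr _ _)) (leq_trans Nn (leq_addr _ _)).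
      have := csn_ge0 csn (u (m + N0)%N - u (n + N0)%N); have := nrm_ge0 a.
      rewrite ler_pdivlMr//; nra.
    by exists l; apply/cvg_nrm.
  by have [K hK] := choice ex; exists K.
have [L hL] := lim (@mulL R A) (fun m n a => erefl) opn_le.
have [S hS] := lim (@mulR R A) (fun m n a => erefl) opn_leR.
have [n|m [hmL _]] := strict_limit (C := opn (u N0) + 1) _ hL hS.
  have := csn_D csn (u (n + N0)%N - u N0) (u N0); rewrite subrK.
  by have := hN0 (n + N0)%N N0 (leq_addl _ _) (leqnn _); lra.
exists m => e e0; have [N hN] := uC e e0; exists N => n Nn.
apply: opn_ub => [|a]; first exact: ltW.
apply: (@le_eps _ _ _ 1) => e1 e10; have /cvg_nrm/(_ e1 e10)[N1 hN1] := hL a.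
pose k := maxn N N1; rewrite mulLD mulLN hmL.
rewrite (le_trans (nrm_triangle (mulL (u (k + N0)%N) a) _ _))// lerD//; last first.
  by rewrite mul1r hN1// leq_maxr.
rewrite -mulLN -mulLD (le_trans (opn_le _ _))// ler_wpM2r ?nrm_ge0//.
by apply: hN => //; rewrite (leq_trans (leq_maxl _ _) (leq_addr _ _)).
Qed.

End multiplier_basics.

(** * Closed ideals: approximate units and quotient seminorms *)

Section closed_ideals.
Variables (R : realType) (A : cstarAlgType R).
Implicit Types (a b i j : A) (m : multiplier A) (k : R[i]) (I : set A).
Local Notation one := (mult_one A).

Record closed_ideal I : Prop := ClosedIdeal {
  closed_ideal0 : I 0;
  closed_idealP : forall k a b, I a -> I b -> I (k *: a + b);
  closed_ideal_mul : forall a b, I a -> I (a ** b) /\ I (b ** a);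
  closed_ideal_closed : closed I }.

Section one_ideal.
Variable I : set A.
Hypothesis idI : closed_ideal I.

Lemma closed_idealD a b : I a -> I b -> I (a + b).
Proof. by move=> Ia Ib; rewrite -[a]scale1r; exact: closed_idealP. Qed.
Lemma closed_idealZ k a : I a -> I (k *: a).
Proof. by move=> Ia; rewrite -[_ *: _]addr0; apply: closed_idealP => //; exact: closed_ideal0. Qed.
Lemma closed_idealN a : I a -> I (- a).
Proof. by move=> Ia; rewrite -scaleN1r; exact: closed_idealZ. Qed.
Lemma closed_idealB a b : I a -> I b -> I (a - b).
Proof. by move=> Ia Ib; apply: closed_idealD => //; exact: closed_idealN. Qed.
Lemma closed_idealMr a b : I a -> I (a ** b).
Proof. by move=> Ia; have [] := closed_ideal_mul idI b Ia. Qed.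
Lemma closed_idealMl a b : I a -> I (b ** a).
Proof. by move=> Ia; have [] := closed_ideal_mul idI b Ia. Qed.

(* [j] itself need not be known to lie in [I]: [1 - i] is a power of
   [1 - t j j^*]. *)
Lemma ideal_approx_unit j (e : R) : I (j ** star j) -> 0 < e -> exists i,
  [/\ I i, star i = i, opn (one - mult_incl i) <= 1 & nrm (j - i ** j) <= e].
Proof.
move=> Ij e0; pose t := (nrm j + 1)^-1.
have t0 : 0 < t by rewrite invr_gt0 ltr_wpDl ?nrm_ge0.
pose x := mult_incl (t%:C *: j); pose h := t%:C *: j ** star (t%:C *: j).
have px : opn x <= 1.
  rewrite opn_incl nrmZ cabsR gtr0_norm// mulrC ler_pdivrMr ?mul1r ?lerDl//.
  by rewrite ltr_wpDl ?nrm_ge0.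
have Ih : I h.
  by rewrite /h starZR !(scale_smull, scale_smulr); apply/closed_idealZ/closed_idealZ.
have sh : star h = h by rewrite starM starK.
have hE : mult_incl h = x ** star x by rewrite mult_inclM mult_incl_star.
clearbody h.
have [n0 hn0] := @inv_nat_small R ((e * t) ^+ 2) (exprn_gt0 _ (mulr_gt0 e0 t0)).
pose n := n0.+2.
have spowE q : exists i, [/\ I i, star i = i &
    spow one (one - x ** star x) q = one - mult_incl i].
  elim: q => [|q [i [Ii si E]]] /=.
    exists 0; split; [exact: closed_ideal0|exact: star0|].
    by rewrite mult_incl0 subr0.
  have hi : scomm h i.
    apply: mult_incl_inj; rewrite !mult_inclM.
    have := spow_scomm (@mult_mul1 R A) (@mult_mulr1 R A) q
      (erefl : scomm (one - x ** star x) (one - x ** star x)).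
    rewrite E -hE /scomm !(smulBl, smulBr) !mult_mul1 !mult_mulr1 => H.
    apply/eqP; rewrite -subr_eq0; apply/eqP; move/eqP: H; rewrite -subr_eq0 => /eqP H.
    by rewrite -[RHS]H; lmod.
  exists (i + h - h ** i); split.
  - by apply: closed_idealB; [exact: closed_idealD|exact: closed_idealMr].
  - by rewrite !starE si sh hi.
  - rewrite E -hE smulBl !smulBr !mult_mul1 !mult_mulr1.
    by rewrite -mult_inclM mult_inclB mult_inclD; lmod.
have [i [Ii si iE]] := spowE n.
have csnO := @opn_csn R A.
exists i; split => //.
  rewrite -iE; apply: (spow_le1 (@mult_mulr1 R A) csnO).
  have := star_smul_subr (@mult_mul1 R A) (@mult_mulr1 R A) csnO (@opn_eq0 R A)
    (@opn_complete R A) (c := star x) (t := 1).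
  by rewrite starK scale1r (csn_star csnO) => ->//; rewrite expr_le1// (csn_ge0 csnO).
have := spow_smul_le (@mult_mul1 R A) (@mult_mulr1 R A) csnO (@opn_eq0 R A)
  (@opn_complete R A) n px.
rewrite iE; have -> : (one - mult_incl i) ** x = mult_incl (t%:C *: (j - i ** j)).
  by rewrite smulBl mult_mul1 -mult_inclM -mult_inclB scale_smulr -scalerBr.
rewrite opn_incl nrmZ cabsR gtr0_norm// => hh.
have := hn0 n0 (leqnn n0); rewrite -/n => h1.
have n1 : (0 : R) < n%:R by rewrite ltr0n.
have h2 : (t * nrm (j - i ** j)) ^+ 2 <= (e * t) ^+ 2.
  apply: le_trans h1; rewrite ler_pdivlMr// mulrC.
  by apply: le_trans hh _; rewrite (_ : 1 = 1%:R)// ler_nat.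
rewrite ler_sqr ?nnegrE ?mulr_ge0 ?(ltW t0) ?(ltW e0) ?nrm_ge0// in h2.
by move: h2; rewrite mulrC ler_pM2r.
Qed.

(** [j] is a limit of products [i ** j], and [m (i j) = (m i) j] is a left multiple of [j] by an
    element of the algebra. *)
Lemma ideal_mulL m j : I j -> I (mulL m j).
Proof.
move=> Ij; apply: (closed_nrm (closed_ideal_closed idI)) => e e0.
have o0 := csn_ge0 (@opn_csn R A) m; have o1 : 0 < opn m + 1 by rewrite ltr_wpDl.
have [i [Ii _ _ hi]] := ideal_approx_unit (closed_idealMr (star j) Ij)
  (divr_gt0 (divr_gt0 e0 o1) (ltr0Sn _ 1)).
exists (mulL m (i ** j)); first by rewrite mulL_smul; exact: closed_idealMl.
rewrite -mulLBr (le_lt_trans (opn_le _ _))//.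
rewrite (le_lt_trans (ler_wpM2l o0 hi))//.
have -> : opn m * (e / (opn m + 1) / 2) = (opn m * e) / (opn m + 1) / 2 by field; rewrite gt_eqF.
rewrite ltr_pdivrMr// ltr_pdivrMr//; nra.
Qed.

Lemma ideal_mulR m j : I j -> I (mulR m j).
Proof.
move=> Ij; apply: (closed_nrm (closed_ideal_closed idI)) => e e0.
have o0 := csn_ge0 (@opn_csn R A) m; have o1 : 0 < opn m + 1 by rewrite ltr_wpDl.
have [|i [Ii si _ hi]] := @ideal_approx_unit (star j) _ _
  (divr_gt0 (divr_gt0 e0 o1) (ltr0Sn _ 1)).
  by rewrite starK; exact: closed_idealMl.
exists (mulR m (j ** i)); first by rewrite mulR_smul; exact: closed_idealMr.
have hi' : nrm (j - j ** i) <= e / (opn m + 1) / 2.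
  by rewrite -(csn_star (@nrm_csn R A)) starB starM si.
rewrite -mulRBr (le_lt_trans (opn_leR _ _))// (le_lt_trans (ler_wpM2l o0 hi'))//.
have -> : opn m * (e / (opn m + 1) / 2) = (opn m * e) / (opn m + 1) / 2 by field; rewrite gt_eqF.
rewrite ltr_pdivrMr// ltr_pdivrMr//; nra.
Qed.

Local Notation qn := (quotient_norm I).

Lemma qn_le a j : I j -> qn a <= nrm (a + j).
Proof. by move=> Ij; apply: ge_inf; [exists 0 => _ [i _ <-]; exact: nrm_ge0|exists j]. Qed.

Lemma qn_lub a r : (forall j, I j -> r <= nrm (a + j)) -> r <= qn a.
Proof.
move=> h; apply: lb_le_inf; first by exists (Re `|a + 0|), 0 => //; exact: closed_ideal0.
by move=> _ [j Ij <-]; exact: h.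
Qed.

Lemma qn_ge0 a : 0 <= qn a.
Proof. by apply: qn_lub => j _; exact: nrm_ge0. Qed.

Lemma qn_lubM a r (t : R) : 0 <= t -> (forall j, I j -> r <= t * nrm (a + j)) -> r <= t * qn a.
Proof.
rewrite le0r => /predU1P[->|t0] h.
  by have := h 0 (closed_ideal0 idI); rewrite !mul0r.
rewrite mulrC -ler_pdivrMr//; apply: qn_lub => j Ij.
by rewrite ler_pdivrMr// mulrC h.
Qed.

Lemma qn_le_nrm a : qn a <= nrm a.
Proof. by have := qn_le a (closed_ideal0 idI); rewrite addr0. Qed.

Lemma qn_mem a : I a -> qn a = 0.
Proof.
move=> Ia; apply/le_anti; rewrite qn_ge0 andbT.
by have := qn_le a (closed_idealN Ia); rewrite subrr nrm0.
Qed.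

Lemma qn_lt a r : qn a < r -> exists2 j, I j & nrm (a + j) < r.
Proof.
move=> h; have := @inf_lt R _ r _ h; move=> [|_ [j Ij <-] hj]; last by exists j.
by exists (Re `|a + 0|), 0 => //; exact: closed_ideal0.
Qed.

Lemma qn_eq0 a : qn a = 0 -> I a.
Proof.
move=> h; apply: (closed_nrm (closed_ideal_closed idI)) => e e0.
rewrite -h in e0; have [j Ij hj] := qn_lt e0; exists (- j); first exact: closed_idealN.
by rewrite opprK.
Qed.

Lemma qn_csn : cstar_seminorm qn.
Proof.
have Zle k a : qn (k *: a) <= cabs k * qn a.
  apply: qn_lubM => [|j Ij]; first exact: cabs_ge0.
  by rewrite -nrmZ scalerDr; apply: qn_le; exact: closed_idealZ.
split=> [a b|k a|a b|a].
- rewrite -lerBlDr; apply: qn_lub => i Ii; rewrite lerBlDl -lerBlDr.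
  apply: qn_lub => j Ij; rewrite lerBlDr.
  have := qn_le (a + b) (closed_idealD Ii Ij); rewrite addrACA.
  by have := nrmD (a + i) (b + j); lra.
- apply/le_anti; rewrite Zle/=; have [->|k0] := eqVneq k 0.
    by rewrite cabs0 mul0r qn_ge0.
  have c1 : cabs k * cabs k^-1 = 1 by rewrite -cabsM divff// /cabs normr1.
  have := ler_wpM2l (cabs_ge0 k) (Zle k^-1 (k *: a)).
  by rewrite scalerA mulVf// scale1r mulrA c1 mul1r.
- apply: qn_lubM => [|j Ij]; first exact: qn_ge0.
  rewrite mulrC; apply: qn_lubM => [|i Ii]; first exact: nrm_ge0.
  rewrite mulrC (le_trans _ (csn_M (@nrm_csn R A) _ _))//.
  rewrite smulDl !smulDr -addrA; apply: qn_le.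
  apply: closed_idealD; first exact: closed_idealMl.
  by apply: closed_idealD; exact: closed_idealMr.
(* Let [w = 1 - i] with [i] in [I] nearly a unit for [j]. Then [a w] represents the class of [a],
   and its squared norm is that of [w (star a ** a + j) w - w j w], where the last term is at most
   [e]. *)
- apply: qn_lub => j Ij; apply: (@le_eps _ _ _ 1) => e e0; rewrite mul1r.
  have [i [Ii si oi hi]] := ideal_approx_unit (closed_idealMr (star j) Ij) e0.
  set w := one - mult_incl i in oi.
  have sw : star w = w by rewrite starB (star_one (@mult_mulr1 R A)) -mult_incl_star si.
  have wR : mulR w a = a - a ** i by [].
  have le1 : qn a <= nrm (mulR w a).
    by rewrite wR; apply: qn_le; apply/closed_idealN/closed_idealMl.
  have E : star (mulR w a) ** mulR w a = mulL w (mulR w (star a ** a)).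
    by have := mulL_star w (star a); rewrite sw starK mulR_smul mulL_smul => ->.
  have csnA := @nrm_csn R A.
  have := csn_C csnA (mulR w a); rewrite E.
  have -> : star a ** a = (star a ** a + j) - j by rewrite addrK.
  rewrite mulRBr mulLBr => h1.
  have h2 : nrm (mulL w (mulR w (star a ** a + j))) <= nrm (star a ** a + j).
    rewrite (le_trans (opn_le _ _))// (le_trans (ler_piMl (nrm_ge0 _) oi))//.
    by rewrite (le_trans (opn_leR _ _))// ler_piMl// nrm_ge0.
  have h3 : nrm (mulL w (mulR w j)) <= e.
    have -> : mulL w (mulR w j) = mulR w (mulL w j).
      apply/eqP; rewrite -subr_eq0; apply/eqP/smul_eq0 => b.
      by rewrite smulBl -mulL_smul !mulR_mulL -mulL_smul subrr.
    rewrite (le_trans (opn_leR _ _))// (le_trans (ler_piMl (nrm_ge0 _) oi))//.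
  have h4 := nrmB (mulL w (mulR w (star a ** a + j))) (mulL w (mulR w j)).
  have h5 : qn a ^+ 2 <= nrm (mulR w a) ^+ 2 by rewrite ler_sqr ?nnegrE ?qn_ge0 ?nrm_ge0.
  rewrite addrK -/(quotient_norm I); lra.
Qed.

Lemma qn_mulL m a : qn (mulL m a) <= opn m * qn a.
Proof.
apply: qn_lubM => [|j Ij]; first exact: csn_ge0 (@opn_csn R A) m.
by rewrite (le_trans _ (opn_le _ _))// mulLDr; apply: qn_le; exact: ideal_mulL.
Qed.

Lemma qn_bounded m : exists2 k : R, 0 <= k & forall a, qn (mulL m a) <= k * qn a.
Proof. by exists (opn m); [exact: csn_ge0 (@opn_csn R A) m|move=> a; exact: qn_mulL]. Qed.

End one_ideal.
End closed_ideals.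

(** * Restriction of irreducible representations from $M(A)$ to $A$ *)

Section restriction.
Variables (R : realType) (A : cstarAlgType R) (H : completeNormedModType R[i])
  (ip : {dot H for (@Num.conj R[i])}) (pi : multiplier A -> H -> H).
Hypothesis rp : irreducible_rep ip pi.

(** The common kernel [Z] of $A$ is invariant under $M(A)$, hence 0. For [V] invariant under $A$,
    the part [W] that $M(A)$ keeps inside [V] is invariant. If [W = 0], then $A$ annihilates [V], as
    it maps [V] into [W], so [V] is contained in [Z]. *)
Lemma restrict_irreducible : (exists a u, pi (mult_incl a) u != 0) ->
  irreducible_rep ip (fun a => pi (mult_incl a)).
Proof.
move=> nz; split=> //.
- exact: hilbert_norm rp.
- by move=> a; exact: rep_linear rp _.
- by move=> a; exact: rep_continuous rp _.
- by move=> a b u; rewrite mult_inclD (repD rp).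
- by move=> k a u; rewrite mult_inclZ (repZ rp).
- by move=> a b u; rewrite mult_inclM (repM rp).
- by move=> a u v; rewrite mult_incl_star (rep_star rp).
move=> V clV V0 lV aV.
pose Z := \bigcap_a (pi (mult_incl a) @^-1` [set 0]).
have Z0 : Z = [set 0].
  have [| | | |//|ZT] := rep_irreducible rp (V := Z).
  - apply: closed_bigI => a _; apply: preimage_closed.
      by move=> u _; exact: (rep_continuous rp).
    exact/accessible_closed_set1/hausdorff_accessible/norm_hausdorff.
  - by move=> a _ /=; rewrite (rep0 _ rp).
  - move=> k u v Zu Zv a _ /=.
    by rewrite (rep_linear rp) (Zu a I) (Zv a I) scaler0 addr0.
  - move=> m u Zu a _ /=; rewrite -(repM rp) mulR_mult_incl.
    exact: Zu.
  have [a [u /eqP]] := nz; case.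
  have : Z u by rewrite ZT.
  exact.
pose W := V `&` \bigcap_m (pi m @^-1` V).
have [| | | |W0|WT] := rep_irreducible rp (V := W).
- apply: closedI => //; apply: closed_bigI => m _; apply: preimage_closed => //.
  by move=> u _; exact: (rep_continuous rp).
- by split=> // m _ /=; rewrite (rep0 _ rp).
- move=> k u v [Vu Wu] [Vv Wv]; split=> [|m _ /=]; first exact: lV.
  by rewrite (rep_linear rp); apply: (lV); [exact: Wu|exact: Wv].
- move=> m u [Vu Wu]; split=> [|n _ /=]; first exact: Wu.
  by rewrite -(repM rp); exact: Wu.
- left; apply/seteqP; split => [v Vv|_ ->//].
  rewrite -Z0 => a _ /=; have : W (pi (mult_incl a) v).
    split=> [|m _ /=]; first exact: aV.
    by rewrite -(repM rp) mulL_mult_incl; exact: aV.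
  by rewrite W0.
- right; apply/seteqP; split=> // v _.
  by have : W v by [rewrite WT]; case.
Qed.

End restriction.

(** * Primitive ideals are closed and separate closed ideals from points *)

Section primitive_ideals_closed.
Variables (R : realType) (A : cstarAlgType R).
Implicit Types (a b : A) (P : Prim A).

(** The definition of a representation only asks each operator to be continuous. With
    [x = star a ** a / r ^+ 2] and [1 - x] the square of [1 - d], the inner product of [pi x u] and
    [u] is the squared norm of [u] minus that of [u - pi d u]. *)
Lemma irreducible_contractive (H : completeNormedModType R[i])
    (ip : {dot H for (@Num.conj R[i])}) (pi : A -> H -> H) :
  irreducible_rep ip pi -> forall a u, nrm (pi a u) <= nrm a * nrm u.
Proof.
move=> rp a u; have ipn := hilbert_norm rp.
apply: (@le_eps _ _ _ (nrm u)) => e e0; pose r := nrm a + e.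
rewrite -[leRHS](_ : r * nrm u = _); last by rewrite /r; ring.
have r0 : 0 < r by rewrite /r ltr_wpDl ?nrm_ge0.
pose x := ((r ^+ 2)^-1)%:C *: (star a ** a).
have sx : star x = x by rewrite starZR starM starK.
have px : nrm x <= 1.
  rewrite nrmZ cabsR gtr0_norm ?invr_gt0 ?exprn_gt0// mulrC ler_pdivrMr ?exprn_gt0//.
  rewrite mul1r (csn_C (@nrm_csn R A)) ler_sqr ?nnegrE ?nrm_ge0 ?(ltW r0)//.
  by rewrite /r lerDl ltW.
have [d [dE _ sd _]] := exact_sqrt (@nrm_csn R A) (@nrm_eq0 R A) (@nrm_complete R A) px.
have {}sd := sd sx.
have h1 := nrm_sqrB ipn u (pi d u).
have h2 : Re (ip (pi x u) u) = (r ^+ 2)^-1 * nrm (pi a u) ^+ 2.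
  rewrite (repZ rp) ipZl ReM_real (repM rp) (rep_star rp).
  by rewrite (Re_ip_id ipn).
have h3 : Re (ip (pi x u) u) = 2 * Re (ip u (pi d u)) - nrm (pi d u) ^+ 2.
  have xE : x = d + (d + (-1) *: (d ** d)) by rewrite -dE; lmod.
  have h5 : ip (pi d (pi d u)) u = ip (pi d u) (pi d u) by rewrite -{1}sd (rep_star rp).
  rewrite xE !(repD rp) (repZ rp) !ipDl ipZl (repM rp) !ReD mulN1r ReN.
  rewrite h5 -(Re_ip_id ipn) (Re_ipC _ u); ring.
have h4 := sqr_ge0 (nrm (u - pi d u)).
rewrite -ler_sqr ?nnegrE ?mulr_ge0 ?nrm_ge0 ?(ltW r0)// exprMn.
rewrite -ler_pdivrMl ?exprn_gt0// -h2 h3; lra.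
Qed.

Lemma prim_ideal_closed_ideal P : closed_ideal (prim_ideal P).
Proof.
case: (prim_idealP P) => H [ip [pi [rp PE]]].
split.
- rewrite PE => u /=; have := repZ rp 0 0 u; rewrite !scale0r; exact.
- rewrite PE => k a b /= ha hb u.
  by rewrite (repD rp) (repZ rp) ha hb scaler0 addr0.
- move=> a b Pa; exact: prim_ideal_lr.
- move=> a clPa; rewrite PE => /= u; apply: nrm_eq0; apply/le_anti.
  rewrite nrm_ge0 andbT; apply: (@le_eps _ _ _ (nrm u)) => e e0; rewrite add0r.
  have := clPa (ball a e%:C); case.
    by apply: nbhsx_ballx; rewrite ltcR.
  move=> b []; rewrite {1}PE /= => Pb /ballC_nrm ab.
  have -> : pi a u = pi (a - b) u.
    by rewrite (repD rp) -scaleN1r (repZ rp) Pb scaler0 addr0.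
  rewrite (le_trans (irreducible_contractive rp _ _))// mulrC ler_wpM2l ?nrm_ge0//.
  exact: ltW.
Qed.

Lemma prim_ideal_proper P : exists a, ~ prim_ideal P a.
Proof.
case: (prim_idealP P) => H [ip [pi [rp PE]]].
have [a [u nz]] := rep_nonzero rp; exists a; rewrite PE => /(_ u) h.
by rewrite h eqxx in nz.
Qed.

Lemma ker_of_closed_ideal (S : set (Prim A)) : closed_ideal (ker_of S).
Proof.
split.
- by move=> P _; exact: closed_ideal0 (prim_ideal_closed_ideal P).
- move=> k a b ha hb P SP; apply: (closed_idealP (prim_ideal_closed_ideal P)).
    exact: ha.
  exact: hb.
- by move=> a b ha; split => P SP; have [] := prim_ideal_lr b (ha P SP).
- apply: closed_bigI => P _; exact: closed_ideal_closed (prim_ideal_closed_ideal P).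
Qed.

(** The existence theorem wants a unit: it is applied in $M(A)$ to the seminorm induced by $A / I$,
    and the representation found is restricted to $A$. *)
Lemma exists_prim_qn (I : set A) a : closed_ideal I -> quotient_norm I a != 0 ->
  exists P, I `<=` prim_ideal P /\ quotient_norm I a <= quotient_norm (prim_ideal P) a.
Proof.
move=> idI a0; pose p := mult_norm (quotient_norm I).
have csq := qn_csn idI; have bd := qn_bounded idI.
have csp : cstar_seminorm p := mult_norm_csn csq bd.
have p_le m : p m <= opn m.
  by apply: mult_norm_ub => [|b]; [exact: csn_ge0 (@opn_csn R A) m|exact: qn_mulL].
have p1 : p (mult_one A) = 1 := mult_norm_one csq bd a0.
have [H [ip [pi [rp pic [u u1 pu]]]]] := exists_irreducible_rep (@mult_mul1 R A)
  (@mult_mulr1 R A) (@opn_csn R A) (@opn_eq0 R A) (@opn_complete R A) csp p_le p1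
  (mult_incl a).
have pE b : p (mult_incl b) = quotient_norm I b := mult_norm_incl csq bd b.
have au : 0 < nrm (pi (mult_incl a) u).
  apply: lt_le_trans pu; rewrite pE lt0r a0; exact: qn_ge0.
have rq : irreducible_rep ip (fun a => pi (mult_incl a)).
  apply: restrict_irreducible => //; exists a, u; apply/eqP => h.
  by rewrite h nrm0 ltxx in au.
have prP : primitive_ideal [set b | forall u, pi (mult_incl b) u = 0].
  by exists H, ip, (fun a => pi (mult_incl a)).
exists (PrimIdeal prP); split => /=.
  move=> b Ib v; apply: nrm_eq0; apply/le_anti; rewrite nrm_ge0 andbT.
  by rewrite (le_trans (pic _ _))// pE (qn_mem idI Ib) mul0r.
apply: (qn_lub (prim_ideal_closed_ideal (PrimIdeal prP))) => j /= Pj.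
rewrite -pE (le_trans pu)//.
have -> : pi (mult_incl a) u = pi (mult_incl (a + j)) u.
  by rewrite mult_inclD (repD rp) Pj addr0.
rewrite (le_trans (pic _ _))// pE.
rewrite (le_trans (ler_piMr (qn_ge0 idI _) u1))//; exact: qn_le_nrm.
Qed.

Lemma prim_separate (I : set A) a : closed_ideal I -> ~ I a ->
  exists P, I `<=` prim_ideal P /\ ~ prim_ideal P a.
Proof.
move=> idI nIa; have a0 : quotient_norm I a != 0.
  by apply/eqP => /(qn_eq0 idI).
have [P [IP h]] := exists_prim_qn idI a0; exists P; split=> // Pa.
move: h; rewrite (qn_mem (prim_ideal_closed_ideal P) Pa) => h.
by move/eqP: a0; apply; apply/le_anti; rewrite h qn_ge0.
Qed.

Lemma nrm_le_prim a (r : R) : 0 <= r ->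
  (forall P, quotient_norm (prim_ideal P) a <= r) -> nrm a <= r.
Proof.
move=> r0 h; have id0 : closed_ideal [set 0 : A].
  split => //.
  - by move=> k b c -> ->; rewrite scaler0 addr0.
  - by move=> b c ->; rewrite smul0r smulr0.
  - exact/accessible_closed_set1/hausdorff_accessible/norm_hausdorff.
have [a0|a0] := eqVneq (quotient_norm [set 0] a) 0.
  by rewrite (qn_eq0 id0 a0) nrm0.
have [P [_ hP]] := exists_prim_qn id0 a0.
apply: le_trans (le_trans hP (h P)).
by apply: (qn_lub id0) => j ->; rewrite addr0.
Qed.

Lemma prim_eq0 a : (forall P, prim_ideal P a) -> a = 0.
Proof.
move=> h; apply: nrm_eq0; apply/le_anti; rewrite nrm_ge0 andbT.
apply: nrm_le_prim => // P; by rewrite (qn_mem (prim_ideal_closed_ideal P)).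
Qed.

End primitive_ideals_closed.

(** * Extension of irreducible representations from $A$ to $M(A)$ *)

Section extension.
Variables (R : realType) (A : cstarAlgType R) (H : completeNormedModType R[i])
  (ip : {dot H for (@Num.conj R[i])}) (pi : A -> H -> H).
Hypothesis rp : irreducible_rep ip pi.
Variable u : nat -> A.
Hypotheses (u1 : forall n, nrm (u n) <= 1)
  (ua : forall a (e : R), 0 < e -> exists N, forall n, (N <= n)%N -> nrm (u n ** a - a) <= e).
Implicit Types (a b : A) (m : multiplier A) (v w : H).

Let contr := irreducible_contractive rp.

Let piDr a v w : pi a (v + w) = pi a v + pi a w.
Proof. by have := rep_linear rp a 1 v w; rewrite !scale1r. Qed.
Let piZr a k v : pi a (k *: v) = k *: pi a v.
Proof. by have := rep_linear rp a k v 0; rewrite !addr0 (rep0 _ rp) addr0. Qed.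
Let piBr a v w : pi a (v - w) = pi a v - pi a w.
Proof. by rewrite piDr -scaleN1r piZr scaleN1r. Qed.
Let piBl a b v : pi (a - b) v = pi a v - pi b v.
Proof. by rewrite (repD rp) -scaleN1r (repZ rp) scaleN1r. Qed.

(** An induction principle: the vectors [pi a v] span a dense subspace, so a closed linear property
    need only be checked on them. *)
Lemma rep_full (V : set H) : closed V -> V 0 ->
  (forall k v w, V v -> V w -> V (k *: v + w)) -> (forall a v, V (pi a v)) ->
  forall v, V v.
Proof.
move=> clV V0 lV aV v.
have [| | | |VE|->//] := rep_irreducible rp (V := V) => //.
have [a [w /eqP nz]] := rep_nonzero rp.
by have := aV a w; rewrite VE.
Qed.

Lemma rep_nondegenerate w : (forall a, pi a w = 0) -> w = 0.
Proof.
pose Z := \bigcap_a (pi a @^-1` [set 0]).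
have [| | | |Z0 h|ZT _] := rep_irreducible rp (V := Z).
- apply: closed_bigI => a _; apply: preimage_closed.
    by move=> v _; exact: (rep_continuous rp).
  exact/accessible_closed_set1/hausdorff_accessible/norm_hausdorff.
- by move=> a _ /=; rewrite (rep0 _ rp).
- move=> k v v' Zv Zv' a _ /=.
  by rewrite (rep_linear rp) (Zv a I) (Zv' a I) scaler0 addr0.
- by move=> m v Zv a _ /=; rewrite -(repM rp); exact: Zv.
- by have : Z w by [move=> a _; exact: h]; rewrite Z0.
- have [a [v /eqP]] := rep_nonzero rp; case.
  by have : Z v by [rewrite ZT]; exact.
Qed.

Lemma rep_unit_cvg w (e : R) : 0 < e -> exists N, forall n, (N <= n)%N ->
  nrm (pi (u n) w - w) <= e.
Proof.
have uc v n : nrm (pi (u n) v) <= nrm v.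
  by rewrite (le_trans (contr _ _))// ler_piMl ?nrm_ge0.
move: w e; suff : forall w, [set w | forall e : R, 0 < e -> exists N, forall n, (N <= n)%N ->
  nrm (pi (u n) w - w) <= e] w by exact.
apply: rep_full.
- move=> w clw e e0; have e40 : 0 < e / 4 by rewrite divr_gt0.
  have [|w' [/= hw' /ballC_nrm ww']] := clw (ball w (e / 4)%:C).
    by apply: nbhsx_ballx; rewrite ltcR.
  have [N hN] := hw' _ e40; exists N => n Nn.
  have -> : pi (u n) w - w = pi (u n) (w - w') - (w - w') + (pi (u n) w' - w').
    by rewrite piBr; lmod.
  have := nrmD (pi (u n) (w - w') - (w - w')) (pi (u n) w' - w').
  have := nrmB (pi (u n) (w - w')) (w - w'); have := uc (w - w') n; have := hN n Nn.
  lra.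
- by move=> e e0; exists 0%N => n _; rewrite (rep0 _ rp) subr0 nrm0 ltW.
- move=> k v w hv hw e e0 /=; have ck := cabs_ge0 k.
  have c1 : 0 < cabs k + 1 by rewrite ltr_wpDl.
  have [N1 h1] := hv _ (divr_gt0 (divr_gt0 e0 (ltr0Sn _ 1)) c1).
  have [N2 h2] := hw _ (divr_gt0 e0 (ltr0Sn _ 1)).
  exists (maxn N1 N2) => n; rewrite geq_max => /andP[n1 n2].
  rewrite piDr piZr.
  have -> : k *: pi (u n) v + pi (u n) w - (k *: v + w) =
    k *: (pi (u n) v - v) + (pi (u n) w - w) by lmod.
  rewrite (le_trans (nrmD _ _))// nrmZ [leRHS](_ : e = e / 2 + e / 2); last by field.
  rewrite lerD ?h2//.
  have -> : e / 2 = (cabs k + 1) * (e / 2 / (cabs k + 1)) by field; rewrite gt_eqF.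
  by apply: ler_pM; rewrite ?nrm_ge0 ?lerDl ?h1.
- move=> a v e e0; have v1 : 0 < nrm v + 1 by rewrite ltr_wpDl ?nrm_ge0.
  have [N hN] := ua a (divr_gt0 e0 v1); exists N => n Nn.
  rewrite -(repM rp) -piBl (le_trans (contr _ _))//.
  have -> : e = e / (nrm v + 1) * (nrm v + 1) by field; rewrite gt_eqF.
  by apply: ler_pM; rewrite ?nrm_ge0 ?hN// lerDl.
Qed.

(* [w] is the value at [v] of the extension of [pi] to the multiplier [m]. *)
Definition ext_rel m v w := forall a, pi a w = pi (mulR m a) v.

Lemma ext_rel_uniq m v w w' : ext_rel m v w -> ext_rel m v w' -> w = w'.
Proof.
move=> h h'; apply/eqP; rewrite -subr_eq0; apply/eqP/rep_nondegenerate => a.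
by rewrite piBr h h' subrr.
Qed.

Lemma ext_rel_le m v w : ext_rel m v w -> nrm w <= opn m * nrm v.
Proof.
move=> h; apply: (@le_eps _ _ _ 1) => e e0; have [N hN] := rep_unit_cvg w e0.
have o0 := csn_ge0 (@opn_csn R A) m.
have h1 : nrm (pi (u N) w) <= opn m * nrm v.
  rewrite h (le_trans (contr _ _))// ler_wpM2r ?nrm_ge0//.
  by rewrite (le_trans (opn_leR _ _))// ler_piMr.
by have := hN N (leqnn N); have := nrm_sub w (pi (u N) w); rewrite nrm_dist; lra.
Qed.

Lemma ext_relP m k v v' w w' : ext_rel m v w -> ext_rel m v' w' ->
  ext_rel m (k *: v + v') (k *: w + w').
Proof. by move=> h h' a; rewrite !piDr !piZr h h'. Qed.

Lemma ext_rel_pi m b v : ext_rel m (pi b v) (pi (mulL m b) v).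
Proof. by move=> a; rewrite -!(repM rp) mulR_mulL. Qed.

(** By [rep_full]: at [pi b v] the value is [pi (mulL m b) v], and [ext_rel_le] makes the values
    along a convergent sequence Cauchy. *)
Lemma ext_rel_total m v : exists w, ext_rel m v w.
Proof.
move: v; apply: (rep_full (V := [set v | exists w, ext_rel m v w])).
- move=> v clv /=.
  have o0 := csn_ge0 (@opn_csn R A) m; have o1 : 0 < opn m + 1 by rewrite ltr_wpDl.
  have ex n : exists x : H * H, nrm (v - x.1) < n.+2%:R^-1 /\ ext_rel m x.1 x.2.
    have [|v' [/= [w hw] /ballC_nrm vv']] := clv (ball v (n.+2%:R^-1)%:C).
      by apply: nbhsx_ballx; rewrite ltcR invr_gt0.
    by exists (v', w).
  have [x hx] := choice ex.
  have xd i j : nrm ((x i).2 - (x j).2) <= (opn m + 1) * (i.+2%:R^-1 + j.+2%:R^-1).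
    have [hi1 hi2] := hx i; have [hj1 hj2] := hx j.
    have hij : ext_rel m ((x i).1 - (x j).1) ((x i).2 - (x j).2).
      have := ext_relP (-1) hj2 hi2; rewrite !scaleN1r.
      by rewrite addrC [- (x j).2 + _]addrC.
    rewrite (le_trans (ext_rel_le hij))// ler_pM ?nrm_ge0 ?lerDl//.
    have := nrm_triangle v (x i).1 (x j).1; rewrite (nrm_dist _ v); move: hi1 hj1.
    by move: (i.+2%:R^-1) (j.+2%:R^-1) => p q; lra.
  have [|w hw] := @nrm_seq_complete R H (fun n => (x n).2).
    move=> e e0; have [N hN] := inv_nat_small (divr_gt0 e0 o1).
    exists N => i j /hN hi /hN hj; rewrite (le_trans (xd i j))// mulrC -ler_pdivlMr//.
    by move: hi hj; move: (i.+2%:R^-1) (j.+2%:R^-1) => p q; lra.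
  exists w => a; apply/eqP; rewrite -subr_eq0; apply/eqP/nrm_eq0/le_anti.
  rewrite nrm_ge0 andbT; apply: (@le_eps _ _ _ (nrm a + nrm (mulR m a))) => e e0.
  have [N hN] := hw e e0; have [N' hN'] := inv_nat_small e0.
  pose n := maxn N N'; have h1 := hN n (leq_maxl _ _).
  have h2 := hN' n (leq_maxr _ _); have [h3 h4] := hx n.
  have -> : pi a w - pi (mulR m a) v =
      pi a (w - (x n).2) - pi (mulR m a) (v - (x n).1).
    by rewrite !piBr h4; lmod.
  rewrite add0r (le_trans (nrmB _ _))// mulrDl lerD//.
    by rewrite (le_trans (contr _ _))// ler_wpM2l ?nrm_ge0// nrm_dist.
  rewrite (le_trans (contr _ _))// ler_wpM2l ?nrm_ge0//.
  by move: h2 h3; move: (n.+2%:R^-1) (nrm_ge0 (v - (x n).1)) => p; lra.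
- by exists 0 => a; rewrite !(rep0 _ rp).
- by move=> k v v' [w hw] [w' hw']; exists (k *: w + w'); exact: ext_relP.
- by move=> a v; exists (pi (mulL m a) v); exact: ext_rel_pi.
Qed.

Definition ext_rep m v : H := xget 0 [set w | ext_rel m v w].

Lemma ext_repP m v : ext_rel m v (ext_rep m v).
Proof.
rewrite /ext_rep; case: xgetP => [w _ //|nw]; have [w hw] := ext_rel_total m v.
by have := nw w.
Qed.

Lemma ext_rep_eq m v w : ext_rel m v w -> ext_rep m v = w.
Proof. exact: ext_rel_uniq (ext_repP m v). Qed.

Lemma ext_rep0 m : ext_rep m 0 = 0.
Proof. by apply: ext_rep_eq => a; rewrite !(rep0 _ rp). Qed.

Lemma ext_rep_incl a v : ext_rep (mult_incl a) v = pi a v.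
Proof. by apply: ext_rep_eq => b; rewrite mulR_incl (repM rp). Qed.

Lemma ext_rep_pi m b v : ext_rep m (pi b v) = pi (mulL m b) v.
Proof. exact/ext_rep_eq/ext_rel_pi. Qed.

Lemma ext_rep_linear m : linear (ext_rep m).
Proof. by move=> k v w; apply/ext_rep_eq/ext_relP; exact: ext_repP. Qed.

Lemma ext_rep_le m v : nrm (ext_rep m v) <= opn m * nrm v.
Proof. exact/ext_rel_le/ext_repP. Qed.

Lemma ext_repB m v w : ext_rep m (v - w) = ext_rep m v - ext_rep m w.
Proof. by rewrite addrC -scaleN1r ext_rep_linear scaleN1r addrC. Qed.

Lemma ext_rep_star m v w : ip (ext_rep (star m) v) w = ip v (ext_rep m w).
Proof.
have ipn := hilbert_norm rp; have o0 := csn_ge0 (@opn_csn R A) m.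
move: w; apply: (rep_full
  (V := [set w | ip (ext_rep (star m) v) w = ip v (ext_rep m w)])).
- move=> w clw /=; apply/eqP; rewrite -subr_eq0; apply/eqP/cabs_eq0/le_anti.
  rewrite cabs_ge0 andbT; apply: (@le_eps _ _ _ (4 * (opn m * nrm v))) => e e0.
  rewrite add0r.
  have [|w' [/= hw' /ballC_nrm ww']] := clw (ball w e%:C).
    by apply: nbhsx_ballx; rewrite ltcR.
  have -> : ip (ext_rep (star m) v) w - ip v (ext_rep m w) =
      ip (ext_rep (star m) v) (w - w') - ip v (ext_rep m (w - w')).
    by rewrite ext_repB !(ipDr, ipNr) hw'; ring.
  rewrite (le_trans (cabsD _ _))// cabsN.
  have h1 := cabs_ip_le ipn (ext_rep (star m) v) (w - w').
  have h2 := cabs_ip_le ipn v (ext_rep m (w - w')).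
  have h3 := ext_rep_le (star m) v; rewrite (csn_star (@opn_csn R A)) in h3.
  have h4 := ext_rep_le m (w - w').
  have v0 := nrm_ge0 v; have n0 := nrm_ge0 (w - w').
  have h5 : nrm (ext_rep (star m) v) * nrm (w - w') <= opn m * nrm v * e.
    by apply: ler_pM => //; [exact: nrm_ge0|exact: ltW].
  have h6 : nrm v * nrm (ext_rep m (w - w')) <= opn m * nrm v * e.
    rewrite (mulrC (opn m)) -mulrA ler_wpM2l// (le_trans h4)// ler_wpM2l//.
    exact: ltW.
  lra.
- have z x : ip x 0 = 0 by rewrite ip_conj ip0l rmorph0.
  by rewrite /= ext_rep0 !z.
- move=> k w w' /= h h'.
  by rewrite ext_rep_linear !ipDr !ipZr h h'.
- move=> b w /=.
  by rewrite -(rep_star rp) ext_repP mulR_star starK (rep_star rp) ext_rep_pi.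
Qed.

Lemma ext_rep_irreducible : irreducible_rep ip ext_rep.
Proof.
split.
- exact: hilbert_norm rp.
- exact: ext_rep_linear.
- move=> m; apply: (@lipschitz_nrm_continuous R _ _ _ (opn m)) => v w.
  by rewrite -ext_repB ext_rep_le.
- move=> m m' v; apply: ext_rep_eq => a.
  by rewrite piDr !ext_repP mulRD (repD rp).
- move=> k m v; apply: ext_rep_eq => a.
  by rewrite piZr ext_repP mulRZ (repZ rp).
- by move=> m m' v; apply: ext_rep_eq => a; rewrite !ext_repP mulRM.
- exact: ext_rep_star.
- have [a [v nz]] := rep_nonzero rp; exists (mult_incl a), v.
  by rewrite ext_rep_incl.
- move=> V clV V0 lV aV; apply: (rep_irreducible rp) => // a v Vv.
  by rewrite -ext_rep_incl; exact: aV.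
Qed.

Lemma ext_rep_ker m : (forall v, ext_rep m v = 0) <->
  mult_tilde [set a | forall v, pi a v = 0] m.
Proof.
split=> [h a|h v].
  split=> v; first by rewrite -ext_rep_pi.
  by rewrite -ext_repP h (rep0 _ rp).
apply: ext_rep_eq => a; rewrite (rep0 _ rp).
by have [_ /= ->] := h a.
Qed.

End extension.

Section tilde_primitive.
Variables (R : realType) (A : cstarAlgType R).

Lemma sigma_unitalP : sigma_unital A -> exists u : nat -> A,
  [/\ forall n, positive_elt (u n), forall n, nrm (u n) <= 1,
      forall n, positive_elt (u n.+1 - u n),
      forall a (e : R), 0 < e -> exists N, forall n, (N <= n)%N -> nrm (u n ** a - a) <= e &
      forall a (e : R), 0 < e -> exists N, forall n, (N <= n)%N -> nrm (a ** u n - a) <= e].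
Proof.
move=> [u [h1 h2 h3]]; exists u; split => //.
- by move=> n; have [] := h1 n.
- by move=> n; have [_] := h1 n; rewrite nrmE lecR.
- by move=> a; have [/cvg_nrm] := h3 a.
- by move=> a; have [_ /cvg_nrm] := h3 a.
Qed.

Lemma tilde_prim (P : Prim A) : sigma_unital A ->
  exists Q : Prim (multiplier A), prim_ideal Q = mult_tilde (prim_ideal P).
Proof.
move=> /sigma_unitalP[u [_ u1 _ ua _]].
case: (prim_idealP P) => H [ip [pi [rp PE]]].
have prQ : primitive_ideal [set m | forall v, ext_rep pi m v = 0].
  by exists H, ip, (ext_rep pi); split => //; exact: (ext_rep_irreducible rp u1 ua).
exists (PrimIdeal prQ) => /=; rewrite PE; apply/seteqP; split => m /=.
  by move/(ext_rep_ker rp u1 ua).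
by move/(ext_rep_ker rp u1 ua).
Qed.

End tilde_primitive.

(** * The Dauns-Hofmann theorem *)

Lemma closed_hull (R : realType) (B : starAlgType R[i]) (S : set (Prim B)) :
  closed S -> hull (ker_of S) `<=` S.
Proof.
move=> clS P hP; have oS : hk_open (~` S) by exact: (closed_openC clS).
by have := oS P; rewrite !setCK => /(_ hP).
Qed.

Section dauns_hofmann.
Variables (R : realType) (A : cstarAlgType R).
Implicit Types (a b c : A) (P : Prim A) (S : set (Prim A)).
Local Notation one := (mult_one A).

Section sum_of_ideals.
Variables (I0 I1 : set A).
Hypotheses (id0 : closed_ideal I0) (id1 : closed_ideal I1).

Definition ideal_sum : set A := [set a | forall e : R, 0 < e ->
  exists x y, [/\ I0 x, I1 y & nrm (a - (x + y)) < e]].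

Lemma ideal_sum_closed_ideal : closed_ideal ideal_sum.
Proof.
split.
- move=> e e0; exists 0, 0; split; [exact: closed_ideal0|exact: closed_ideal0|].
  by rewrite addr0 subrr nrm0.
- move=> k a b ha hb e e0; have c1 : 0 < cabs k + 1 by rewrite ltr_wpDl ?cabs_ge0.
  have [x [y [hx hy hxy]]] := ha _ (divr_gt0 (divr_gt0 e0 (ltr0Sn _ 1)) c1).
  have [x' [y' [hx' hy' hxy']]] := hb _ (divr_gt0 e0 (ltr0Sn _ 1)).
  exists (k *: x + x'), (k *: y + y'); split; [exact: closed_idealP|exact: closed_idealP|].
  have -> : k *: a + b - (k *: x + x' + (k *: y + y')) =
    k *: (a - (x + y)) + (b - (x' + y')) by lmod.
  have h1 := nrmD (k *: (a - (x + y))) (b - (x' + y')); rewrite nrmZ in h1.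
  have h2 : cabs k * nrm (a - (x + y)) <= e / 2.
    have -> : e / 2 = (cabs k + 1) * (e / 2 / (cabs k + 1)) by field; rewrite gt_eqF.
    by apply: ler_pM; rewrite ?nrm_ge0 ?cabs_ge0 ?lerDl ?(ltW hxy).
  lra.
- move=> a b ha; have b1 : 0 < nrm b + 1 by rewrite ltr_wpDl ?nrm_ge0.
  have key (e : R) x y : nrm (a - (x + y)) < e / (nrm b + 1) ->
      nrm ((a - (x + y)) ** b) < e /\ nrm (b ** (a - (x + y))) < e.
    rewrite ltr_pdivlMr// => h; have csnA := @nrm_csn R A.
    have := csn_M csnA (a - (x + y)) b; have := csn_M csnA b (a - (x + y)).
    have := nrm_ge0 (a - (x + y)); have := nrm_ge0 b; split; nra.
  split=> e e0; have [x [y [hx hy /key[h1 h2]]]] := ha _ (divr_gt0 e0 b1).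
    exists (x ** b), (y ** b); split; [exact: closed_idealMr|exact: closed_idealMr|].
    by rewrite -smulDl -smulBl.
  exists (b ** x), (b ** y); split; [exact: closed_idealMl|exact: closed_idealMl|].
  by rewrite -smulDr -smulBr.
- move=> a cla e e0; have e20 : 0 < e / 2 by rewrite divr_gt0.
  have [|a' [ha' /ballC_nrm aa']] := cla (ball a (e / 2)%:C).
    by apply: nbhsx_ballx; rewrite ltcR.
  have [x [y [hx hy hxy]]] := ha' _ e20; exists x, y; split => //.
  by have := nrm_triangle a' a (x + y); lra.
Qed.

Lemma ideal_sum_l a : I0 a -> ideal_sum a.
Proof.
move=> h e e0; exists a, 0; split=> //; first exact: closed_ideal0.
by rewrite addr0 subrr nrm0.
Qed.

Lemma ideal_sum_r a : I1 a -> ideal_sum a.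
Proof.
move=> h e e0; exists 0, a; split=> //; first exact: closed_ideal0.
by rewrite add0r subrr nrm0.
Qed.

End sum_of_ideals.

(** No primitive ideal contains both kernels, so their sum is dense and [a] is nearly [x + y]. With
    [i] in the first kernel nearly a unit for [x], take [c = i ** a]: modulo [P] in [S1] the term
    [y] disappears and [a - c] is nearly [x - i ** x]. *)
Lemma prim_separation S0 S1 a (e : R) : closed S0 -> closed S1 ->
  (forall P, S0 P -> S1 P -> False) -> 0 < e ->
  exists c, [/\ forall P, S0 P -> prim_ideal P c,
    forall P, S1 P -> quotient_norm (prim_ideal P) (a - c) <= e & nrm c <= 2 * nrm a].
Proof.
move=> cl0 cl1 disj e0; pose I0 := ker_of S0; pose I1 := ker_of S1.
have id0 : closed_ideal I0 := ker_of_closed_ideal S0.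
have id1 : closed_ideal I1 := ker_of_closed_ideal S1.
have Ia : ideal_sum I0 I1 a.
  apply: contrapT => nIa.
  have [P [IP _]] := prim_separate (ideal_sum_closed_ideal id0 id1) nIa.
  apply: (disj P); apply: closed_hull => //= b hb; apply: IP.
    exact: ideal_sum_l.
  exact: ideal_sum_r.
have [x [y [hx hy hxy]]] := Ia _ (divr_gt0 e0 (ltr0Sn _ 1)).
have [i [Ii _ oi hi]] := ideal_approx_unit id0 (closed_idealMr id0 (star x) hx)
  (divr_gt0 e0 (ltr0Sn _ 1)).
have w1 b : nrm (b - i ** b) <= nrm b.
  have := opn_le (one - mult_incl i) b.
  by move/le_trans; apply; rewrite ler_piMl ?nrm_ge0.
exists (i ** a); split.
- by move=> P SP; have [] := prim_ideal_lr a (Ii P SP).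
- move=> P SP; have idP := prim_ideal_closed_ideal P.
  have Py : prim_ideal P (- (y - i ** y)).
    have Py := hy P SP; apply: (closed_idealN idP); apply: (closed_idealB idP) => //.
    exact: (closed_idealMl idP).
  rewrite (le_trans (qn_le _ Py))//.
  have -> : a - i ** a - (y - i ** y) =
      ((a - (x + y)) - i ** (a - (x + y))) + (x - i ** x).
    by rewrite !smulE; lmod.
  by have := nrmD ((a - (x + y)) - i ** (a - (x + y))) (x - i ** x);
    have := w1 (a - (x + y)); lra.
- have := nrm_sub (i ** a) a; have := w1 a; rewrite (nrm_dist a); lra.
Qed.

Section real_function.
Variable F : Prim A -> R.
Hypotheses (cF : continuous F) (F0 : forall P, 0 <= F P).

(** Layer by layer: level [K] adds an element that is 0 where [F <= K] and nearly [a] where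
    [F >= K + 1]. At a given [P] at most one level lies strictly in between; it costs [2 * nrm a]
    for the added element and [nrm a] for the target, however many levels there are. *)
Lemma dauns_hofmann_truncated a (e : R) K : 0 < e -> exists c, forall P,
  quotient_norm (prim_ideal P) (c - (Num.min (F P) K%:R)%:C *: a) <=
    K%:R * e + (if K%:R <= F P then 0 else 3 * nrm a).
Proof.
move=> e0; elim: K => [|K [c hc]].
  exists 0 => P; rewrite F0 min_r// scale0r subr0 mul0r addr0.
  have idP := prim_ideal_closed_ideal P.
  by rewrite (qn_mem idP (closed_ideal0 idP)).
have cl0 : closed [set P | F P <= K%:R].
  by apply: (@preimage_closed _ _ F [set r | r <= K%:R]) => [P _|]; [exact: cF|exact: closed_le].
have cl1 : closed [set P | K.+1%:R <= F P].
  by apply: (@preimage_closed _ _ F [set r | K.+1%:R <= r]) => [P _|]; [exact: cF|exact: closed_ge].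
have [P /= h1 h2|d [d0 d1 dn]] := prim_separation a cl0 cl1 _ e0.
  have := le_trans h2 h1; rewrite ler_nat ltnn => //.
exists (c + d) => P; have idP := prim_ideal_closed_ideal P.
have csq := qn_csn idP; have {hc} := hc P; have Ke : K.+1%:R = K%:R + 1 :> R by rewrite natr1.
have [hK1|hK1] := leP K.+1%:R (F P).
  have hK : K%:R <= F P by rewrite (le_trans _ hK1)// ler_nat.
  rewrite hK (min_r hK) addr0 Ke => hc.
  have -> : c + d - (K%:R + 1)%:C *: a = (c - K%:R%:C *: a) - (a - d) by lmod.
  by rewrite addr0 mulrDl mul1r (le_trans (csnB csq _ _))// lerD// d1.
have [hK|hK] := leP K%:R (F P).
  rewrite addr0 => hc.
  have -> : c + d - (F P)%:C *: a = (c - K%:R%:C *: a) + (d - (F P - K%:R)%:C *: a) by lmod.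
  rewrite (le_trans (csn_D csq _ _))// lerD//.
    by rewrite (le_trans hc)// ler_wpM2r ?(ltW e0)// ler_nat.
  rewrite (le_trans (qn_le_nrm idP _))// (le_trans (nrmB _ _))// nrmZ cabsR.
  rewrite ger0_norm ?subr_ge0//.
  have : (F P - K%:R) * nrm a <= 1 * nrm a.
    by rewrite ler_wpM2r ?nrm_ge0// lerBlDr addrC -Ke ltW.
  lra.
move=> hc.
have dP : prim_ideal P d by apply: d0; exact: ltW.
have -> : c + d - (F P)%:C *: a = (c - (F P)%:C *: a) + d by lmod.
rewrite (le_trans (csn_D csq _ _))// (qn_mem idP dP) addr0 (le_trans hc)// lerD2r.
by rewrite ler_wpM2r ?(ltW e0)// ler_nat.
Qed.
End real_function.

Lemma dauns_hofmann_approx (f : Prim A -> R) a (e : R) : continuous f ->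
  (forall P, 0 <= f P <= 1) -> 0 < e ->
  exists c, forall P, quotient_norm (prim_ideal P) (c - (f P)%:C *: a) <= e.
Proof.
(* [f] is cut into [n] layers of height [1 / n]; this [n] brings the cost [3 * nrm a / n] of the
   transitional layer below [e / 2]. *)
move=> cf f01 e0; pose n := (Num.bound (6 * nrm a / e)).+1.
have n0 : (0 : R) < n%:R by rewrite ltr0n.
have hn : 3 * nrm a / n%:R <= e / 2.
  have h := archi_boundP (divr_ge0 (mulr_ge0 (ler0n R 6) (nrm_ge0 a)) (ltW e0)).
  rewrite ler_pdivrMr//; move: h; rewrite ltr_pdivrMr// => h.
  have : (Num.bound (6 * nrm a / e))%:R <= n%:R :> R by rewrite ler_nat.
  by move=> /(ler_wpM2r (ltW e0)); lra.
pose F P := n%:R * f P.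
have cF : continuous F by move=> P; exact: (@cvgMl_tmp R (Prim A) (nbhs P) _ f n%:R (f P) (cf P)).
have F0 P : 0 <= F P by case/andP: (f01 P) => f0 _; rewrite mulr_ge0.
have [c hc] := dauns_hofmann_truncated cF F0 a n (divr_gt0 e0 (ltr0Sn _ 1)).
exists ((n%:R^-1)%:C *: c) => P; have := hc P.
have csq := qn_csn (prim_ideal_closed_ideal P).
have -> : Num.min (F P) n%:R = F P.
  by rewrite min_l// /F ler_piMr ?ler0n//; case/andP: (f01 P).
have -> : (n%:R^-1)%:C *: c - (f P)%:C *: a = (n%:R^-1)%:C *: (c - (F P)%:C *: a).
  by rewrite scalerBr scalerA -rmorphM/= /F mulrA mulVf ?mul1r// gt_eqF.
rewrite (csnZR csq) ger0_norm ?invr_ge0 ?ler0n// => h.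
rewrite mulrC ler_pdivrMr// (le_trans h)//.
have : (if n%:R <= F P then 0 else 3 * nrm a) <= 3 * nrm a.
  by case: ifP => // _; rewrite mulr_ge0 ?nrm_ge0.
by move: hn; rewrite ler_pdivrMr//; lra.
Qed.

Lemma dauns_hofmann_elt (f : Prim A -> R) a : continuous f ->
  (forall P, 0 <= f P <= 1) ->
  exists c, forall P, prim_ideal P (c - (f P)%:C *: a).
Proof.
move=> cf f01.
have ex (n : nat) : exists c, forall P,
    quotient_norm (prim_ideal P) (c - (f P)%:C *: a) <= n.+2%:R^-1.
  by apply: dauns_hofmann_approx => //; rewrite invr_gt0.
have [c hc] := choice ex.
have [|l hl] := @nrm_complete R A c.
  move=> e e0; have [N hN] := inv_nat_small e0; exists N => m n /hN hm /hN hn.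
  apply: nrm_le_prim => [|P]; first exact: ltW.
  have csq := qn_csn (prim_ideal_closed_ideal P).
  rewrite (le_trans (csn_triangle csq ((f P)%:C *: a) _ _))//.
  rewrite (csn_dist csq ((f P)%:C *: a)).
  have := hc m P; have := hc n P; move: hm hn.
  by move: (m.+2%:R^-1) (n.+2%:R^-1) => p q; lra.
exists l => P; have idP := prim_ideal_closed_ideal P; have csq := qn_csn idP.
apply: (qn_eq0 idP); apply/le_anti; rewrite (csn_ge0 csq) andbT.
apply: (@le_eps _ _ _ 2) => e e0; have [N hN] := hl e e0; have [N' hN'] := inv_nat_small e0.
pose n := maxn N N'; have h1 := hN n (leq_maxl _ _); have h2 := hN' n (leq_maxr _ _).
rewrite (le_trans (csn_triangle csq (c n) _ _))// (csn_dist csq l).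
have := le_trans (qn_le_nrm idP _) h1; have := hc n P; move: h2.
have : 0 < n.+2%:R^-1 :> R by rewrite invr_gt0.
by move: (n.+2%:R^-1) => p; lra.
Qed.

(** The property that characterises [dauns_hofmann f], with centrality left out because
    [acts_as_central] recovers it. *)
Definition acts_as (z : multiplier A) (f : Prim A -> R[i]) :=
  forall a P, prim_ideal P (mulL z a - f P *: a).

Lemma acts_as_uniq z z' f : acts_as z f -> acts_as z' f -> z = z'.
Proof.
move=> h h'; apply: mult_extL => a; apply/eqP; rewrite -subr_eq0; apply/eqP/prim_eq0 => P.
have := closed_idealB (prim_ideal_closed_ideal P) (h a P) (h' a P).
by rewrite opprB addrA subrK.
Qed.

Lemma acts_as_central z f : acts_as z f -> mult_center z.
Proof.
move=> h m; apply: mult_extL => a; apply/eqP; rewrite -subr_eq0; apply/eqP/prim_eq0 => P.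
have idP := prim_ideal_closed_ideal P.
have := closed_idealB idP (h (mulL m a) P) (ideal_mulL idP m (h a P)).
by rewrite !mulLM mulLBr mulLZr opprB addrA subrK.
Qed.

Lemma acts_as_dauns_hofmann z f : acts_as z f -> dauns_hofmann f = z.
Proof.
move=> h; rewrite /dauns_hofmann; case: xgetP => [w _ [_ hw]|nz].
  exact: acts_as_uniq hw h.
by have := nz z; case; split => //; exact: acts_as_central h.
Qed.

(** The value 0 is also the default of [xget] when no multiplier acts as [f]; a nonzero value is
    genuine. *)
Lemma dauns_hofmann_acts f : dauns_hofmann f != 0 :> multiplier A ->
  acts_as (dauns_hofmann f) f.
Proof.
rewrite /dauns_hofmann; case: xgetP => [w _ [_ hw] _|_]; first exact: hw.
by rewrite eqxx.
Qed.

Theorem dauns_hofmann_exists (f : Prim A -> R) : continuous f ->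
  (forall P, 0 <= f P <= 1) -> exists z, acts_as z (fun P => (f P)%:C).
Proof.
move=> cf f01.
have [L hL] := choice (fun a => dauns_hofmann_elt a cf f01).
have eqP0 a b : (forall P, prim_ideal P (a - b)) -> a = b.
  by move=> h; apply/eqP; rewrite -subr_eq0; apply/eqP/prim_eq0.
have dc : double_centralizer (L, L).
  have lin : linear L.
    move=> k a b; apply: eqP0 => P; have idP := prim_ideal_closed_ideal P.
    have h := closed_idealB idP (hL (k *: a + b) P) (closed_idealP idP k (hL a P) (hL b P)).
    by apply: (eq_ind _ (prim_ideal P) h); lmod.
  have bdd : bounded_operator L.
    apply: (@bounded_operatorP _ _ _ 1) => // a; rewrite mul1r.
    apply: nrm_le_prim => [|P]; first exact: nrm_ge0.
    have idP := prim_ideal_closed_ideal P.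
    rewrite (le_trans (qn_le _ (closed_idealN idP (hL a P))))//.
    rewrite opprB addrC subrK nrmZ cabsR.
    by case/andP: (f01 P) => f0 f1; rewrite ger0_norm// ler_piMl ?nrm_ge0.
  split => //=.
  - move=> a b; apply: eqP0 => P; have idP := prim_ideal_closed_ideal P.
    have h := closed_idealB idP (hL (a ** b) P) (closed_idealMr idP b (hL a P)).
    by apply: (eq_ind _ (prim_ideal P) h); rewrite !smulE; lmod.
  - move=> a b; apply: eqP0 => P; have idP := prim_ideal_closed_ideal P.
    have h := closed_idealB idP (hL (a ** b) P) (closed_idealMl idP a (hL b P)).
    by apply: (eq_ind _ (prim_ideal P) h); rewrite !smulE; lmod.
  - move=> a b; apply: eqP0 => P; have idP := prim_ideal_closed_ideal P.
    have h := closed_idealB idP (closed_idealMr idP b (hL a P)) (closed_idealMl idP a (hL b P)).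
    by apply: (eq_ind _ (prim_ideal P) h); rewrite !smulE; lmod.
by exists (mult_of_dc dc).
Qed.

End dauns_hofmann.

(** * The base map on the primitive ideals of the multiplier algebra *)

Lemma ptws_eval_continuous (I : Type) (T : topologicalType) (i : I) :
  continuous (fun F : {ptws I -> T} => F i).
Proof.
move=> F; have /cvg_sup/(_ i) c : F --> F by exact: cvg_id.
apply: cvg_trans; last exact: (@initial_continuous _ _ (fun F : I -> T => F i)).
by apply: cvg_app; exact: c.
Qed.

Section topology.
Variables (R : realType) (X : topologicalType).
Implicit Types (f g : X -> R).

Lemma continuous_subr f g : continuous f -> continuous g -> continuous (fun y => f y - g y).
Proof. by move=> cf cg y; exact: (@cvgB _ _ _ (nbhs y) _ f g _ _ (cf y) (cg y)). Qed.

Lemma bump_function (x : X) (U : set X) : locally_compact [set: X] -> hausdorff_space X ->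
  nbhs x U -> exists g : X -> R, [/\ continuous g, forall y, 0 <= g y <= 1, g x = 1,
    forall y, ~ U y -> g y = 0 & forall e, 0 < e -> compact [set y | e <= g y]].
Proof.
move=> lc hX xU; have [K] := lc x I; rewrite withinET => Kx [cK clK].
have [||f [cf f01 f0 f1]] := iffLR (@uniform_separatorP X R _ _)
    (@locally_compact_completely_regular X R lc hX x (~` (U `&` K)^°) _ _).
- exact/open_closedC/open_interior.
- by move=> h; apply: h; apply: filterI.
have f01' y : 0 <= f y <= 1 by have := f01 (f y) (ex_intro2 _ _ y I erefl); rewrite /= in_itv.
have fU y : ~ (U `&` K) y -> f y = 1.
  by move=> nU; apply: (f1 (f y)); exists y => // /interior_subset.
have cg : continuous (fun y => 1 - f y : R) by apply: continuous_subr => // y; exact: cvg_cst.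
exists (fun y => 1 - f y); split => //.
- by move=> y; have := f01' y; lra.
- by rewrite (f0 (f x)) ?subr0//; exists x.
- by move=> y nU; rewrite fU ?subrr// => -[].
- move=> e e0; apply: (subclosed_compact _ cK).
    apply: (@preimage_closed _ _ (fun y => 1 - f y : R) [set r | e <= r]) => [y _|].
      exact: cg.
    exact: closed_ge.
  move=> y /=; apply: contraPP => nK.
  by rewrite fU; [lra|case].
Qed.

Lemma stone_cech_incl_inj : locally_compact [set: X] -> hausdorff_space X ->
  injective (@stone_cech_incl R X).
Proof.
move=> lc hX x y xy; apply: contrapT => nxy.
have [|g [cg g01 gx gU _]] := @bump_function x (~` [set y]) lc hX.
  apply: open_nbhs_nbhs; split => //; apply: closed_openC.
  exact/accessible_closed_set1/hausdorff_accessible.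
have := congr1 (fun z => (set_val z : {ptws unit_function R X -> R})
  (exist _ g (conj cg g01))) xy.
rewrite /=; change (g x = g y -> False); rewrite gx gU; last by move=> h; apply: h.
by move/eqP; rewrite oner_eq0.
Qed.

Lemma stone_cech_coord_continuous (h : unit_function R X) :
  continuous (fun w : stone_cech R X => (set_val w : {ptws unit_function R X -> R}) h).
Proof.
move=> w; apply: (@continuous_comp _ _ _ set_val (fun F : {ptws unit_function R X -> R} => F h)).
  exact: initial_continuous.
exact: ptws_eval_continuous.
Qed.

End topology.

Section strict.
Variables (R : realType) (A : cstarAlgType R).
Implicit Types (a b : A) (m : multiplier A) (J : set A).

Lemma strict_mulL_continuous a :
  continuous (fun m : strict_topology A => mulL m a : A).
Proof.
move=> m; apply: (@continuous_comp (strict_topology A) ({ptws A -> A} * {ptws A -> A})%type A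
  (fun m => (mulL m, mulR m)) (fun F => F.1 a)).
  exact: initial_continuous.
apply: (@continuous_comp ({ptws A -> A} * {ptws A -> A})%type {ptws A -> A} A fst (fun F => F a)).
  exact: cvg_fst.
exact: ptws_eval_continuous.
Qed.

Lemma strict_mulR_continuous a :
  continuous (fun m : strict_topology A => mulR m a : A).
Proof.
move=> m; apply: (@continuous_comp (strict_topology A) ({ptws A -> A} * {ptws A -> A})%type A
  (fun m => (mulL m, mulR m)) (fun F => F.2 a)).
  exact: initial_continuous.
apply: (@continuous_comp ({ptws A -> A} * {ptws A -> A})%type {ptws A -> A} A snd (fun F => F a)).
  exact: cvg_snd.
exact: ptws_eval_continuous.
Qed.

Lemma strict_cvg (m_ : nat -> multiplier A) m :
  (forall a, (fun n => mulL (m_ n) a) @ \oo --> mulL m a) ->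
  (forall a, (fun n => mulR (m_ n) a) @ \oo --> mulR m a) ->
  m_ @ \oo --> (m : strict_topology A).
Proof.
move=> hL hR U /= [_ [[W oW <-] Wm]] sub; apply: filterS sub _.
pose F m := ((mulL m : {ptws A -> A}), (mulR m : {ptws A -> A})).
have cL : (fun n => mulL (m_ n) : {ptws A -> A}) @ \oo --> (mulL m : {ptws A -> A}).
  by apply/pointwise_cvgP => a; exact: hL.
have cR : (fun n => mulR (m_ n) : {ptws A -> A}) @ \oo --> (mulR m : {ptws A -> A}).
  by apply/pointwise_cvgP => a; exact: hR.
have nW : nbhs ((mulL m, mulR m) : {ptws A -> A} * {ptws A -> A}) W by exact: open_nbhs_nbhs.
exact: (cvg_pair cL cR nW).
Qed.

Lemma tilde_strictly_closed J : closed J -> strictly_closed (mult_tilde J).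
Proof.
move=> clJ; rewrite /strictly_closed.
have -> : mult_tilde J = \bigcap_a ([set m : strict_topology A | J (mulL m a)] `&`
    [set m : strict_topology A | J (mulR m a)]).
  apply/seteqP; split => m h a; first by move=> _; exact: (h a).
  exact: (h a).
apply: closed_bigI => a _; apply: closedI.
  by apply: (@preimage_closed _ _ (fun m : strict_topology A => mulL m a : A) J) =>
    [m _|//]; exact: strict_mulL_continuous.
by apply: (@preimage_closed _ _ (fun m : strict_topology A => mulR m a : A) J) =>
  [m _|//]; exact: strict_mulR_continuous.
Qed.

End strict.

Section ideals.
Variables (R : realType) (B : starAlgType R[i]).

Lemma prim_idealZD (Q : Prim B) k a b :
  prim_ideal Q a -> prim_ideal Q b -> prim_ideal Q (k *: a + b).
Proof.
case: (prim_idealP Q) => H [ip [pi [rp ->]]] /= ha hb u.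
by rewrite (repD rp) (repZ rp) ha hb scaler0 addr0.
Qed.

Lemma prim_ideal0 (Q : Prim B) : prim_ideal Q 0.
Proof.
case: (prim_idealP Q) => H [ip [pi [rp ->]]] /= u.
by rewrite -(scale0r 0) (repZ rp) scale0r.
Qed.

End ideals.

Section tilde.
Variables (R : realType) (A : cstarAlgType R).
Implicit Types (m n : multiplier A).

Lemma mult_tildeM (J : set A) m n : closed_ideal J -> mult_tilde J m -> mult_tilde J (m ** n).
Proof.
move=> idJ h a; split; first by rewrite mulLM; exact: (h _).1.
by rewrite mulRM; apply: (ideal_mulR idJ); exact: (h _).2.
Qed.

End tilde.

Section base_map.
Variables (R : realType) (A : cstarAlgType R) (X : topologicalType) (phi : Prim A -> X)
  (phibar : Prim (multiplier A) -> stone_cech R X).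
Hypotheses (lcX : locally_compact [set: X]) (hX : hausdorff_space X)
  (ext : is_extension phi phibar) (sA : sigma_unital A).
Implicit Types (P : Prim A) (Q : Prim (multiplier A)) (a b : A) (m : multiplier A) (x : X).
Local Notation iota := (stone_cech_incl R).

Lemma fiber_ideal_closed_ideal x : closed_ideal (fiber_ideal phi x).
Proof. exact: ker_of_closed_ideal. Qed.

(** Let [I] be the multipliers that vanish over [V], and [K] the kernel of the primitive ideals of
    $M(A)$ not over [V]. Each [P] lies over [V], or its tilde is one of the latter ideals, so the
    product of [I] and [K] is 0. By primeness [Q] contains [I] or [K], and [K] would put [Q] outside
    an open set containing it. *)
Lemma prim_mult_local (V : set (stone_cech R X)) Q m : open V -> V (phibar Q) ->
  (forall P, V (iota (phi P)) -> mult_tilde (prim_ideal P) m) -> prim_ideal Q m.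
Proof.
move=> oV VQ hm; pose U := phibar @^-1` V.
have oU : open U by apply: open_comp => // P _; exact: ext.1.
pose I := [set m | forall P, V (iota (phi P)) -> mult_tilde (prim_ideal P) m].
have [||h|h] := @prim_ideal_prime _ _ Q I (ker_of (~` U)).
- move=> n n' h P VP; apply: mult_tildeM; [exact: prim_ideal_closed_ideal|exact: h].
- move=> n k hn hk; suff -> : n ** k = 0 by exact: prim_ideal0.
  apply: mult_extL => a; apply: prim_eq0 => P; rewrite mulLM.
  have [VP|nVP] := pselect (V (iota (phi P))); first exact: (hn P VP _).1.
  have [Q' hQ'] := tilde_prim P sA; apply: (ideal_mulL (prim_ideal_closed_ideal P)).
  have : prim_ideal Q' k by apply: hk; rewrite /U /= /preimage/= (ext.2 _ _ hQ').
  by rewrite hQ' => /(_ a)[].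
- exact: h.
- by have := closed_hull (open_closedC oU) h; case.
Qed.

(** A [Q] that does not contain $A$ is the tilde of its trace [P] on $A$, and then [phi P = x]
    because $X$ embeds in its compactification. *)
Lemma prim_fiber_incl x Q a : phibar Q = iota x -> fiber_ideal phi x a ->
  prim_ideal Q (mult_incl a).
Proof.
move=> Qx xa; apply: contrapT => nQa.
have Qlr := @prim_ideal_lr _ _ Q.
case: (prim_idealP Q) => H [ip [pi [rp QE]]].
have pi_nz : exists b u, pi (mult_incl b) u != 0.
  apply: contrapT => hn; apply: nQa; rewrite QE => u; apply/eqP; apply: contrapT => nz.
  by apply: hn; exists a, u; apply/negP.
have prP : primitive_ideal [set b | forall u, pi (mult_incl b) u = 0].
  by exists H, ip, (fun b => pi (mult_incl b)); split => //; exact: restrict_irreducible.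
pose P := PrimIdeal prP.
have PE b : prim_ideal P b <-> prim_ideal Q (mult_incl b) by rewrite QE.
have QP : prim_ideal Q = mult_tilde (prim_ideal P).
  apply/seteqP; split => m.
    move=> Qm b; rewrite !PE -mulL_mult_incl -mulR_mult_incl.
    by have [] := Qlr m (mult_incl b) Qm.
  move=> hm; have [||h|h] := @prim_ideal_prime _ _ Q (mult_tilde (prim_ideal P))
    (range (@mult_incl R A)).
  - by move=> n n' hn; apply: mult_tildeM => //; exact: prim_ideal_closed_ideal.
  - by move=> n _ hn [b _ <-]; rewrite mulL_mult_incl -PE; have [] := hn b.
  - exact: h.
  - by case: nQa; apply: h; exists a.
have := ext.2 _ _ QP; rewrite Qx => /(stone_cech_incl_inj lcX hX) xP.
by apply: nQa; rewrite -PE; apply: xa.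
Qed.

Lemma mult_fiber_sub_tilde x : mult_fiber_ideal phibar x `<=` mult_tilde (fiber_ideal phi x).
Proof.
move=> m hm a; split=> P Px; have [Q hQ] := tilde_prim P sA;
  have : prim_ideal Q m by apply: hm; rewrite /= (ext.2 _ _ hQ) Px.
all: by rewrite hQ => /(_ a)[].
Qed.

(** For [m] in $\tilde J_x$ the elements [m ** mult_incl (u n)] come from $J_x$, hence lie in $H_x$,
    and they converge strictly to [m]. *)
Lemma strictly_closed_mult_fiberP x : strictly_closed (mult_fiber_ideal phibar x) <->
  mult_tilde (fiber_ideal phi x) `<=` mult_fiber_ideal phibar x.
Proof.
have idx := fiber_ideal_closed_ideal x; split=> [cl m hm|sub].
  have [u [_ u1 _ ua au]] := sigma_unitalP sA.
  have c : (fun n => m ** mult_incl (u n)) @ \oo --> (m : strict_topology A).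
    apply: strict_cvg => a; apply/cvg_nrm => e e0.
      have [N hN] := ua a _ (divr_gt0 e0 (ltr_wpDl (csn_ge0 (@opn_csn R A) m) ltr01)).
      exists N => n Nn; rewrite mulLM -mulLBr (le_trans (opn_le _ _))//.
      have h0 := csn_ge0 (@opn_csn R A) m; have h1 : 0 < opn m + 1 by rewrite ltr_wpDl.
      have := hN n Nn; rewrite ler_pdivlMr// mulL_incl; have := nrm_ge0 (u n ** a - a); nra.
    have [N hN] := au (mulR m a) _ e0.
    by exists N => n Nn; rewrite mulRM mulR_incl; exact: hN.
  apply: (@closed_cvg _ (strict_topology A) \oo _ _ (mult_fiber_ideal phibar x) cl _ m c).
  exists 0 => // n _ Q hQ.
  rewrite mulL_mult_incl; apply: (prim_fiber_incl hQ); exact: (hm _).1.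
have -> : mult_fiber_ideal phibar x = mult_tilde (fiber_ideal phi x).
  by apply/seteqP; split => //; exact: mult_fiber_sub_tilde.
exact: tilde_strictly_closed (closed_ideal_closed idx).
Qed.

End base_map.

(** * Real functions and P-points *)

Section real_functions.
Variables (R : realType) (T : topologicalType).
Implicit Types (f g h : T -> R).

Lemma near_dist f y (e : R) : continuous f -> 0 < e -> \forall z \near y, `|f y - f z| < e.
Proof. by move=> cf e0; have /cvgrPdist_lt := cf y; apply. Qed.

Lemma dist_continuous f g h (C : R) : continuous f -> continuous g ->
  (forall y z, `|h y - h z| <= C * (`|f y - f z| + `|g y - g z|)) -> continuous h.
Proof.
move=> cf cg hC y; apply/cvgrPdist_lt => e e0.
have c1 : 0 < `|C| + 1 by rewrite ltr_wpDl.
have d0 : 0 < e / (`|C| + 1) / 2 by rewrite !divr_gt0.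
apply: filterS2 (near_dist y cf d0) (near_dist y cg d0) => z h1 h2.
apply: (le_lt_trans (hC y z)).
have h3 : `|f y - f z| + `|g y - g z| < e / (`|C| + 1) by lra.
move: h3; rewrite ltr_pdivlMr//; have := ler_norm C.
have := normr_ge0 (f y - f z); have := normr_ge0 (g y - g z).
move: (`|f y - f z|) (`|g y - g z|) (`|C|) (normr_ge0 C) => p q r; nra.
Qed.

Lemma dist_continuous1 f h (C : R) : continuous f ->
  (forall y z, `|h y - h z| <= C * `|f y - f z|) -> continuous h.
Proof.
move=> cf hC; apply: (@dist_continuous f (fun=> 0) h C cf) => [y|y z]; first exact: cvg_cst.
by rewrite subrr normr0 addr0.
Qed.

Definition clamp (r : R) : R := Num.min 1 (Num.max 0 r).

Lemma clamp01 r : 0 <= clamp r <= 1.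
Proof. by rewrite /clamp ge_min lexx le_min ler01 le_max lexx. Qed.

Lemma clamp_le0 r : r <= 0 -> clamp r = 0.
Proof. by move=> r0; rewrite /clamp (max_l r0) min_r. Qed.

Lemma clamp_ge1 r : 1 <= r -> clamp r = 1.
Proof. by move=> r1; rewrite /clamp max_r ?min_l// (le_trans ler01). Qed.

Lemma maxr_dist (a b c d : R) : `|Num.max a b - Num.max c d| <= `|a - c| + `|b - d|.
Proof.
have := ler_norm (a - c); have := ler_norm (- (a - c)).
have := ler_norm (b - d); have := ler_norm (- (b - d)); rewrite !normrN.
rewrite ler_norml; case: (leP a b) => h1; case: (leP c d) => h2; lra.
Qed.

Lemma clamp_dist r s : `|clamp r - clamp s| <= `|r - s|.
Proof.
have := maxr_dist 0 r 0 s; rewrite subrr normr0 add0r; apply: le_trans.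
rewrite /clamp; move: (Num.max 0 r) (Num.max 0 s) => u v.
have := ler_norm (u - v); have := ler_norm (- (u - v)); rewrite normrN.
by rewrite ler_norml; case: (leP 1 u) => h1; case: (leP 1 v) => h2; lra.
Qed.

Lemma near_bounded (F : set_system T) (FF : Filter F) (S : nat -> set T) N :
  (forall n, F (S n)) -> F [set z | forall n, (n < N)%N -> S n z].
Proof.
move=> FS; elim: N => [|N IH]; first by apply: filterS filterT.
apply: filterS2 IH (FS N) => z h hN n; rewrite ltnS leq_eqVlt => /orP[/eqP->//|].
exact: h.
Qed.

(** The functions vanish together exactly where the supremum over [n] of [min (f n) (1 / (n + 1))]
    does. The truncation makes it continuous, since only finitely many terms can exceed a given
    [e]. *)
Lemma P_point_bigcap (x : T) (f : nat -> T -> R) : P_point R x ->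
  (forall n, continuous (f n)) -> (forall n, f n x = 0) -> (forall n y, 0 <= f n y) ->
  \forall y \near x, forall n, f n y = 0.
Proof.
move=> px cf fx f0.
pose r (n : nat) : R := n.+1%:R^-1; have r0 n : 0 < r n by rewrite invr_gt0.
pose S y := [set Num.min (f n y) (r n) | n in [set: nat]].
have S_ub y : has_ubound (S y).
  exists 1 => _ [n _ <-]; rewrite ge_min; apply/orP; right.
  by rewrite invf_le1// ler1n.
have S_le y n : Num.min (f n y) (r n) <= sup (S y) by apply: ub_le_sup => //; exists n.
have S_lub y k : (forall n, Num.min (f n y) (r n) <= k) -> sup (S y) <= k.
  by move=> h; apply: ge_sup; [exists (Num.min (f 0%N y) (r 0%N)), 0%N|move=> _ [n _ <-]].
have S0 y : 0 <= sup (S y) by rewrite (le_trans _ (S_le y 0%N))// le_min f0 ltW.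
have cS : continuous (fun y => sup (S y)).
  move=> y; apply/cvgrPdist_le => e e0; have [N hN] := inv_nat_small e0.
  have := near_bounded (nbhs_filter y) N.+2 (fun n => near_dist y (cf n) e0).
  apply: filterS => z hz.
  have key a b : (forall n, (n < N.+2)%N -> `|f n a - f n b| < e) -> sup (S a) <= sup (S b) + e.
    move=> hab; apply: S_lub => n; have [nN|Nn] := ltnP n N.+2.
      have := S_le b n; have := hab n nN; have := ler_norm (f n a - f n b).
      by case: (leP (f n a) (r n)); case: (leP (f n b) (r n)); lra.
    have : r n <= e.
      case: n Nn => // n Nn; apply: le_trans (hN n (ltnW Nn)).
      by rewrite /r -[X in X <= _]mul1r ler_pM2r ?invr_gt0// ler1n.
    have := S0 b; case: (leP (f n a) (r n)); lra.
  rewrite ler_norml; have := key y z hz; have := key z y.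
  have hz' n : (n < N.+2)%N -> `|f n z - f n y| < e by move=> /hz; rewrite distrC.
  by move=> /(_ hz'); lra.
have : \forall y \near x, sup (S y) = 0.
  by apply: px => //; apply/le_anti; rewrite S0 andbT; apply: S_lub => n; rewrite fx ge_min lexx.
apply: filterS => y hy n; have := S_le y n; rewrite hy ge_min (leNgt (r n)) r0 orbF => h.
by apply/le_anti; rewrite h f0.
Qed.

End real_functions.

(** * Calculus of central multipliers *)

Section acts_as.
Variables (R : realType) (A : cstarAlgType R).
Implicit Types (a b : A) (m z w : multiplier A) (P : Prim A) (f g : Prim A -> R[i]).

Lemma closed_ideal_star (I : set A) a : closed_ideal I -> I a -> I (star a).
Proof. by move=> idI h; apply: (qn_eq0 idI); rewrite (csn_star (qn_csn idI)) (qn_mem idI). Qed.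

Lemma central_mulL_mulR z a : mult_center z -> mulL z a = mulR z a.
Proof. by move=> cz; apply: mult_incl_inj; rewrite -mulL_mult_incl -mulR_mult_incl cz. Qed.

Lemma acts_asM z w f g : acts_as z f -> acts_as w g -> acts_as (z ** w) (fun P => f P * g P).
Proof.
move=> hz hw a P; have idP := prim_ideal_closed_ideal P.
have h := closed_idealP idP (g P) (hz a P) (ideal_mulL idP z (hw a P)).
apply: (eq_ind _ (prim_ideal P) h); rewrite mulLM mulLBr mulLZr; lmod.
Qed.

Lemma acts_asZD k z w f g : acts_as z f -> acts_as w g ->
  acts_as (k *: z + w) (fun P => k * f P + g P).
Proof.
move=> hz hw a P; have idP := prim_ideal_closed_ideal P.
have h := closed_idealP idP k (hz a P) (hw a P).
apply: (eq_ind _ (prim_ideal P) h); rewrite mulLD mulLZ; lmod.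
Qed.

Lemma acts_as_one : acts_as (mult_one A) (fun=> 1).
Proof. by move=> a P; rewrite scale1r subrr; exact: closed_ideal0 (prim_ideal_closed_ideal P). Qed.

Lemma acts_as_star z f : acts_as z f -> acts_as (star z) (fun P => (f P)^*%R).
Proof.
move=> hz a P; have := closed_ideal_star (prim_ideal_closed_ideal P) (hz (star a) P).
rewrite mulL_star -(central_mulL_mulR _ (acts_as_central hz)).
by rewrite starB starZ starK.
Qed.

Lemma acts_as_tilde z f P : acts_as z f -> f P = 0 -> mult_tilde (prim_ideal P) z.
Proof.
move=> hz fP a; rewrite -(central_mulL_mulR _ (acts_as_central hz)).
by have := hz a P; rewrite fP scale0r subr0.
Qed.

End acts_as.

(** * The two sufficient conditions *)

Section local.
Variables (R : realType) (A : cstarAlgType R) (X : topologicalType) (phi : Prim A -> X)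
  (phibar : Prim (multiplier A) -> stone_cech R X).
Hypotheses (lcX : locally_compact [set: X]) (hX : hausdorff_space X) (cphi : continuous phi)
  (ext : is_extension phi phibar) (sA : sigma_unital A).
Implicit Types (P : Prim A) (Q : Prim (multiplier A)) (a b : A) (m z : multiplier A) (x y : X).
Local Notation iota := (stone_cech_incl R).
Local Notation J := (fiber_ideal phi).

Definition base_corestrict P : base_image phi := SigSub (mem_set (imageT phi P)).

Lemma base_corestrict_continuous : continuous base_corestrict.
Proof. by apply: continuous_comp_initial; exact: cphi. Qed.

Lemma set_val_base_continuous : continuous (set_val : base_image phi -> X).
Proof. exact: initial_continuous. Qed.

Lemma base_multiplier (k : base_image phi -> R) : continuous k ->
  (forall y : base_image phi, 0 <= k y <= 1) ->
  exists z, acts_as z (fun P => (k (base_corestrict P))%:C).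
Proof.
move=> ck k01; apply: (dauns_hofmann_exists (f := k \o base_corestrict)) => [P|P]; last exact: k01.
by apply: continuous_comp; [exact: base_corestrict_continuous|exact: ck].
Qed.

Lemma base_multiplierX (k : X -> R) : continuous k ->
  (forall y, 0 <= k y <= 1) -> exists z, acts_as z (fun P => (k (phi P))%:C).
Proof.
move=> ck k01; apply: (dauns_hofmann_exists (f := k \o phi)) => [P|P]; last exact: k01.
by apply: continuous_comp; [exact: cphi|exact: ck].
Qed.

(** The positivity set of the coordinate of a bump function is open in the compactification, and its
    trace on $X$ lies in [U]. *)
Lemma prim_mult_near x (U : set X) Q m : nbhs x U -> phibar Q = iota x ->
  (forall P, U (phi P) -> mult_tilde (prim_ideal P) m) -> prim_ideal Q m.
Proof.
move=> xU Qx hm; have [g [cg g01 gx gU _]] := @bump_function R X x U lcX hX xU.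
pose h : unit_function R X := exist _ g (conj cg g01).
pose V := [set w : stone_cech R X | 0 < (set_val w : {ptws unit_function R X -> R}) h].
apply: (@prim_mult_local _ _ _ _ _ ext sA V).
- apply: (@open_comp _ _ (fun w : stone_cech R X =>
    (set_val w : {ptws unit_function R X -> R}) h) [set r | 0 < r]).
    by move=> w _; exact: stone_cech_coord_continuous.
  exact: open_gt.
- by rewrite /V Qx; change (0 < g x); rewrite gx ltr01.
- move=> P hP; apply: hm; apply: contrapT => /gU gP.
  by have : 0 < g (phi P) by [exact: hP]; rewrite gP ltxx.
Qed.

Lemma fiber_ideal_rep x a : ~ J x a -> exists2 P, phi P = x & ~ prim_ideal P a.
Proof.
move=> nJ; apply: contrapT => h; apply: nJ => P Px; apply: contrapT => nP.
by apply: h; exists P.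
Qed.

Lemma mult_fiber_mulr x Q (b : multiplier A) a : phibar Q = iota x -> mult_tilde (J x) b ->
  prim_ideal Q (b ** mult_incl a).
Proof.
move=> Qx hb; rewrite mulL_mult_incl; apply: (prim_fiber_incl lcX hX ext Qx).
exact: (hb a).1.
Qed.

Lemma continuous_cabs (f : X -> R[i]) : continuous (f : X -> R[i]^o) ->
  continuous (fun y => cabs (f y)).
Proof.
move=> cf y; apply/cvgrPdist_lt => e e0.
have /cvgrPdist_lt := cf y; move=> /(_ e%:C); rewrite ltcR => /(_ e0).
apply: filterS => z; rewrite cabsE ltcR; apply: le_lt_trans.
have := cabsD (f y - f z) (f z); have := cabsD (f z - f y) (f y).
by rewrite !subrK -(cabsN (f z - f y)) opprB ler_norml; lra.
Qed.

Lemma Zprime_acts x a : Zprime phi a -> ~ J x a -> exists f : X -> R[i],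
  [/\ continuous (f : X -> R[i]^o), acts_as (mult_incl a) (f \o phi) & f x != 0].
Proof.
move=> [f [cf _] fa] na; have [P Px nP] := fiber_ideal_rep na.
have idP := prim_ideal_closed_ideal P.
have act : acts_as (mult_incl a) (f \o phi).
  rewrite -fa; apply: dauns_hofmann_acts; rewrite fa; apply/eqP => a00; apply: na.
  have -> : a = 0 by apply: mult_incl_inj; rewrite a00 mult_incl0.
  exact: closed_ideal0 (fiber_ideal_closed_ideal phi x).
(* If [f x = 0], then [a ** star a] lies in [P], and the C*-identity puts [a] in [P]. *)
exists f; split => //; apply/eqP => fx; apply: nP; apply: (qn_eq0 idP); apply/eqP.
rewrite -(sqrf_eq0 (quotient_norm _ _)) -(csn_star (qn_csn idP)) -(csn_C (qn_csn idP)) starK.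
by rewrite (qn_mem idP) ?eqxx//; have := act (star a) P; rewrite /= Px fx scale0r subr0.
Qed.

Lemma Uphi_sub (x : base_image phi) : Uphi phi x ->
  mult_tilde (J (set_val x)) `<=` mult_fiber_ideal phibar (set_val x).
Proof.
move=> Ux; set x0 := set_val x.
have [a0 [Za na0]] : exists a0, Zprime phi a0 /\ ~ J x0 a0.
  by apply: contrapT => h; apply: Ux => a Za; apply: contrapT => nJ; apply: h; exists a.
have [f [cf act fx]] := Zprime_acts Za na0.
pose q y : R := cabs (f y) ^+ 2.
have qE y : (q y)%:C = (f y)^*%R * f y by rewrite mulrC -cabs_sqr.
have qx : 0 < q x0.
  rewrite exprn_gt0// lt_neqAle cabs_ge0 andbT eq_sym.
  by apply: contra fx => /eqP/cabs_eq0 ->.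
pose d := q x0 / 2; have d0 : 0 < d by rewrite divr_gt0.
have cq : continuous q.
  have cf' := continuous_cabs cf.
  by move=> y; exact: (@cvgM _ _ (nbhs y) _ _ _ _ _ (cf' y) (cf' y)).
(* [k * q] is constantly [d] where [q >= d], so [star a0 ** a0] cut by [k] acts there as the scalar
   [d]. *)
pose k y := d / Num.max d (q y).
have k01 y : 0 <= k y <= 1.
  have m0 : 0 < Num.max d (q y) by rewrite lt_max d0.
  by rewrite /k divr_ge0 ?(ltW d0) ?(ltW m0)//= ler_pdivrMr// mul1r le_max lexx.
have ck : continuous k.
  apply: (dist_continuous1 (f := q) (C := d^-1)) => // y z; rewrite /k.
  have := maxr_dist d (q y) d (q z); rewrite subrr normr0 add0r.
  have : d <= Num.max d (q y) by rewrite le_max lexx.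
  have : d <= Num.max d (q z) by rewrite le_max lexx.
  move: (Num.max d (q y)) (Num.max d (q z)) => u v dv du h.
  have u0 : 0 < u by apply: lt_le_trans du.
  have v0 : 0 < v by apply: lt_le_trans dv.
  have -> : d / u - d / v = (d / u) * (v^-1 * (v - u)) by field; rewrite !gt_eqF.
  have du0 : 0 <= d / u by rewrite divr_ge0// ltW.
  rewrite normrM (ger0_norm du0) normrM (@ger0_norm _ v^-1) ?invr_ge0 ?(ltW v0)//.
  have h1 : d / u <= 1 by rewrite ler_pdivrMr// mul1r.
  have h2 : v^-1 * `|v - u| <= d^-1 * `|q y - q z|.
    apply: ler_pM; rewrite ?invr_ge0 ?(ltW v0)//; first by rewrite lef_pV2.
    by rewrite distrC.
  by apply: le_trans h2; rewrite ler_piMl// mulr_ge0// invr_ge0 ltW.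
have [t ht] := base_multiplierX ck k01.
pose m := (- d%:C) *: mult_one A + t ** mult_incl (star a0 ** a0).
have hm : acts_as m (fun P => - d%:C * 1 + (k (phi P))%:C * ((f (phi P))^*%R * f (phi P))).
  rewrite /m mult_inclM mult_incl_star.
  exact: (acts_asZD (- d%:C) (@acts_as_one R A) (acts_asM ht (acts_asM (acts_as_star act) act))).
have xU : nbhs x0 [set y | d < q y].
  have qd : nbhs (q x0) [set r | d < r].
    by apply: open_nbhs_nbhs; split; [exact: open_gt|rewrite /= /d; lra].
  exact: (cq x0 _ qd).
move=> b hb Q Qx.
have Qm : prim_ideal Q m.
  apply: (prim_mult_near xU Qx) => P' /= hP'; apply: (acts_as_tilde hm).
  by rewrite -qE -rmorphM/= /k (max_r (ltW hP')) divfK ?gt_eqF ?(lt_trans d0)// mulr1 addrC subrr.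
have h1 : prim_ideal Q (b ** m) := (prim_ideal_lr b Qm).2.
have h2 : prim_ideal Q (b ** (t ** mult_incl (star a0 ** a0))).
  by rewrite (mulL_mult_incl t); exact: (mult_fiber_mulr _ Qx hb).
have h3 := prim_idealZD (- 1) h2 h1.
apply: (eq_ind _ (prim_ideal Q) (prim_idealZD (- d^-1)%:C h3 (prim_ideal0 Q))).
rewrite /m smulDr scale_smulr mult_mulr1.
have -> (v w : multiplier A) : -1 *: v + (- d%:C *: w + v) = (- d)%:C *: w by lmod.
by rewrite addr0 scalerA -rmorphM/= mulrNN mulVf ?scale1r// gt_eqF.
Qed.

Lemma P_point_sub (x : base_image phi) : continuous_C0_algebra phi -> P_point R x ->
  mult_tilde (J (set_val x)) `<=` mult_fiber_ideal phibar (set_val x).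
Proof.
move=> Acont px b hb Q Qx; have [u [_ u1 _ ua au]] := sigma_unitalP sA.
pose f n (y : base_image phi) : R := quotient_norm (J (set_val y)) (mulL b (u n)).
have idJ y := fiber_ideal_closed_ideal phi y.
have h : \forall y \near x, forall n, f n y = 0.
  apply: P_point_bigcap => // [n|n|n y].
  - move=> y; apply: (@continuous_comp _ _ _ set_val (fun y => quotient_norm (J y) (mulL b (u n)))).
      exact: set_val_base_continuous.
    exact: Acont.
  - by apply: (qn_mem (idJ _)); exact: (hb _).1.
  - exact: (qn_ge0 (idJ _)).
have [U xU hU] : exists2 U, nbhs (set_val x) U &
    forall y : base_image phi, U (set_val y) -> forall n, f n y = 0.
  case: h => _ [[V oV <-] Vx] sub; exists V => [|y Vy]; last exact: sub.
  exact: open_nbhs_nbhs.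
apply: (prim_mult_near xU Qx) => P UP.
have idP := prim_ideal_closed_ideal P.
have key n : prim_ideal P (mulL b (u n)).
  have := hU (base_corestrict P) UP n; move/(qn_eq0 (idJ _)); apply.
  by [].
have cl c (c_ : nat -> A) : (forall n, prim_ideal P (c_ n)) -> (forall e : R, 0 < e ->
    exists N, forall n, (N <= n)%N -> nrm (c_ n - c) <= e) -> prim_ideal P c.
  move=> hc /cvg_nrm hl; apply: (@closed_cvg _ _ \oo _ _ (prim_ideal P) _ _ c hl).
    exact: closed_ideal_closed idP.
  by exists 0.
move=> a; split.
  apply: (cl _ (fun n => mulL b (u n ** a))) => [n|e e0].
    by rewrite mulL_smul; exact: closed_idealMr.
  have b1 : 0 < opn b + 1 by rewrite ltr_wpDl ?(csn_ge0 (@opn_csn R A)).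
  have [N hN] := ua a _ (divr_gt0 e0 b1); exists N => n Nn.
  rewrite -mulLBr (le_trans (opn_le _ _))//.
  have := hN n Nn; rewrite ler_pdivlMr//; have := nrm_ge0 (u n ** a - a); lra.
apply: (cl _ (fun n => mulR b a ** u n)) => [n|e e0]; last exact: au.
by rewrite mulR_mulL; exact: closed_idealMl.
Qed.

End local.

(** * Upper limits of C*-seminorms *)

Section limsup_seminorm.
Variables (R : realType) (B : starAlgType R[i]) (T : topologicalType) (N : T -> B -> R)
  (nm : B -> R).
Hypotheses (csnN : forall y, cstar_seminorm (N y)) (N_le : forall y a, N y a <= nm a).
Implicit Types (a b : B) (x y : T) (k : R).

(** Neighbourhoods are not punctured: the value at [x] itself counts, which later gives the unit
    upper limit 1. *)
Definition limsup_at x a : R := inf [set k | 0 <= k /\ \forall y \near x, N y a <= k].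

Lemma limsup_at_le x a k : 0 <= k -> (\forall y \near x, N y a <= k) -> limsup_at x a <= k.
Proof.
by move=> k0 h; apply: ge_inf => //; exists 0 => r [].
Qed.

Let limsup_nonempty x a : [set k | 0 <= k /\ \forall y \near x, N y a <= k] !=set0.
Proof.
exists (nm a); split; first exact: le_trans (csn_ge0 (csnN x) a) (N_le x a).
by apply: nearW => y; exact: N_le.
Qed.

Lemma limsup_at_ge0 x a : 0 <= limsup_at x a.
Proof. by apply: lb_le_inf => [|k []]; first exact: limsup_nonempty. Qed.

Lemma limsup_at_near x a (e : R) : 0 < e -> \forall y \near x, N y a <= limsup_at x a + e.
Proof.
move=> e0.
have [|k [k0 hk] kle] := @inf_adherent _ [set k | 0 <= k /\ \forall y \near x, N y a <= k] e e0.
  by split; [exact: limsup_nonempty|exists 0 => r []].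
by apply: filterS hk => y /le_trans; apply; exact: ltW.
Qed.

Lemma limsup_at_bound x a : limsup_at x a <= nm a.
Proof.
apply: limsup_at_le; first exact: le_trans (csn_ge0 (csnN x) a) (N_le x a).
by apply: nearW => y; exact: N_le.
Qed.

Lemma limsup_at_self x a : N x a <= limsup_at x a.
Proof.
apply: (@le_eps _ _ _ 1) => e e0; rewrite mul1r.
exact: nbhs_singleton (limsup_at_near x a e0).
Qed.

Let limsup_atZ_le x (l : R[i]) a : limsup_at x (l *: a) <= cabs l * limsup_at x a.
Proof.
have p0 := limsup_at_ge0 x a; have l0 := cabs_ge0 l.
apply: (@le_eps _ _ _ (cabs l)) => e e0; rewrite -mulrDr.
apply: limsup_at_le; first by rewrite mulr_ge0 ?addr_ge0// ltW.
by apply: filterS (limsup_at_near x a e0) => y h; rewrite (csn_Z (csnN y)) ler_wpM2l.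
Qed.

Lemma limsup_at_csn x : cstar_seminorm (limsup_at x).
Proof.
split.
- move=> a b; have p0 := limsup_at_ge0 x; apply: (@le_eps _ _ _ 2) => e e0.
  apply: limsup_at_le; first by rewrite !addr_ge0// mulr_ge0// ltW.
  apply: filterS2 (limsup_at_near x a e0) (limsup_at_near x b e0) => y h1 h2.
  by rewrite (le_trans (csn_D (csnN y) _ _))//; lra.
- move=> l a; apply/le_anti; rewrite limsup_atZ_le//=.
  have [->|l0] := eqVneq l 0; first by rewrite cabs0 mul0r limsup_at_ge0.
  have := limsup_atZ_le x l^-1 (l *: a); rewrite scalerA mulVf// scale1r => h.
  rewrite (le_trans (ler_wpM2l (cabs_ge0 l) h))// mulrA -cabsM mulfV//.
  by rewrite -[1]/(1%:C) cabsR normr1 mul1r.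
- move=> a b; have p0 := limsup_at_ge0 x.
  apply: (@le_eps _ _ _ (limsup_at x a + limsup_at x b + 1)) => e' e0'.
  (* Capping at 1 bounds the term [e ^+ 2] of the product by [e], whence the summand 1 in the
     constant. *)
  pose e := Num.min e' 1; have e0 : 0 < e by rewrite lt_min e0' ltr01.
  have e1 : e <= 1 by rewrite ge_min lexx orbT.
  have ee : e <= e' by rewrite ge_min lexx.
  have pa := p0 a; have pb := p0 b.
  apply: limsup_at_le; first by rewrite addr_ge0 ?mulr_ge0 ?addr_ge0// ltW.
  apply: filterS2 (limsup_at_near x a e0) (limsup_at_near x b e0) => y h1 h2.
  rewrite (le_trans (csn_M (csnN y) _ _))//.
  have : N y a * N y b <= (limsup_at x a + e) * (limsup_at x b + e).
    by apply: ler_pM => //; exact: csn_ge0 (csnN y) _.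
  move: (limsup_at x a) (limsup_at x b) pa pb => p q hp hq; clearbody e; nra.
- move=> a; have p0 := limsup_at_ge0 x; apply: (@le_eps _ _ _ 1) => e e0; rewrite mul1r.
  have s0 : 0 <= limsup_at x (star a ** a) + e by rewrite addr_ge0// ltW.
  rewrite -[leRHS]sqr_sqrtr// lerXn2r ?nnegrE ?sqrtr_ge0//.
  apply: limsup_at_le; first exact: sqrtr_ge0.
  apply: filterS (limsup_at_near x (star a ** a) e0) => y h.
  rewrite -(@ger0_norm _ (N y a)) ?(csn_ge0 (csnN y))// -sqrtr_sqr ler_sqrt//.
  exact: le_trans (csn_C_le (csnN y) a) h.
Qed.

End limsup_seminorm.

(** * Fibre norms and the ideal $H_x$ *)

Section fiber_norm.
Variables (R : realType) (A : cstarAlgType R) (X : topologicalType) (phi : Prim A -> X)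
  (phibar : Prim (multiplier A) -> stone_cech R X).
Hypotheses (lcX : locally_compact [set: X]) (hX : hausdorff_space X) (cphi : continuous phi)
  (ext : is_extension phi phibar) (sA : sigma_unital A).
Implicit Types (P : Prim A) (Q : Prim (multiplier A)) (a b : A) (m z : multiplier A) (x y : X).
Local Notation iota := (stone_cech_incl R).
Local Notation J := (fiber_ideal phi).

(** Off $X_\phi$ the ideal is $A$ and the seminorm is 0, so upper limits taken in $X$ only see
    $X_\phi$. *)
Definition fiber_norm y : multiplier A -> R := mult_norm (quotient_norm (J y)).

Let idJ y := fiber_ideal_closed_ideal phi y.

Lemma fiber_norm_csn y : cstar_seminorm (fiber_norm y).
Proof. exact: (mult_norm_csn (qn_csn (idJ y)) (qn_bounded (idJ y))). Qed.

Lemma fiber_norm_le y m : fiber_norm y m <= opn m.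
Proof.
apply: mult_norm_ub => [|a]; first exact: csn_ge0 (@opn_csn R A) m.
exact: qn_mulL.
Qed.

Lemma fiber_norm_one y : range phi y -> fiber_norm y (mult_one A) = 1.
Proof.
case=> P _ Py; have [a na] := prim_ideal_proper P.
apply: (mult_norm_one (qn_csn (idJ y)) (qn_bounded (idJ y)) (a := a)).
by apply/eqP => /(qn_eq0 (idJ y))/(_ P Py).
Qed.

Lemma fiber_norm_eq0 y m : (forall a, J y (mulL m a)) -> fiber_norm y m = 0.
Proof.
move=> h; apply/le_anti; rewrite (csn_ge0 (fiber_norm_csn y)) andbT.
by apply: mult_norm_ub => // a; rewrite mul0r (qn_mem (idJ y)).
Qed.

Definition fiber_limsup x : multiplier A -> R := limsup_at fiber_norm x.

Lemma fiber_limsup_csn x : cstar_seminorm (fiber_limsup x).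
Proof. exact: limsup_at_csn fiber_norm_csn fiber_norm_le x. Qed.

Lemma fiber_limsup_le x m : fiber_limsup x m <= opn m.
Proof. exact: limsup_at_bound fiber_norm_csn fiber_norm_le x m. Qed.

Lemma fiber_limsup_one x : range phi x -> fiber_limsup x (mult_one A) = 1.
Proof.
move=> rx; apply/le_anti/andP; split.
  exact: (csn_one_le (@mult_mulr1 R A) (fiber_limsup_csn x)).
by rewrite -(fiber_norm_one rx); exact: (limsup_at_self fiber_norm_csn fiber_norm_le).
Qed.

(** Let [Q] be the kernel of a representation that attains the upper limit at [m]. If [Q] lies over
    [x], it contains [m]. Otherwise a function that is 0 near [x] and 1 near [phibar Q] gives a
    central [z] with [z] in [Q] because its upper limit is 0, and [1 - z] in [Q] by
    [prim_mult_local], which is absurd. *)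
Lemma mult_fiber_limsup x m : range phi x -> mult_fiber_ideal phibar x m ->
  fiber_limsup x m = 0.
Proof.
move=> rx hm; have csn := fiber_limsup_csn x.
apply/eqP; apply: contrapT => nz.
have [H [ip [pi [rp contr [xi _ hxi]]]]] := exists_irreducible_rep (@mult_mul1 R A)
  (@mult_mulr1 R A) (@opn_csn R A) (@opn_eq0 R A) (@opn_complete R A)
  csn (fiber_limsup_le x) (fiber_limsup_one rx) m.
pose Q := PrimIdeal (ex_intro _ H (ex_intro _ ip (ex_intro _ pi (conj rp erefl)))).
have [Qx|nQx] := pselect (phibar Q = iota x).
  have /= Qm := hm _ Qx; move: hxi; rewrite Qm nrm0 => h; apply: nz.
  by rewrite eq_le h (csn_ge0 csn).
pose coord (w : stone_cech R X) : {ptws unit_function R X -> R} := set_val w.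
have [h nh] : exists h, coord (phibar Q) h <> sval h x.
  apply: contrapT => hn; apply: nQx; apply: val_inj; apply/funext => h /=.
  by apply: contrapT => nh; apply: hn; exists h.
(* The function [g] below is 0 within [d] of [c] and 1 beyond [2 * d]; [phibar Q] sits at
   [3 * d]. *)
set c := sval h x in nh; pose d := `|coord (phibar Q) h - c| / 3.
have d0 : 0 < d by rewrite divr_gt0// normr_gt0 subr_eq0; exact/eqP.
have ch : continuous (sval h) := (svalP h).1.
pose g y := clamp (`|sval h y - c| / d - 1).
have cg : continuous g.
  apply: (dist_continuous1 (f := sval h) (C := d^-1)) => // y y'.
  rewrite (le_trans (clamp_dist _ _))// opprB addrA subrK -mulrBl normrM.
  rewrite (@ger0_norm _ d^-1) ?invr_ge0 ?(ltW d0)// mulrC ler_wpM2l ?invr_ge0 ?(ltW d0)//.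
  by rewrite (le_trans (ler_dist_dist _ _))// opprB addrA subrK.
have [z hz] := base_multiplierX cphi cg (fun y => clamp01 _).
have pz : fiber_limsup x z = 0.
  apply/le_anti; rewrite (csn_ge0 csn) andbT; apply: limsup_at_le => //.
  apply: filterS (near_dist x ch d0) => y hy; rewrite fiber_norm_eq0// => a P Py.
  have := hz a P; rewrite Py /g clamp_le0 ?scale0r ?subr0// subr_le0 ler_pdivrMr// mul1r.
  by rewrite distrC ltW.
have Qz : prim_ideal Q z.
  by move=> v; apply/nrm_eq0/le_anti; rewrite nrm_ge0 andbT (le_trans (contr _ _))// pz mul0r.
have Qz1 : prim_ideal Q (-1 *: z + mult_one A).
  pose V := [set w : stone_cech R X | 2 * d < `|coord w h - c|].
  apply: (@prim_mult_local _ _ _ _ _ ext sA V).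
  - apply: (@open_comp _ _ (fun w : stone_cech R X => coord w h) [set r | 2 * d < `|r - c|]).
      by move=> w _; exact: stone_cech_coord_continuous.
    apply: (@open_comp _ _ (fun r : R => `|r - c|) [set r | 2 * d < r]); last exact: open_gt.
    move=> r _; apply: (dist_continuous1 (f := id) (C := 1)) => [r'|y y']; first exact: cvg_id.
    by rewrite mul1r (le_trans (ler_dist_dist _ _))// opprB addrA subrK.
  - by have -> : V (phibar Q) = (2 * d < 3 * d);
      [rewrite /d [3 * _]mulrC divfK|rewrite ltr_pM2r// ltr_nat].
  - move=> P hP; have {hP} hP : 2 * d < `|sval h (phi P) - c| by exact: hP.
    apply: (acts_as_tilde (acts_asZD (-1) hz (@acts_as_one R A))).
    rewrite /g clamp_ge1 ?mulr1 ?addNr// lerBrDr ler_pdivlMr//; exact: ltW hP.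
have Q1 : prim_ideal Q (mult_one A).
  by have := prim_idealZD 1 Qz Qz1; rewrite scale1r scaleN1r addNKr.
have [b [v /eqP]] := rep_nonzero rp; apply.
by have := (prim_ideal_lr b Q1).1; rewrite mult_mul1; apply.
Qed.
End fiber_norm.

(** * The units of the fibres *)

Section completeness.
Variables (R : realType) (A : cstarAlgType R).
Implicit Types (a b : A) (z : multiplier A).

Lemma expr_small (r e : R) : 0 <= r < 1 -> 0 < e -> exists N, forall n, (N <= n)%N -> r ^+ n <= e.
Proof.
move=> /andP[r0 r1] e0; have : `|r| < 1 by rewrite ger0_norm.
move/cvg_expr/cvgrPdist_le/(_ e e0) => [N _ hN]; exists N => n /hN /=.
by rewrite sub0r normrN ger0_norm ?exprn_ge0.
Qed.

Lemma nrm_cauchy (s : nat -> A) (d : nat -> R) :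
  (forall K L, nrm (s (K + L)%N - s K) <= d K) ->
  (forall e, 0 < e -> exists N, forall n, (N <= n)%N -> d n <= e) ->
  exists l, forall e, 0 < e -> exists N, forall n, (N <= n)%N -> nrm (s n - l) <= e.
Proof.
move=> hs hd; apply: nrm_complete => e e0.
have [N hN] := hd _ (divr_gt0 e0 (ltr0Sn _ 1)); exists N => m n Nm Nn.
rewrite (le_trans (nrm_triangle (s N) _ _))// (nrm_dist (s N)).
have := hs N (m - N)%N; have := hs N (n - N)%N; rewrite !subnKC//.
have := hN N (leqnn N); lra.
Qed.

Lemma mult_incl_closed z : (forall e, 0 < e -> exists b, opn (z - mult_incl b) <= e) ->
  exists a, z = mult_incl a.
Proof.
move=> hz; have csn := @opn_csn R A.
have hz' (n : nat) : exists b, opn (z - mult_incl b) <= n.+2%:R^-1.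
  by apply: hz; rewrite invr_gt0.
have [b hb] := choice hz'.
have hd (e : R) : 0 < e -> exists N, forall n, (N <= n)%N -> n.+2%:R^-1 + n.+2%:R^-1 <= e.
  by move=> /inv_nat_small[N hN]; exists N => n /hN; rewrite mulr_natl mulr2n.
have [|l hl] := nrm_cauchy (s := b) _ hd.
  move=> K L; rewrite -opn_incl mult_inclB (le_trans (csn_triangle csn z _ _))//.
  rewrite (csn_dist csn _ z); have := hb K; have := hb (K + L)%N.
  have : (K + L).+2%:R^-1 <= K.+2%:R^-1 :> R by rewrite lef_pV2 ?posrE// ler_nat !ltnS leq_addr.
  by move: ((K + L).+2%:R^-1) (K.+2%:R^-1) => p q; lra.
exists l; apply/eqP; rewrite -subr_eq0; apply/eqP/opn_eq0/le_anti.
rewrite (csn_ge0 csn) andbT; apply: (@le_eps _ _ _ 2) => e e0; rewrite add0r.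
have [N hN] := hl e e0; have [N' hN'] := hd e e0; pose n := maxn N N'.
have h1 := hN n (leq_maxl _ _); have := hN' n (leq_maxr _ _); have := hb n.
have : 0 < n.+2%:R^-1 :> R by rewrite invr_gt0.
rewrite -opn_incl mult_inclB in h1.
have := csn_triangle csn (mult_incl (b n)) z (mult_incl l); move: h1.
move: (opn _) (opn _) (opn _) (n.+2%:R^-1) => p q r t; clear; lra.
Qed.
End completeness.

Section unit_case.
Variables (R : realType) (A : cstarAlgType R) (X : topologicalType) (phi : Prim A -> X)
  (phibar : Prim (multiplier A) -> stone_cech R X).
Hypotheses (lcX : locally_compact [set: X]) (hX : hausdorff_space X) (cphi : continuous phi)
  (ext : is_extension phi phibar) (sA : sigma_unital A).
Implicit Types (P : Prim A) (Q : Prim (multiplier A)) (a b : A) (m z : multiplier A) (x y : X).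
Local Notation iota := (stone_cech_incl R).
Local Notation J := (fiber_ideal phi).
Local Notation N := (fiber_norm phi).
Local Notation one := (mult_one A).

Let idJ y := fiber_ideal_closed_ideal phi y.
Let csnN y := fiber_norm_csn phi y.

Lemma fiber_norm_mulL y m a : quotient_norm (J y) (mulL m a) <= N y m * quotient_norm (J y) a.
Proof. exact: mult_norm_le (qn_csn (idJ y)) (qn_bounded (idJ y)) m a. Qed.

Lemma fiber_norm_incl y a : N y (mult_incl a) = quotient_norm (J y) a.
Proof. exact: mult_norm_incl (qn_csn (idJ y)) (qn_bounded (idJ y)) a. Qed.

Lemma fiber_norm_tilde y m : N y m = 0 -> mult_tilde (J y) m.
Proof.
move=> h; have key m' a : N y m' = 0 -> J y (mulL m' a).
  move=> h'; apply: (qn_eq0 (idJ y)); apply/le_anti; rewrite (qn_ge0 (idJ y)) andbT.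
  by rewrite (le_trans (fiber_norm_mulL _ _ _))// h' mul0r.
move=> a; split; first exact: key.
have := key (star m) (star a); rewrite (csn_star (csnN y)) => /(_ h).
by move/(closed_ideal_star (idJ y)); rewrite mulL_star !starK.
Qed.

Lemma fiber_norm_spow y m n : N y (spow one m n) <= N y m ^+ n.
Proof.
elim: n => [|n IH]; first exact: (csn_one_le (@mult_mulr1 R A) (csnN y)).
by rewrite exprS (le_trans (csn_M (csnN y) _ _))// ler_wpM2l// (csn_ge0 (csnN y)).
Qed.

Lemma spow_unit_incl m a n : one - m = mult_incl a ->
  exists b, one - spow one m n = mult_incl b.
Proof.
move=> hm; elim: n => [|n [b hb]]; first by exists 0; rewrite subrr mult_incl0.
exists (mulL m b + a); rewrite mult_inclD -mulL_mult_incl -hb -hm /=.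
by rewrite smulBr mult_mulr1; lmod.
Qed.

(** Neumann series: with [v = 1 - a], the sum of the [v^n a] tends to a unit modulo $J_x$. The terms
    are small only in the quotient, so each is replaced by a representative [c n] of geometrically
    small norm. *)
Lemma quotient_unit_lift x a : N x (one - mult_incl a) < 1 ->
  exists e, mult_tilde (J x) (one - mult_incl e).
Proof.
set v := one - mult_incl a => v1; have v0 := csn_ge0 (csnN x) v.
(* [r] is positive even if [N x v = 0], so that [C * r ^+ n] strictly exceeds the quotient norm of
   [v^n a], as lifting requires. *)
pose r := (N x v + 1) / 2; have r0 : 0 < r by rewrite /r; lra.
have r1 : r < 1 by rewrite /r; lra.
have vr : N x v <= r by rewrite /r; lra.
pose C := nrm a + 1; have C0 : 0 < C by rewrite ltr_wpDl ?nrm_ge0.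
pose pw n := spow one v n.
have pwr n : N x (pw n) <= r ^+ n.
  by rewrite (le_trans (fiber_norm_spow _ _ _))// lerXn2r ?nnegrE// ltW.
have ex n : exists c, nrm c <= C * r ^+ n /\ J x (c - mulR (pw n) a).
  have [|j Jj hj] := @qn_lt _ _ (J x) (idJ x) (mulR (pw n) a) (C * r ^+ n).
    rewrite -fiber_norm_incl -mulR_mult_incl (le_lt_trans (csn_M (csnN x) _ _))//.
    rewrite fiber_norm_incl.
    have := qn_le_nrm (idJ x) a; have := qn_ge0 (idJ x) a; have := pwr n.
    have := csn_ge0 (csnN x) (pw n); have := exprn_gt0 n r0; rewrite /C.
    move: (N x (pw n)) (quotient_norm _ a) (nrm a) (r ^+ n) => p q s t; nra.
  exists (mulR (pw n) a + j); split; first exact: ltW.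
  by rewrite addrC addKr.
have [c hc] := choice ex.
pose S K := \sum_(i < K) c i.
have SS K : S K.+1 = S K + c K by rewrite /S big_ord_recr.
have SN K : N x (one - mult_incl (S K) - pw K) = 0.
  elim: K => [|K IH]; first by rewrite /S big_ord0 mult_incl0 subr0 /pw /= subrr (csn0 (csnN x)).
  apply/le_anti; rewrite (csn_ge0 (csnN x)) andbT.
  have -> : one - mult_incl (S K.+1) - pw K.+1 =
      (one - mult_incl (S K) - pw K) - mult_incl (c K - mulR (pw K) a).
    rewrite SS /pw /= -/(pw K) mult_inclD mult_inclB -mulR_mult_incl /v smulBl mult_mul1.
    lmod.
  rewrite (le_trans (csnB (csnN x) _ _))// IH fiber_norm_incl (qn_mem (idJ x)) ?addr0//.
  by have [] := hc K.
have Scauchy K L : nrm (S (K + L)%N - S K) <= C / (1 - r) * r ^+ K.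
  suff : (1 - r) * nrm (S (K + L)%N - S K) <= C * (r ^+ K - r ^+ (K + L)%N).
    have := exprn_gt0 (K + L)%N r0; rewrite mulrAC ler_pdivlMr ?subr_gt0// mulrC.
    by move=> h1 h2; rewrite (le_trans h2)// ler_pM2l// lerBlDr lerDl ltW.
  elim: L => [|L IH]; first by rewrite addn0 !subrr nrm0 !mulr0.
  rewrite addnS SS addrAC exprS; have := nrmD (S (K + L)%N - S K) (c (K + L)%N).
  have [h _] := hc (K + L)%N; have s0 : 0 < 1 - r by rewrite subr_gt0.
  move: (nrm (_ + _)) (nrm (S _ - _)) (nrm (c _)) IH h => p q s; nra.
have rs e : 0 < e -> exists N, forall n, (N <= n)%N -> C / (1 - r) * r ^+ n <= e.
  move=> e0; have k0 : 0 < C / (1 - r) by rewrite divr_gt0 ?subr_gt0.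
  have [||N0 hN] := @expr_small R r (e / (C / (1 - r))); first by rewrite ltW.
    by rewrite divr_gt0.
  by exists N0 => n /hN; rewrite ler_pdivlMr// mulrC.
have [e he] := nrm_cauchy Scauchy rs.
exists e; apply: fiber_norm_tilde; apply/le_anti; rewrite (csn_ge0 (csnN x)) andbT.
apply: (@le_eps _ _ _ 2) => d d0; rewrite add0r.
have [N1 h1] := he d d0; have [|N2 h2] := @expr_small R r d _ d0; first by rewrite ltW.
pose n := maxn N1 N2; have {h1} h1 := h1 n (leq_maxl _ _); have {h2} h2 := h2 n (leq_maxr _ _).
have -> : one - mult_incl e = (one - mult_incl (S n) - pw n) + pw n + mult_incl (S n - e).
  by rewrite mult_inclB; lmod.
have := csn_D (csnN x) (one - mult_incl (S n) - pw n + pw n) (mult_incl (S n - e)).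
have := csn_D (csnN x) (one - mult_incl (S n) - pw n) (pw n).
rewrite SN fiber_norm_incl; have := qn_le_nrm (idJ x) (S n - e); have := pwr n; lra.
Qed.

Lemma acts_as_qn z (f : Prim A -> R[i]) P a : acts_as z f ->
  quotient_norm (prim_ideal P) (mulL z a) <= cabs (f P) * quotient_norm (prim_ideal P) a.
Proof.
move=> hz; have idP := prim_ideal_closed_ideal P; have csq := qn_csn idP.
rewrite -(csn_Z csq) -[mulL z a](subrK (f P *: a)) (le_trans (csn_D csq _ _))//.
by rewrite (qn_mem idP (hz a P)) add0r.
Qed.

Lemma qn_fiber_le P a : quotient_norm (prim_ideal P) a <= quotient_norm (J (phi P)) a.
Proof.
have idP := prim_ideal_closed_ideal P.
apply: (qn_lub (idJ _)) => j /(_ P erefl) jP.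
rewrite -{1}[a](addrK j) (le_trans (csnB (qn_csn idP) _ _))// (qn_mem idP jP) addr0.
exact: qn_le_nrm idP _.
Qed.

Lemma Uphi_of_unit (x : base_image phi) a :
  mult_tilde (J (set_val x)) `<=` mult_fiber_ideal phibar (set_val x) ->
  N (set_val x) (one - mult_incl a) < 1 -> Uphi phi x.
Proof.
move=> sub /quotient_unit_lift[e he]; set x0 := set_val x.
have rx : range phi x0 := set_valP x.
have p0 := mult_fiber_limsup cphi ext sA rx (sub _ he).
set v := one - mult_incl e in p0 he.
have h20 : 0 < 2^-1 :> R by rewrite invr_gt0.
have xU : nbhs x0 [set y | N y v <= 2^-1].
  have := limsup_at_near csnN (@fiber_norm_le _ _ _ phi) x0 v h20.
  by apply: filterS => y; rewrite /= -/(fiber_limsup phi x0 v) p0 add0r.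
have [g [cg g01 gx gU gK]] := @bump_function R X x0 _ lcX hX xU.
have [z hz] := base_multiplierX cphi cg g01.
(* [z] lives where [v] has norm at most one half. Since [1 - v^n] is in $A$, so is [z (1 - v^n)],
   and these elements converge to [z]. *)
have small n : opn (z ** spow one v n) <= 2^-1 ^+ n.
  apply: opn_ub => [|b]; first by rewrite exprn_ge0// ltW.
  apply: nrm_le_prim => [|P]; first by rewrite mulr_ge0 ?nrm_ge0// exprn_ge0// ltW.
  rewrite mulLM (le_trans (acts_as_qn _ _ hz))// cabsR.
  have /andP[g0 g1] := g01 (phi P); rewrite ger0_norm//.
  have q0 c := qn_ge0 (prim_ideal_closed_ideal P) c.
  have [hU|hU] := pselect (N (phi P) v <= 2^-1); last first.
    by rewrite (gU _ hU) mul0r mulr_ge0 ?nrm_ge0// exprn_ge0// ltW.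
  rewrite (le_trans (ler_piMl (q0 _) g1))// (le_trans (qn_fiber_le _ _))//.
  rewrite (le_trans (fiber_norm_mulL _ _ _))// ler_pM//.
  - exact: csn_ge0 (csnN _) _.
  - exact: qn_ge0 (idJ _) _.
  - rewrite (le_trans (fiber_norm_spow _ _ _))// lerXn2r// nnegrE ?(ltW h20)//.
    exact: csn_ge0 (csnN _) _.
  - exact: qn_le_nrm (idJ _) _.
have [c zc] : exists c, z = mult_incl c.
  apply: mult_incl_closed => d d0.
  have [|k hk] := @expr_small R 2^-1 d _ d0; first by rewrite ltW//= invf_lt1// ltr1n.
  have [|b hb] := @spow_unit_incl v e k; first by rewrite /v opprB addrC subrK.
  exists (mulL z b); rewrite -mulL_mult_incl -hb smulBr mult_mulr1 opprB addrC subrK.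
  by rewrite (le_trans (small k))// hk.
have Zc : Zprime phi c.
  exists (fun y => (g y)%:C); last by rewrite -zc; exact: acts_as_dauns_hofmann hz.
  split.
    move=> y; apply/cvgrPdist_lt => _ /posC[d d0 ->].
    apply: filterS (near_dist y cg d0) => y'.
    by rewrite -rmorphB/= cabsE cabsR ltcR.
  move=> _ /posC[d d0 ->]; rewrite (_ : [set _ | _] = [set y | d <= g y]); first exact: gK.
  apply/seteqP; split => y /=; rewrite cabsE cabsR lecR.
    by have /andP[g0 _] := g01 y; rewrite ger0_norm.
  by move/le_trans; apply; exact: ler_norm.
(* [c] acts as 1 over [x]; were it in $J_x$, every [b] would lie in [P]. *)
move=> /(_ c Zc) Jc; case: rx => P _ Px.
have [b nb] := prim_ideal_proper P; apply: nb.
have idP := prim_ideal_closed_ideal P.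
have := hz b P; rewrite Px gx zc mulL_incl scale1r => h.
have := closed_idealB idP (closed_idealMr idP b (Jc P Px)) h.
by rewrite opprB addrC subrK.
Qed.

End unit_case.

(** Monotonicity for a seminorm [p] below the complete norm: [upper_state] agrees with [p] on
    positive elements and is at most 0 on their negatives. *)
Lemma csn_pos_mono (R : realType) (B : starAlgType R[i]) (one : B)
    (nm p : B -> R) (smul1r : forall a : B, one ** a = a)
    (smulr1 : forall a : B, a ** one = a)
    (csn_nm : cstar_seminorm nm) (nm_eq0 : forall a, nm a = 0 -> a = 0)
    (nm_complete : seq_complete nm) (csn : cstar_seminorm p)
    (p_le : forall a, p a <= nm a) (p_one : p one = 1) (c d : B) :
  pos one nm c -> pos one nm d -> p c <= p (c + d).
Proof.
have sqrt := pos_sqrt smul1r smulr1 csn_nm nm_eq0 nm_complete.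
move=> /sqrt[s [ss <- _ _]] /sqrt[r [sr <- _ _]].
have h1 := upper_state_ge smul1r smulr1 csn_nm nm_eq0 nm_complete csn p_one s.
have h2 := upper_state_neg smul1r smulr1 csn_nm nm_eq0 nm_complete csn p_le p_one r.
rewrite ss in h1; rewrite sr in h2.
have h3 := sublinearD (upper_state_sublinear csn p_one) (s ** s + r ** r) (- (r ** r)).
rewrite addrK in h3.
have := upper_state_le_p csn p_one (s ** s + r ** r); lra.
Qed.

Lemma mulL_sub_add (R : realType) (A : cstarAlgType R) (p q t d : multiplier A) k a :
  mulL (p + t ** d - (q + k *: d)) a =
  mulL (p - q) a + (mulL t (mulL d a) - k *: mulL d a).
Proof. by rewrite !mulLD !mulLN !mulLD mulLM mulLZ; lmod. Qed.

(** * The series of the non-unital case *)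

Section strict_series.
Variables (R : realType) (A : cstarAlgType R) (X : topologicalType) (phi : Prim A -> X).
Hypothesis cphi : continuous phi.
Variable u : nat -> A.
Hypotheses (u_pos : forall n, positive_elt (u n)) (u1 : forall n, nrm (u n) <= 1)
  (u_incr : forall n, positive_elt (u n.+1 - u n))
  (ua : forall a (e : R), 0 < e -> exists N, forall n, (N <= n)%N -> nrm (u n ** a - a) <= e)
  (au : forall a (e : R), 0 < e -> exists N, forall n, (N <= n)%N -> nrm (a ** u n - a) <= e).
Local Notation T := (base_image phi).
Local Notation one := (mult_one A).
Local Notation J := (fiber_ideal phi).
Local Notation N := (fiber_norm phi).
Local Notation cor := (base_corestrict phi).
Implicit Types (a b : A) (P : Prim A) (y : T) (m : multiplier A).

Let csn := @opn_csn R A.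
Let idJ y := fiber_ideal_closed_ideal phi (set_val y).
Let csnN y := fiber_norm_csn phi (set_val y).

Variable s : nat -> T -> R.
Hypotheses (cs : forall n, continuous (s n)) (s01 : forall n y, 0 <= s n y <= 1)
  (s_incr : forall n y, s n y <= s n.+1 y).

(** A partial sum as seen in the fibre over [y], where the functions [s n] are scalars. *)
Definition series_at K y : multiplier A :=
  \sum_(n < K) (s n.+1 y - s n y)%:C *: (one - mult_incl (u n.+1)).

Let series_atS K y : series_at K.+1 y = series_at K y +
  (s K.+1 y - s K y)%:C *: (one - mult_incl (u K.+1)).
Proof. by rewrite /series_at big_ord_recr. Qed.

Lemma unit_sa n : star (u n) = u n.
Proof. by have [c ->] := u_pos n; rewrite starM starK. Qed.

Lemma pos_sub_unit n : pos one (@opn R A) (one - mult_incl (u n)).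
Proof.
have := @pos_subr _ _ one (@opn R A) (@mult_mulr1 R A) csn (mult_incl (u n)) 1.
by rewrite -mult_incl_star unit_sa scale1r opn_incl => /(_ erefl (u1 n)).
Qed.

Lemma s_mono K L y : s K y <= s (K + L)%N y.
Proof. by elim: L => [|L IH]; rewrite ?addn0// addnS (le_trans IH). Qed.

(* Abel summation: [sum_n (s_(n+1) - s_n)(1 - u_(n+1)) - (s_K - s_0)(1 - u_K)] is a sum of
   positive multiples of the increments of [u]. *)
Lemma pos_series_at K y :
  pos one (@opn R A) (series_at K y - (s K y - s 0%N y)%:C *: (one - mult_incl (u K))).
Proof.
elim: K => [|K IH].
  by rewrite /series_at big_ord0 !subrr scale0r subr0; exact: pos0.
have -> : series_at K.+1 y - (s K.+1 y - s 0%N y)%:C *: (one - mult_incl (u K.+1)) =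
    (series_at K y - (s K y - s 0%N y)%:C *: (one - mult_incl (u K))) +
    (s K y - s 0%N y)%:C *: mult_incl (u K.+1 - u K).
  by rewrite series_atS mult_inclB; lmod.
apply: (posD csn) IH _; apply: (posZ csn); first by rewrite subr_ge0 -[K]add0n s_mono.
have [c ->] := u_incr K; rewrite mult_inclM mult_incl_star.
exact: (pos_star_smul (@mult_mul1 R A) (@mult_mulr1 R A) csn (@opn_eq0 R A) (@opn_complete R A)).
Qed.

Lemma fiber_norm_series_at K y :
  (s K y - s 0%N y) * N (set_val y) (one - mult_incl (u K)) <= N (set_val y) (series_at K y).
Proof.
have d0 : 0 <= s K y - s 0%N y by rewrite subr_ge0 -[K]add0n s_mono.
rewrite -{1}(ger0_norm d0) -(csnZR (csnN y)).
rewrite -[series_at K y](subrK ((s K y - s 0%N y)%:C *: (one - mult_incl (u K)))) [in leRHS]addrC.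
apply: (csn_pos_mono (@mult_mul1 R A) (@mult_mulr1 R A) csn (@opn_eq0 R A) (@opn_complete R A)).
- exact: csnN.
- exact: fiber_norm_le.
- exact: fiber_norm_one (set_valP y).
- exact/(posZ csn)/pos_sub_unit.
- exact: pos_series_at.
Qed.

(** The coefficients [tt n] act as nonnegative functions with sum at most 1, so [tt n] applied to a
    null sequence is summable in norm. The null sequences are [a - u n.+1 ** a] on the left and
    [a - a ** u n.+1] on the right. *)
Lemma strict_series : exists b : multiplier A, forall y K0,
  (forall K, (K0 <= K)%N -> s K y = s K0 y) ->
  N (set_val y) (b - series_at K0 y) = 0.
Proof.
have [t ht] := choice (fun n => base_multiplier cphi (@cs n) (s01 n)).
pose tt n := -1 *: t n + t n.+1.
have htt n : acts_as (tt n) (fun P => (s n.+1 (cor P) - s n (cor P))%:C).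
  have e (p q : R) : (p - q)%:C = -1 * q%:C + p%:C :> R[i] by rewrite rmorphB/= mulN1r addrC.
  by move=> a P; rewrite e; exact: (acts_asZD (-1) (ht n) (ht n.+1)).
pose S (d : nat -> A) K := \sum_(n < K) mulL (tt n) (d n).
have SS d K : S d K.+1 = S d K + mulL (tt K) (d K) by rewrite /S big_ord_recr.
have Sb d K D : 0 <= D -> (forall n, (K <= n)%N -> nrm (d n) <= D) -> forall L,
    nrm (S d (K + L)%N - S d K) <= D.
  move=> D0 hD L; apply: nrm_le_prim => // P; have idP := prim_ideal_closed_ideal P.
  have csq := qn_csn idP; set y := cor P.
  suff : quotient_norm (prim_ideal P) (S d (K + L)%N - S d K) <= (s (K + L)%N y - s K y) * D.
    move/le_trans; apply; rewrite ler_piMl//.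
    by have := s01 (K + L)%N y; have := s01 K y; lra.
  elim: L => [|L IH]; first by rewrite addn0 !subrr mul0r (csn0 csq).
  rewrite addnS SS addrAC (le_trans (csn_D csq _ _))//.
  have := acts_as_qn P (d (K + L)%N) (htt (K + L)%N).
  rewrite cabsR -/y ger0_norm ?subr_ge0//.
  have h : quotient_norm (prim_ideal P) (d (K + L)%N) <= D.
    by rewrite (le_trans (qn_le_nrm idP _))// hD// leq_addr.
  have h' : 0 <= s (K + L).+1 y - s (K + L)%N y by rewrite subr_ge0.
  have := ler_wpM2l h' h; lra.
have Slim d : (forall e, 0 < e -> exists N, forall n, (N <= n)%N -> nrm (d n) <= e) ->
    exists l : A, S d @ \oo --> l.
  move=> hd; have [|l hl] := @nrm_complete R A (S d); last by exists l; apply/cvg_nrm.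
  move=> e e0; have e20 : 0 < e / 2 by rewrite divr_gt0.
  have [N0 hN] := hd _ e20; exists N0 => m n Nm Nn.
  rewrite (le_trans (nrm_triangle (S d N0) _ _))// (nrm_dist (S d N0)).
  have := Sb d N0 (e / 2) (ltW e20) hN (m - N0)%N.
  by have := Sb d N0 (e / 2) (ltW e20) hN (n - N0)%N; rewrite !subnKC//; lra.
pose m_ K := \sum_(n < K) tt n ** (one - mult_incl (u n.+1)).
have mS K : m_ K.+1 = m_ K + tt K ** (one - mult_incl (u K.+1)) by rewrite /m_ big_ord_recr.
have mL a K : mulL (m_ K) a = S (fun n => a - u n.+1 ** a) K.
  elim: K => [|K IH]; first by rewrite /m_ /S !big_ord0 mulL0.
  by rewrite mS SS mulLD IH mulLM.
have mR a K : mulR (m_ K) a = S (fun n => a - a ** u n.+1) K.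
  elim: K => [|K IH]; first by rewrite /m_ /S !big_ord0.
  rewrite mS SS mulRD IH mulRM -(central_mulL_mulR _ (acts_as_central (htt K))).
  by rewrite mulLBr mulL_smul.
have limL a : exists l : A, (fun K => mulL (m_ K) a) @ \oo --> l.
  rewrite (funext (mL a)); apply: Slim => e /(ua a)[M hM]; exists M => n Mn.
  by rewrite nrm_dist; apply: hM; exact: leqW.
have limR a : exists l : A, (fun K => mulR (m_ K) a) @ \oo --> l.
  rewrite (funext (mR a)); apply: Slim => e /(au a)[M hM]; exists M => n Mn.
  by rewrite nrm_dist; apply: hM; exact: leqW.
have [L hL] := choice limL; have [S' hS'] := choice limR.
(* The bound 2 is that of [a - u n.+1 ** a] relative to [a]. *)
have m2 K : opn (m_ K) <= 2.
  apply: opn_ub => // a; rewrite mL.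
  have -> : S (fun n => a - u n.+1 ** a) K =
      S (fun n => a - u n.+1 ** a) (0 + K)%N - S (fun n => a - u n.+1 ** a) 0%N.
    by rewrite /S big_ord0 subr0.
  apply: Sb => [|n _]; first by rewrite mulr_ge0 ?nrm_ge0.
  have := nrmB a (u n.+1 ** a); have := csn_M (@nrm_csn R A) (u n.+1) a.
  by have := ler_wpM2r (nrm_ge0 a) (u1 n.+1); lra.
have [b [bL _]] := strict_limit m2 hL hS'; exists b => y K0 sK0.
apply: fiber_norm_eq0 => a P Py; have idP := prim_ideal_closed_ideal P.
have yE : cor P = y by apply: val_inj; exact: Py.
have key K : prim_ideal P (mulL (m_ K - series_at K y) a).
  elim: K => [|K IH].
    by rewrite /m_ /series_at !big_ord0 subrr mulL0; exact: closed_ideal0 idP.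
  have -> : mulL (m_ K.+1 - series_at K.+1 y) a = mulL (m_ K - series_at K y) a +
      (mulL (tt K) (mulL (one - mult_incl (u K.+1)) a) -
       (s K.+1 y - s K y)%:C *: mulL (one - mult_incl (u K.+1)) a).
    by rewrite mS series_atS mulL_sub_add.
  by apply: (closed_idealD idP) => //; have := htt K (mulL (one - mult_incl (u K.+1)) a) P;
    rewrite yE.
have sE K : (K0 <= K)%N -> series_at K y = series_at K0 y.
  move=> /subnKC <-; elim: (K - K0)%N => [|l IH]; first by rewrite addn0.
  rewrite addnS series_atS IH !sK0 ?subrr ?scale0r ?addr0 ?leq_addr//.
  by rewrite -addnS leq_addr.
apply: (@closed_cvg _ _ \oo _ (fun K => mulL (m_ K) a - mulL (series_at K0 y) a)
  (prim_ideal P) (closed_ideal_closed idP)).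
  by exists K0 => // K /sE KE; have := key K; rewrite KE mulLD mulLN.
by rewrite mulLD mulLN bL; apply: cvgB; [exact: hL|exact: cvg_cst].
Qed.
End strict_series.

(** * Necessity: fibres without a unit *)

Section nonunit_case.
Variables (R : realType) (A : cstarAlgType R) (X : topologicalType) (phi : Prim A -> X)
  (phibar : Prim (multiplier A) -> stone_cech R X).
Hypotheses (lcX : locally_compact [set: X]) (hX : hausdorff_space X) (cphi : continuous phi)
  (ext : is_extension phi phibar) (sA : sigma_unital A) (Acont : continuous_C0_algebra phi).
Local Notation T := (base_image phi).
Local Notation one := (mult_one A).
Local Notation J := (fiber_ideal phi).
Local Notation N := (fiber_norm phi).
Implicit Types (a b : A) (P : Prim A) (m : multiplier A).

Let idJ y := fiber_ideal_closed_ideal phi y.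
Let csnN y := fiber_norm_csn phi y.

Lemma fiber_norm_witness (x : X) m : 1 <= N x m ->
  exists a, nrm a <= 1 /\ 2^-1 <= quotient_norm (J x) (mulL m a).
Proof.
move=> m1; have csq := qn_csn (idJ x).
have [a ha] : exists a, 2^-1 * quotient_norm (J x) a < quotient_norm (J x) (mulL m a).
  apply: contrapT => hn; suff : N x m <= 2^-1 by lra.
  apply: mult_norm_ub => [|a]; first by rewrite invr_ge0.
  by rewrite leNgt; apply/negP => h; apply: hn; exists a.
(* The class of [a / t] has norm below 1 and lifts to the unit ball, while [m] sends it to norm one
   half. *)
pose t := 2 * quotient_norm (J x) (mulL m a).
have at' : quotient_norm (J x) a < t by rewrite /t; lra.
have t0 : 0 < t by apply: le_lt_trans at'; exact: csn_ge0 csq a.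
have [j Jj jt] := qn_lt (idJ x) at'.
exists ((t^-1)%:C *: (a + j)); rewrite mulLZr (csnZR csq) nrmZ cabsR.
rewrite gtr0_norm ?invr_gt0//; split; first by rewrite mulrC ler_pdivrMr// mul1r ltW.
rewrite mulLDr mulrC ler_pdivlMr//.
have := csnB csq (mulL m a + mulL m j) (mulL m j).
by rewrite addrK (qn_mem (idJ x) (ideal_mulL (idJ x) m Jj)) /t; lra.
Qed.

Section witnesses.
Variables (u a_ : nat -> A) (x : T).
Hypotheses (u_pos : forall n, positive_elt (u n)) (u1 : forall n, nrm (u n) <= 1)
  (u_incr : forall n, positive_elt (u n.+1 - u n))
  (ua : forall a (e : R), 0 < e -> exists N, forall n, (N <= n)%N -> nrm (u n ** a - a) <= e)
  (au : forall a (e : R), 0 < e -> exists N, forall n, (N <= n)%N -> nrm (a ** u n - a) <= e).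

Definition defect n (y : T) : R :=
  quotient_norm (J (set_val y)) (mulL (one - mult_incl (u n)) (a_ n)).

Hypotheses (a1 : forall n, nrm (a_ n) <= 1) (ax : forall n, 2^-1 <= defect n x).

(** 0 where the defect is at least 1/2, as at [x], and 1 where it is at most 1/4. *)
Definition gap n y := clamp (2 - 4 * defect n y).

Lemma gap_continuous n : continuous (gap n).
Proof.
apply: (dist_continuous1 (f := defect n) (C := 4)) => [y|y z].
  apply: (@continuous_comp _ _ _ set_val (fun y =>
    quotient_norm (J y) (mulL (one - mult_incl (u n)) (a_ n)))).
    exact: set_val_base_continuous.
  exact: Acont.
rewrite (le_trans (clamp_dist _ _))//.
have -> : 2 - 4 * defect n y - (2 - 4 * defect n z) = 4 * (defect n z - defect n y) by ring.
by rewrite normrM ger0_norm// distrC.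
Qed.

Lemma gap_ge0 n y : 0 <= gap n y. Proof. by case/andP: (clamp01 (2 - 4 * defect n y)). Qed.

Lemma gap_x n : gap n x = 0.
Proof. by apply: clamp_le0; have := ax n; lra. Qed.

(** Near [x] all gaps vanish, so all defects are at least 1/2. An element [a] of $Z'(A)$ acting over
    [y] as a nonzero scalar would keep [a (1 - u n)] above half its modulus for every [n], while
    this tends to 0. *)
Lemma Wphi_of_P_point : P_point R x -> interior (Wphi phi) x.
Proof.
move=> px; have := P_point_bigcap px gap_continuous gap_x gap_ge0.
apply: filterS => y hy; rewrite /Wphi /Uphi /=; apply => a Za; apply: contrapT => na.
have [f [_ act fy]] := Zprime_acts Za na.
have d2 n : 2^-1 <= defect n y.
  rewrite leNgt; apply/negP => h; have := hy n; rewrite /gap /clamp.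
  by case: (leP 0 (2 - 4 * defect n y)) => h1; case: (leP 1 _) => h2; lra.
have f0 : 0 < cabs (f (set_val y)).
  by rewrite lt_neqAle cabs_ge0 andbT eq_sym; apply: contra fy => /eqP/cabs_eq0 ->.
have [|M hM] := au a (e := cabs (f (set_val y)) / 4); first by rewrite divr_gt0.
have := hM M (leqnn M); rewrite leNgt => /negP; apply.
have csq := qn_csn (idJ (set_val y)).
set c := mulL (one - mult_incl (u M)) (a_ M).
have h1 : cabs (f (set_val y)) * defect M y <= quotient_norm (J (set_val y)) (a ** c).
  rewrite /defect -/c -(csn_Z csq).
  have Jd : J (set_val y) (a ** c - f (set_val y) *: c).
    by move=> P Py; have := act c P; rewrite /= Py.
  have := csnB csq (a ** c) (a ** c - f (set_val y) *: c).
  by rewrite subKr (qn_mem (idJ _) Jd) addr0.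
have h2 : nrm (a ** c) <= nrm (a ** u M - a).
  have -> : a ** c = - ((a ** u M - a) ** a_ M).
    by rewrite /c mulLD mulLN mulL_incl /= !smulE; lmod.
  rewrite nrmN (le_trans (csn_M (@nrm_csn R A) _ _))// ler_piMr ?nrm_ge0//.
have := qn_le_nrm (idJ (set_val y)) (a ** c); have := ler_wpM2l (ltW f0) (d2 M); lra.
Qed.

Section running_max.
Variable f : T -> R.
Hypotheses (cf : continuous f) (fx : f x = 0).

Fixpoint run_gap n y : R := if n is k.+1 then Num.max (run_gap k y) (gap n y) else gap 0 y.

(** The $s_n$ of the overview. The index [n.+1] is such that [step M y < 1] bounds [defect M.+1 y]
    from below, which belongs to the [u M.+1] of the term in which [step] passes from index [M] to
    [M.+1]. *)
Definition step n y : R := Num.max (clamp (2 ^+ n * `|f y|)) (run_gap n.+1 y).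

Lemma run_gap_continuous n : continuous (run_gap n).
Proof.
elim: n => [|n IH]; first exact: gap_continuous.
apply: (dist_continuous (f := run_gap n) (g := gap n.+1) (C := 1)) => // [|y z].
  exact: gap_continuous.
by rewrite mul1r maxr_dist.
Qed.

Lemma run_gap01 n y : 0 <= run_gap n y <= 1.
Proof.
elim: n => [|n /andP[h0 h1]] /=; first exact: clamp01.
by rewrite le_max h0 ge_max h1 /=; case/andP: (clamp01 (2 - 4 * defect n.+1 y)).
Qed.

Lemma gap_le_run n y : gap n y <= run_gap n y.
Proof. by case: n => [|n] //=; rewrite le_max lexx orbT. Qed.

Lemma run_gap_x n : run_gap n x = 0.
Proof. by elim: n => [|n IH] /=; rewrite ?IH gap_x ?maxxx. Qed.

Lemma step_continuous n : continuous (step n).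
Proof.
apply: (dist_continuous (f := f) (g := run_gap n.+1) (C := 2 ^+ n)) => // [|y z].
  exact: run_gap_continuous.
have n1 : 1 <= 2 ^+ n :> R by rewrite exprn_ege1// ler1n.
have n0 : 0 <= 2 ^+ n :> R by rewrite (le_trans ler01).
rewrite (le_trans (maxr_dist _ _ _ _))// mulrDr lerD//; last first.
  by rewrite -[leLHS]mul1r ler_wpM2r.
rewrite (le_trans (clamp_dist _ _))// -mulrBr normrM (ger0_norm n0) ler_wpM2l//.
exact: ler_dist_dist.
Qed.

Lemma step01 n y : 0 <= step n y <= 1.
Proof.
have /andP[h0 h1] := run_gap01 n.+1 y; have /andP[k0 k1] := clamp01 (2 ^+ n * `|f y|).
by rewrite /step le_max k0 ge_max k1.
Qed.

Lemma clamp_mono (r t : R) : r <= t -> clamp r <= clamp t.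
Proof.
move=> rt; rewrite /clamp le_min ge_min lexx /= ge_min ge_max !le_max lexx rt /=.
by rewrite !orbT.
Qed.

Lemma step_incr n y : step n y <= step n.+1 y.
Proof.
have h1 : clamp (2 ^+ n * `|f y|) <= clamp (2 ^+ n.+1 * `|f y|).
  by rewrite clamp_mono// exprS ler_wpM2r// ler_peMl ?exprn_ge0// ler1n.
have h2 : run_gap n.+1 y <= run_gap n.+2 y 
  by change (run_gap n.+1 y <= Num.max (run_gap n.+1 y) (gap n.+2 y)); rewrite le_max lexx.
rewrite /step; move: (run_gap n.+1 y) (run_gap n.+2 y) h2 => p q h2.
by rewrite ge_max !le_max h1 h2 orbT.
Qed.

Lemma step_x n : step n x = 0.
Proof. by rewrite /step run_gap_x fx normr0 mulr0 clamp_le0// maxxx. Qed.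

Lemma P_point_step :
  mult_tilde (J (set_val x)) `<=` mult_fiber_ideal phibar (set_val x) ->
  \forall y \near x, f y = 0.
Proof.
move=> sub.
have [b hb] := strict_series cphi u1 ua au step_continuous step01 step_incr.
(* All steps vanish at [x], so there [b] agrees with the empty partial sum. *)
have bx : mult_tilde (J (set_val x)) b.
  apply: fiber_norm_tilde; have := hb x 0%N; rewrite /series_at big_ord0 subr0; apply.
  by move=> K _; rewrite !step_x.
have p0 := mult_fiber_limsup cphi ext sA (set_valP x) (sub _ bx).
(* Any bound below 1/8 will do: where [f] is nonzero, [b] will have norm at least 1/2 times 1/4. *)
have e0 : 0 < 16^-1 :> R by rewrite invr_gt0.
have h1 : \forall y \near x, N (set_val y) b <= 16^-1.
  have h := limsup_at_near csnN (@fiber_norm_le _ _ _ phi) (set_val x) b e0.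
  rewrite -/(fiber_limsup phi (set_val x) b) p0 in h.
  have h' : nbhs x (set_val @^-1` [set y | N y b <= 0 + 16^-1]) by exact: set_val_base_continuous h.
  by apply: filterS h' => y; rewrite /= add0r.
have h20 : 0 < 2^-1 :> R by rewrite invr_gt0.
have h2 : \forall y \near x, `|step 0 x - step 0 y| < 2^-1.
  exact: near_dist (@step_continuous 0%N) h20.
apply: filterS2 h1 h2 => y b16; rewrite step_x sub0r normrN => s2.
apply/eqP; apply: contraT => fy; exfalso.
have ex1 : exists k, step k y == 1.
  have [k hk] : exists k : nat, 1 <= 2 ^+ k * `|f y|.
    have [||k hk] := @expr_small R 2^-1 `|f y|; first by rewrite ltW//= invf_lt1// ltr1n.
      by rewrite normr_gt0.
    exists k; have := hk k (leqnn k); rewrite exprVn -[X in X <= _]mulr1.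
    by rewrite ler_pdivrMl ?exprn_gt0.
  exists k; rewrite eq_le; have /andP[_ ->] := step01 k y.
  by rewrite /step le_max clamp_ge1// lexx.
(* [M.+1] is the first index with step 1; index 0 is excluded because [step 0 y < 1/2]. *)
case: (ex_minnP ex1) => -[|M] /eqP sM minM.
  by move: s2; rewrite sM normr1; lra.
have sM' : step M y < 1.
  rewrite lt_neqAle; case/andP: (step01 M y) => _ ->; rewrite andbT.
  by apply/negP => /minM; rewrite ltnn.
have gM : gap M.+1 y < 1.
  apply: le_lt_trans sM'; rewrite /step le_max gap_le_run orbT //.
have dM : 4^-1 <= defect M.+1 y.
  rewrite leNgt; apply/negP => h; move: gM; rewrite /gap clamp_ge1 ?ltxx//; lra.
have NM : 4^-1 <= N (set_val y) (one - mult_incl (u M.+1)).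
  rewrite (le_trans dM)// (le_trans (fiber_norm_mulL _ _ _ _))//.
  rewrite ler_piMr ?(csn_ge0 (csnN _))//.
  by rewrite (le_trans (qn_le_nrm (idJ _) _)).
(* The steps are constant from [M.+1] on, so over [y] the series is a finite sum that dominates
   [(1 - step 0 y) (1 - u M.+1)]. *)
have sK K : (M.+1 <= K)%N -> step K y = step M.+1 y.
  move=> MK; apply/le_anti; rewrite sM; case/andP: (step01 K y) => _ ->/=.
  by rewrite -sM -(subnKC MK); exact: (s_mono step_incr).
have Nb := hb y M.+1 sK.
have h3 := fiber_norm_series_at u_pos u1 u_incr step_incr M.+1 y.
have h4 := csnB (csnN (set_val y)) b (b - series_at u step M.+1 y).
rewrite subKr Nb addr0 in h4; rewrite sM in h3.
have s0 : step 0 y < 2^-1 by apply: le_lt_trans s2; exact: ler_norm.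
move: (N _ (series_at _ _ _ _)) h3 h4 => q; move: (N _ _) NM b16 => p r; nra.
Qed.

End running_max.
End witnesses.

Lemma strictly_closed_necessary (x : T) :
  mult_tilde (J (set_val x)) `<=` mult_fiber_ideal phibar (set_val x) ->
  Uphi phi x \/ (interior (Wphi phi) x /\ P_point R x).
Proof.
move=> sub; have [u [u_pos u1 u_incr ua au]] := sigma_unitalP sA.
have [[n hn]|hn] := pselect (exists n, N (set_val x) (one - mult_incl (u n)) < 1).
  left; exact: (Uphi_of_unit lcX hX cphi ext sA sub hn).
have w n : exists a, nrm a <= 1 /\
    2^-1 <= quotient_norm (J (set_val x)) (mulL (one - mult_incl (u n)) a).
  by apply: fiber_norm_witness; rewrite leNgt; apply/negP => h; apply: hn; exists n.
have [a_ ha] := choice w.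
have px : P_point R x.
  move=> f cf fx; apply: (P_point_step u_pos u1 u_incr ua au (a_ := a_)) => //.
    by move=> n; have [] := ha n.
  by move=> n; have [] := ha n.
right; split => //; apply: (Wphi_of_P_point au (a_ := a_)) => //.
  by move=> n; have [] := ha n.
by move=> n; have [] := ha n.
Qed.

End nonunit_case.

Unset Implicit Arguments.

Theorem theorem4p6 (R : realType) (A : cstarAlgType R) (X : topologicalType)
    (phi : Prim A -> X)
    (phibar : Prim (multiplier A) -> stone_cech R X)
    (HphiX : C0_algebra phi)
    (Hphibar : is_extension phi phibar)
    (Acont : continuous_C0_algebra phi)
    (Asigma : sigma_unital A)
    (x : base_image phi) :
  strictly_closed (mult_fiber_ideal phibar (set_val x)) <->
  (Uphi phi x \/ (interior (Wphi phi) x /\ P_point R x)).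
Proof.
case: HphiX => lcX hX cphi.
apply: (iff_trans (strictly_closed_mult_fiberP lcX hX Hphibar Asigma _)); split.
  exact: (strictly_closed_necessary lcX hX cphi Hphibar Asigma Acont).
case=> [Ux|[_ px]].
  exact: (Uphi_sub lcX hX cphi Hphibar Asigma Ux).
exact: (P_point_sub lcX hX Hphibar Asigma Acont px).
Qed.
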